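(* Let $d>1$ and let $\{z_n\}$ be a separated sequence of points in the upper half-space $\mathbb{R}_+^{d+1}$. (a) Assume that $\{z_n\}$ is an interpolating sequence for $h^+(\mathbb{R}_+^{d+1})$. Then there exist constants $M>0$ and $0<\alpha<1$ such that $$\#\{z_k : \beta(z_k,z_n)\le l\}\le M\,2^{\alpha d l},\qquad l,n=1,2,\dots. \qquad ( * )$$ (b) Assume that there exist constants $M>0$ and $0<\alpha<1$ such that $( * )$ holds. Then $\{z_n\}$ can be split into a finite number of disjoint subsequences $\Lambda_1,\dots,\Lambda_N$, that is, $\{z_n\}=\Lambda_1\cup\dots\cup\Lambda_N$, such that $\Lambda_i\cup\Lambda_j$ is an interpolating sequence for $h^+(\mathbb{R}_+^{d+1})$ for any $i,j=1,\dots,N$.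
   Context: $\mathbb{R}_+^{d+1}=\{(x,y): x\in\mathbb{R}^d,\ y>0\}$, and $h^+(\mathbb{R}_+^{d+1})$ is the cone of positive harmonic functions in $\mathbb{R}_+^{d+1}$. The hyperbolic distance between $z,w\in\mathbb{R}_+^{d+1}$ is normalized as $$\beta(z,w)=\log_2\frac{1+\rho(z,w)}{1-\rho(z,w)},\qquad \rho(z,w)=\frac{|z-w|}{|z-\bar w|},\qquad \bar w=(w_1,\dots,w_d,-w_{d+1}).$$ A sequence $\{z_n\}\subset\mathbb{R}_+^{d+1}$ is separated if $\inf_{n\ne m}\beta(z_n,z_m)>0$. A sequence $\{z_n\}\subset\mathbb{R}_+^{d+1}$ is an interpolating sequence for $h^+(\mathbb{R}_+^{d+1})$ if there exists a constant $\varepsilon=\varepsilon(\{z_n\})>0$ such that for any sequence $\{w_n\}$ of positive values satisfying $|\log_2 w_n-\log_2 w_m|\le\varepsilon\,\beta(z_n,z_m)$ for all $n,m=1,2,\dots$, there exists $u\in h^+(\mathbb{R}_+^{d+1})$ with $u(z_n)=w_n$ for all $n=1,2,\dots$. *)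

(* Defs.v *)
From mathcomp Require Import all_boot all_order all_algebra finmap.
From mathcomp Require Import all_classical all_reals all_analysis.

Set Implicit Arguments.
Unset Strict Implicit.
Unset Printing Implicit Defensive.

Import Order.TTheory GRing.Theory Num.Theory.
Import numFieldNormedType.Exports.

Local Open Scope classical_set_scope.
Local Open Scope ring_scope.

(* Points (x, y) of R^d x R are row vectors of length d.+1; y is the entry of
   index ord_max. *)
Definition half_space {R : realType} {d : nat} : set 'rV[R]_d.+1 :=
  [set z | 0 < z ord0 ord_max].

(* The norm `|_| of MathComp-Analysis on 'rV[R]_n is the sup norm. *)
Definition euclid {R : realType} {n : nat} (z : 'rV[R]_n) : R :=
  Num.sqrt (\sum_(i < n) z ord0 i ^+ 2).

Definition reflection {R : realType} {d : nat} (w : 'rV[R]_d.+1) :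
    'rV[R]_d.+1 :=
  \row_i (if i == ord_max then - w ord0 i else w ord0 i).

Definition log2 {R : realType} (x : R) : R := ln x / ln 2.

Definition rho {R : realType} {d : nat} (z w : 'rV[R]_d.+1) : R :=
  euclid (z - w) / euclid (z - reflection w).

Definition beta {R : realType} {d : nat} (z w : 'rV[R]_d.+1) : R :=
  log2 ((1 + rho z w) / (1 - rho z w)).

Definition basis_vec {R : realType} {d : nat} (i : 'I_d.+1) : 'rV[R]_d.+1 :=
  delta_mx ord0 i.

(* All partial derivatives of order at most 2 exist and are continuous on the
   open set D. *)
Definition C2_on {R : realType} {d : nat} (D : set 'rV[R]_d.+1)
    (u : 'rV[R]_d.+1 -> R) : Prop :=
  forall z, D z ->
  {for z, continuous u} /\
  forall i, [/\ derivable u z (basis_vec i),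
    {for z, continuous ('D_(basis_vec i) u)} &
    forall j, derivable ('D_(basis_vec i) u) z (basis_vec j) /\
      {for z, continuous ('D_(basis_vec j) ('D_(basis_vec i) u))}].

Definition laplacian {R : realType} {d : nat} (u : 'rV[R]_d.+1 -> R)
    (z : 'rV[R]_d.+1) : R :=
  \sum_(i < d.+1) 'D_(basis_vec i) ('D_(basis_vec i) u) z.

Definition harmonic_on {R : realType} {d : nat} (D : set 'rV[R]_d.+1)
    (u : 'rV[R]_d.+1 -> R) : Prop :=
  C2_on D u /\ forall z, D z -> laplacian u z = 0.

(* Elements are total functions; their values off the half-space are
   irrelevant. *)
Definition hplus {R : realType} {d : nat} : set ('rV[R]_d.+1 -> R) :=
  [set u | harmonic_on half_space u /\ forall z, half_space z -> 0 < u z].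

Definition separated_seq {R : realType} {d : nat} (z : nat -> 'rV[R]_d.+1) :
    Prop :=
  0 < inf [set b : R | exists n m, n <> m /\ b = beta (z n) (z m)].

(* The subsequence (z_n), n \in A, is interpolating; A = setT gives the full
   sequence. *)
Definition interpolating {R : realType} {d : nat} (A : set nat)
    (z : nat -> 'rV[R]_d.+1) : Prop :=
  exists2 eps : R, 0 < eps &
  forall w : nat -> R,
    (forall n, A n -> 0 < w n) ->
    (forall n m, A n -> A m ->
       `|log2 (w n) - log2 (w m)| <= eps * beta (z n) (z m)) ->
    exists2 u, hplus u & forall n, A n -> u (z n) = w n.

(* fset_set is a junk value on infinite sets, hence the finite_set clause. *)
Definition growth_bound {R : realType} {d : nat} (z : nat -> 'rV[R]_d.+1)
    (M alpha : R) : Prop :=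
  forall l n : nat, (0 < l)%N ->
    let B := z @` [set k | beta (z k) (z n) <= l%:R] in
    finite_set B /\
    (#|` fset_set B|)%:R <= M * 2 `^ (alpha * d%:R * l%:R).

(* Main.v *)
(* All harmonic functions are handled through the minimum principle and finite
   sums of the Poisson kernels y / |z - xi|^(d+1), height xi = 0; no integral
   is needed.  The quantity hyp z w = |z - wbar|^2 / (height z * height w) is
   comparable to 2^(beta z w) and replaces beta in all estimates.

   (a) Let u interpolate w_k = 2^(eps * beta z_k z_n).  Above a horizontal
   layer h <= y < 2h, u dominates a fixed multiple of the sum over the z_k in
   the layer of u(z_k) h^d times a difference of two Poisson kernels with poles
   below z_k: by Harnack's inequality this holds on y = h, and the minimum
   principle carries it up to z_n.  Hence the w_k / 2^(d l) summed over a layer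
   of the ball of radius l are bounded, and only O(l) layers meet the ball, so
   the exponential size of the w_k gains a factor 2^(-eps l) in the count.

   (b) Colour the points so that points of the same colour are far apart; in a
   union of two colour classes each z_n has at most one near neighbour.  For
   each n take a positive combination g_n of Poisson kernels, g_n(z_n) = 1, with
   poles spread over a boundary cube from which z_n is seen strictly better than
   its neighbour, after deletion of the poles lying in the shadows of the other
   points.  The growth condition says that enough poles survive and that the
   row sums of g_n(z_m) w_n / w_m off the diagonal are smaller than 1.  The
   linear system for the first K points then has a positive solution, and an
   ultrafilter limit as K grows interpolates the whole sequence: every
   derivative of a Poisson kernel is locally bounded by a multiple of the kernel
   at a fixed point, so differentiation commutes with the limit. *)

Require Import Defs.
From mathcomp Require Import all_boot all_order all_algebra finmap.
From mathcomp Require Import all_classical all_reals all_analysis.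
From mathcomp Require Import ring lra zify.

Set Implicit Arguments.
Unset Strict Implicit.

Import Order.TTheory GRing.Theory Num.Theory.
Import numFieldNormedType.Exports.

Local Open Scope classical_set_scope.
Local Open Scope ring_scope.


(** * Derivatives and the minimum principle *)

Section Calculus.
Context {R : realType}.

(** Since integrals are avoided, Harnack's inequality must itself come from barriers: a reflection
    estimate bounds the oscillation, a subharmonic power carries lower bounds outwards, and a
    weighted maximum joins the two. The poles sit on finite grids, whose mesh must be finer than
    every shadow; the shadows of infinitely many points may shrink to zero, so each kernel serves
    only a finite set of points. The constants are uniform in that set, which is what the final
    limit needs. The split into pairs of classes reflects a limit of the method: at a near neighbour
    the kernel of [z n] is not small, only smaller than [1] by a fixed factor [1 + k]. One such
    neighbour keeps the row sum below [1]; two might not. The far points are paid for by the gap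
    [1 - alpha], measured in units [e = (1 - alpha) / 16]: part of it sizes the shadows, part lets
    the data [w] grow, part makes the row sums converge. The triangle inequality for [beta] carries
    an additive error [6], absorbed by separation in (a) and by the colouring radius in (b). *)

Lemma quotient_le (A t e : R) : t != 0 ->
  `|- A / t| <= e <-> `|A| <= e * `|t|.
Proof. by move=> t0; rewrite normrM normfV normrN ler_pdivrMr ?normr_gt0. Qed.

Lemma is_derive_expansion (V : normedModType R) (f : V -> R) x v (l : R) :
  is_derive x v f l -> forall e : R, 0 < e -> exists2 r : R, 0 < r &
    forall t : R, `|t| < r -> `|f (x + t *: v) - f x - t * l| <= e * `|t|.
Proof.
move=> [df fl] e e0.
have /cvgrPdist_le/(_ e e0) : h^-1 *: (f (h *: v + x) - f x) @[h --> 0^'] --> l.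
  by rewrite -fl; exact: df.
rewrite near_withinE => /nbhs_ballP[r /= r0 H].
exists r => // t tr.
have [->|t0] := eqVneq t 0.
  by rewrite scale0r addr0 subrr mul0r subrr normr0 mulr0.
have := H t; rewrite /ball /= sub0r normrN => /(_ tr t0).
rewrite (_ : l - _ = - (f (x + t *: v) - f x - t * l) / t); last first.
  by rewrite [x + _]addrC [_ *: (_ - _)](mulrC t^-1); field.
by move=> h; exact: (quotient_le _ _ t0).1 h.
Qed.

Lemma expansion_is_derive (V : normedModType R) (f : V -> R) x v (l : R) :
  (forall e : R, 0 < e -> exists2 r : R, 0 < r &
    forall t : R, `|t| < r -> `|f (x + t *: v) - f x - t * l| <= e * `|t|) ->
  is_derive x v f l.
Proof.
move=> H.
have C : h^-1 *: (f (h *: v + x) - f x) @[h --> 0^'] --> l.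
  apply/cvgrPdist_le => e e0; have [r r0 Hr] := H _ e0.
  rewrite near_withinE; apply/nbhs_ballP; exists r => //= t.
  rewrite /ball /= sub0r normrN => tr t0.
  rewrite (_ : l - _ = - (f (x + t *: v) - f x - t * l) / t); last first.
    by rewrite [x + _]addrC [_ *: (_ - _)](mulrC t^-1); field.
  exact: (quotient_le _ _ t0).2 (Hr _ tr).
split; last exact/cvg_lim.
by apply/cvg_ex; exists l.
Qed.

Lemma MVT_bound (g g' : R -> R) (t e : R) :
  (forall s : R, `|s| <= `|t| -> is_derive s 1 g (g' s)) ->
  (forall s : R, `|s| <= `|t| -> `|g' s| <= e) ->
  `|g t - g 0| <= e * `|t|.
Proof.
move=> dg bg.
have cont (a b : R) : `|a| <= `|t| -> `|b| <= `|t| ->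
    {within `[a, b], continuous g}.
  move=> ar br; apply: continuous_in_subspaceT => x.
  rewrite inE /= in_itv /= => /andP[ax xb].
  apply: differentiable_continuous; apply/derivable1_diffP.
  have xt : `|x| <= `|t|.
    by move: ar br; rewrite !ler_norml => /andP[? ?] /andP[? ?]; apply/andP; split; lra.
  by have [] := dg x xt.
have [t0|t0|<-] := ltgtP 0 t; last by rewrite subrr !normr0 mulr0.
- have bt x : 0 <= x <= t -> `|x| <= `|t|.
    by move=> /andP[? ?]; rewrite ger0_norm// ger0_norm; lra.
  have [| |c] := MVT t0 (df := g') _ (f := g).
  + by move=> x; rewrite in_itv /= => /andP[? ?]; apply: dg; apply: bt; lra.
  + by apply: cont; apply: bt; lra.
  rewrite in_itv /= => /andP[c0 ct] ->.
  by rewrite normrM subr0 ler_wpM2r//; apply: bg; apply: bt; lra.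
- have bt x : t <= x <= 0 -> `|x| <= `|t|.
    by move=> /andP[? ?]; rewrite ler0_norm// ler0_norm; lra.
  have [| |c] := MVT t0 (df := g') _ (f := g).
  + by move=> x; rewrite in_itv /= => /andP[? ?]; apply: dg; apply: bt; lra.
  + by apply: cont; apply: bt; lra.
  rewrite in_itv /= => /andP[c0 ct]; rewrite distrC => ->.
  by rewrite normrM sub0r normrN ler_wpM2r//; apply: bg; apply: bt; lra.
Qed.

Lemma taylor2_bound (g g' : R -> R) (a t e : R) :
  (forall s : R, `|s| <= `|t| -> is_derive s 1 g (g' s)) ->
  (forall s : R, `|s| <= `|t| -> `|g' s - a| <= e) ->
  `|g t - g 0 - t * a| <= e * `|t|.
Proof.
move=> dg bg.
have := @MVT_bound (fun s => g s - s * a) (fun s => g' s - a) t e.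
rewrite mul0r subr0 addrAC; apply; last exact: bg.
move=> s st; have dgs := dg s st.
rewrite (_ : (fun s => _) = g - a *: id); last by apply/funext => x; rewrite mulrC.
by apply: is_derive_eq; rewrite [_ *: _]mulr1.
Qed.

(** The mean value bound is applied to [g] minus its quadratic Taylor polynomial, using the
    expansion of [g'] at the single point [0]; the error is [o(t^2)] at [t] and at [- t], and the
    odd terms cancel in the sum. *)
Lemma sym_second_difference (g g' : R -> R) (a r : R) : 0 < r ->
  (forall s : R, `|s| < r -> is_derive s 1 g (g' s)) ->
  is_derive (0 : R) 1 g' a ->
  forall e : R, 0 < e -> exists2 r' : R, 0 < r' &
    forall t : R, `|t| < r' -> `|g t + g (- t) - 2 * g 0 - a * t ^+ 2| <= e * t ^+ 2.
Proof.
move=> r0 dg da e e0.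
have e4 : 0 < e / 4 by lra.
have [r1 r10 H] := is_derive_expansion da e4.
exists (Num.min r r1); first by rewrite lt_min r0.
move=> t; rewrite lt_min => /andP[tr tr1].
have bnd (u : R) : `|u| = `|t| ->
    `|(g u - u * g' 0 - a * u ^+ 2 / 2) - (g 0 - 0 * g' 0 - a * 0 ^+ 2 / 2)|
      <= (e / 4 * `|t|) * `|u|.
  move=> ut.
  apply: (@MVT_bound (fun s => g s - s * g' 0 - a * s ^+ 2 / 2)
    (fun s => g' s - g' 0 - s * a)).
    move=> s su; have ds : is_derive s 1 g (g' s).
      by apply: dg; apply: le_lt_trans su _; rewrite ut.
    rewrite (_ : (fun s => _) = g - g' 0 *: id - (a / 2) *: (id ^+ 2)); last first.
      apply/funext => x; congr (_ - _ - _); first exact: mulrC.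
      exact: mulrAC.
    apply: is_derive_eq.
    by rewrite -[LHS]/(g' s - g' 0 * 1 - a / 2 * (2 * s ^+ 1 * 1)); lra.
  move=> s su; have := H s; rewrite add0r [_ *: _]mulr1 => h.
  apply: le_trans (h _) _; first by apply: le_lt_trans su _; rewrite ut.
  by rewrite -ut ler_wpM2l// ltW.
have := bnd t erefl; have := bnd (- t) (normrN t).
rewrite normrN sqrrN !mul0r expr0n/= mulr0 !mul0r !subr0 => h1 h2.
have tt : e / 4 * `|t| * `|t| = e / 4 * t ^+ 2.
  by rewrite -mulrA -expr2 -normrX ger0_norm// sqr_ge0.
rewrite tt in h1 h2.
have t20 := sqr_ge0 t.
have e1 : g t + g (- t) - 2 * g 0 - a * t ^+ 2 =
   (g (- t) - - t * g' 0 - a * t ^+ 2 / 2 - g 0) +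
   (g t - t * g' 0 - a * t ^+ 2 / 2 - g 0) by field.
rewrite e1; apply: le_trans (ler_normD _ _) _.
have := mulr_ge0 (ltW e0) t20.
lra.
Qed.

End Calculus.

Section Continuity.
Context {R : realType} {T : topologicalType} (x : T).

Lemma continuous_atD (f g : T -> R) :
  {for x, continuous f} -> {for x, continuous g} ->
  {for x, continuous (fun y => f y + g y)}.
Proof. by move=> cf cg; apply: cvgD; [exact: cf|exact: cg]. Qed.

Lemma continuous_atB (f g : T -> R) :
  {for x, continuous f} -> {for x, continuous g} ->
  {for x, continuous (fun y => f y - g y)}.
Proof. by move=> cf cg; apply: cvgB; [exact: cf|exact: cg]. Qed.

Lemma continuous_atM (f g : T -> R) :
  {for x, continuous f} -> {for x, continuous g} ->
  {for x, continuous (fun y => f y * g y)}.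
Proof. by move=> cf cg; apply: cvgM; [exact: cf|exact: cg]. Qed.

Lemma continuous_at_cst (k : R) : {for x, continuous (fun _ : T => k)}.
Proof. exact: cst_continuous. Qed.

Lemma continuous_at_sum (I : Type) (s : seq I) (f : I -> T -> R) :
  (forall k, {for x, continuous (f k)}) ->
  {for x, continuous (fun y => \sum_(k <- s) f k y)}.
Proof.
move=> cf; elim: s => [|k s IH].
  rewrite (_ : (fun _ => _) = fun=> 0); first exact: cst_continuous.
  by apply/funext => y; rewrite big_nil.
rewrite (_ : (fun _ => _) = fun y => f k y + \sum_(k <- s) f k y).
  by apply: cvgD; [exact: cf|exact: IH].
by apply/funext => y; rewrite big_cons.
Qed.

Lemma continuous_atX (f : T -> R) n :
  {for x, continuous f} -> {for x, continuous (fun y => f y ^+ n)}.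
Proof.
move=> cf; elim: n => [|n IH].
  by rewrite (_ : (fun _ => _) = fun=> 1); [exact: cst_continuous|exact/funext].
rewrite (_ : (fun _ => _) = fun y => f y * f y ^+ n).
  by apply: cvgM; [exact: cf|exact: IH].
by apply/funext => y; rewrite exprS.
Qed.

End Continuity.

Section Coordinates.
Context {R : realType} {d : nat}.
Implicit Types (z c : 'rV[R]_d.+1) (i j : 'I_d.+1) (u v : 'rV[R]_d.+1 -> R).

Definition move z i (t : R) : 'rV[R]_d.+1 := z + t *: basis_vec i.

Lemma moveE z i t j : move z i t ord0 j = z ord0 j + (if j == i then t else 0).
Proof. by rewrite !mxE eqxx /=; case: eqP => _; rewrite ?mulr1 ?mulr0. Qed.

Lemma move0 z i : move z i 0 = z.
Proof. by rewrite /move scale0r addr0. Qed.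

Lemma moveD z i s t : move (move z i s) i t = move z i (s + t).
Proof. by rewrite /move -addrA -scalerDl. Qed.

Lemma is_derive_line u z i l t :
  is_derive (move z i t) (basis_vec i) u l <->
  is_derive t 1 (fun s : R => u (move z i s)) l.
Proof.
split=> h; apply: expansion_is_derive => e e0;
  have [r r0 H] := is_derive_expansion h e0; exists r => // s sr; have := H s sr.
- by rewrite [s *: (1 : R)]mulr1 -[move z i t + _]/(move (move z i t) i s) moveD.
- by rewrite [s *: (1 : R)]mulr1 -[move z i t + _]/(move (move z i t) i s) moveD.
Qed.

(** A symmetric second derivative in direction [i], in Peano form. It is nonnegative at a minimum,
    is linear in the function and survives reflections, which is all that the comparison arguments
    ask of a harmonic function. *)
Definition second_diff (w : 'rV[R]_d.+1 -> R) z i (a : R) :=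
  forall e : R, 0 < e -> exists2 r : R, 0 < r & forall t : R, `|t| < r ->
    `|w (move z i t) + w (move z i (- t)) - 2 * w z - a * t ^+ 2| <= e * t ^+ 2.

Lemma second_diffD u v z i a b :
  second_diff u z i a -> second_diff v z i b ->
  second_diff (fun x => u x + v x) z i (a + b).
Proof.
move=> hu hv e e0; have [r r0 H] := hu (e / 2) ltac:(lra).
have [s s0 K] := hv (e / 2) ltac:(lra).
exists (Num.min r s); first by rewrite lt_min r0.
move=> t; rewrite lt_min => /andP[/H h /K k].
apply: le_trans (_ : e / 2 * t ^+ 2 + e / 2 * t ^+ 2 <= _); last lra.
apply: le_trans (lerD h k); apply: le_trans (ler_normD _ _).
by rewrite le_eqVlt; apply/orP; left; apply/eqP; congr (`| _ |); ring.
Qed.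

Lemma second_diffZ k u z i a :
  second_diff u z i a -> second_diff (fun x => k * u x) z i (k * a).
Proof.
move=> hu e e0; have [r r0 H] := hu (e / (`|k| + 1)) ltac:(by rewrite divr_gt0// ltr_wpDl).
exists r => // t /H h.
rewrite [X in `|X|](_ : _ = k * (u (move z i t) + u (move z i (- t)) - 2 * u z
  - a * t ^+ 2)); last ring.
rewrite normrM; apply: le_trans (_ : (`|k| + 1) * (e / (`|k| + 1) * t ^+ 2) <= _).
  by apply: ler_pM => //; rewrite lerDl.
have k0 : `|k| + 1 != 0 by rewrite gt_eqF// ltr_wpDl.
by rewrite le_eqVlt; apply/orP; left; apply/eqP; field.
Qed.

Lemma second_diff_cst k z i : second_diff (fun=> k) z i 0.
Proof.
move=> e e0; exists 1 => // t _.
rewrite [X in `|X|](_ : _ = 0); last by ring.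
by rewrite normr0 mulr_ge0 ?sqr_ge0// ltW.
Qed.

Lemma second_diff_sum (I : Type) (s : seq I) (f : I -> 'rV[R]_d.+1 -> R)
    (a : I -> R) z i :
  (forall k, second_diff (f k) z i (a k)) ->
  second_diff (fun x => \sum_(k <- s) f k x) z i (\sum_(k <- s) a k).
Proof.
move=> h; elim: s => [|k s IH].
  rewrite big_nil (_ : (fun _ => _) = fun=> 0); first exact: second_diff_cst.
  by apply/funext => x; rewrite big_nil.
rewrite big_cons (_ : (fun _ => _) = fun x => f k x + \sum_(k <- s) f k x).
  exact: second_diffD.
by apply/funext => x; rewrite big_cons.
Qed.

Lemma second_diff_deriv u (Du : 'rV[R]_d.+1 -> R) z i (a r : R) : 0 < r ->
  (forall t : R, `|t| < r -> is_derive (move z i t) (basis_vec i) u (Du (move z i t))) ->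
  is_derive z (basis_vec i) Du a ->
  second_diff u z i a.
Proof.
move=> r0 du da e e0.
have [| |r' r'0 H] := @sym_second_difference R (fun s => u (move z i s))
  (fun s => Du (move z i s)) a r r0 _ _ e e0.
- by move=> s sr; apply/is_derive_line; exact: du.
- by apply/is_derive_line; rewrite move0.
by exists r' => // t /H; rewrite move0.
Qed.

Definition superharmonic_at (w : 'rV[R]_d.+1 -> R) z :=
  exists2 a : 'I_d.+1 -> R, forall i, second_diff w z i (a i) & \sum_i a i <= 0.

Lemma second_diff_sqr c z i j :
  second_diff (fun x => (x ord0 j - c ord0 j) ^+ 2) z i (if i == j then 2 else 0).
Proof.
move=> e e0; exists 1 => // t _; rewrite !moveE.
rewrite [X in `|X|](_ : _ = 0); last by rewrite [j == i]eq_sym; case: ifP => _; ring.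
by rewrite normr0 mulr_ge0 ?sqr_ge0// ltW.
Qed.

Lemma second_diff_lin c z i j :
  second_diff (fun x => x ord0 j - c ord0 j) z i 0.
Proof.
move=> e e0; exists 1 => // t _; rewrite !moveE.
rewrite [X in `|X|](_ : _ = 0); last by case: ifP => _; ring.
by rewrite normr0 mulr_ge0 ?sqr_ge0// ltW.
Qed.

(** Subtracting [e * |z|^2] makes the inequality strict: at a minimum of the perturbed function each
    [a i] is at least [2 * e], so their sum is positive, against superharmonicity. Interior points
    are recognised by moves along the coordinate axes. *)
Lemma min_principle (K : set 'rV[R]_d.+1) (w : 'rV[R]_d.+1 -> R) (T : R) :
  compact K -> (forall z i, K z -> `|z ord0 i| <= T) ->
  (forall z, K z -> {for z, continuous w}) ->
  (forall z, K z -> 0 <= w z \/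
     ((forall i, exists2 r : R, 0 < r & forall t : R, `|t| < r -> K (move z i t))
      /\ superharmonic_at w z)) ->
  forall z, K z -> 0 <= w z.
Proof.
move=> cK bK cw alt z1 Kz1; rewrite leNgt; apply/negP => w1.
pose g (z : 'rV[R]_d.+1) : R := \sum_(i < d.+1) z ord0 i ^+ 2.
pose B : R := d.+1%:R * T ^+ 2 + 1.
have gB z : K z -> 0 <= g z <= B - 1.
  move=> Kz; rewrite sumr_ge0 /=; last by move=> i _; exact: sqr_ge0.
  rewrite /B addrK; apply: le_trans (_ : \sum_(i < d.+1) T ^+ 2 <= _).
    apply: ler_sum => i _; have := bK z i Kz => h.
    by rewrite -[_ ^+ 2]ger0_norm ?sqr_ge0// normrX ler_sqr ?nnegrE//; apply: le_trans h.
  by rewrite sumr_const card_ord mulr_natl.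
have B0 : 0 < B by have /andP[] := gB z1 Kz1; lra.
(* The perturbation is at most [- w z1 / 2] on [K], so its minimiser still has [w < 0] and falls
   under the second alternative of [alt]. *)
pose e := - w z1 / B / 2.
have e0 : 0 < e by rewrite !divr_gt0// oppr_gt0.
have cg : continuous g.
  move=> z; apply: continuous_at_sum => i.
  by apply: continuous_atX; exact: coord_continuous.
have [| |zm /set_mem Kzm zmin] := @compact_EVT_min _ R (fun z => w z - e * g z) K _ cK.
- by exists z1.
- apply: continuous_in_subspaceT => z /set_mem Kz.
  apply: (@continuous_atB _ _ z w (fun y => e * g y)); first exact: cw.
  by apply: (@continuous_atM _ _ z (fun=> e) g); [exact: continuous_at_cst|exact: cg].
have eB : e * B = - w z1 / 2 by rewrite /e; field; rewrite gt_eqF.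
have := zmin z1 (mem_set Kz1).
have /andP[gm0 gmB] := gB _ Kzm; have /andP[g10 g1B] := gB _ Kz1.
have : e * g zm <= e * B by rewrite ler_wpM2l; lra.
have : 0 <= e * g z1 by rewrite mulr_ge0; lra.
move=> ? ? ?; have wm : w zm < 0 by lra.
have [|[inK [a ha asum]]] := alt _ Kzm; first lra.
have a2 i : 2 * e <= a i.
  have : second_diff (fun x => w x + (- e) * g x) zm i (a i + (- e) * 2).
    apply: second_diffD; first exact: ha.
    apply: second_diffZ.
    have -> : 2 = \sum_(j < d.+1) (if i == j then 2 else 0) :> R.
      by rewrite -big_mkcond /= (big_pred1 i)// => j; rewrite eq_sym.
    rewrite (_ : g = fun x => \sum_(j < d.+1) (x ord0 j - (0 : 'rV[R]_d.+1) ord0 j) ^+ 2).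
      by apply: second_diff_sum => j; exact: second_diff_sqr.
    by apply/funext => x; apply: eq_bigr => j _; rewrite mxE subr0.
  rewrite leNgt => h; apply/negP => ha2.
  have [r r0 H] := h ((2 * e - a i) / 2) ltac:(lra).
  have [r1 r10 H1] := inK i.
  pose t := Num.min r r1 / 2.
  have rr : 0 < Num.min r r1 by rewrite lt_min r0.
  have tr : `|t| < Num.min r r1 by rewrite gtr0_norm /t; lra.
  move: tr; rewrite lt_min => /andP[tr tr1].
  have := zmin _ (mem_set (H1 t tr1)).
  have := zmin _ (mem_set (H1 (- t) ltac:(by rewrite normrN))).
  have := H t tr.
  have t2 : 0 < t ^+ 2 by rewrite exprn_gt0// /t; lra.
  have : 0 < (2 * e - a i) / 2 * t ^+ 2 by rewrite mulr_gt0//; lra.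
  rewrite ler_norml; move: (w (move _ _ _)) (w (move _ _ _)) (g (move _ _ _)) (g (move _ _ _)).
  move=> w1' w2' g1 g2 ? /andP[? ?] ? ?; lra.
have : \sum_(i < d.+1) 2 * e <= \sum_i a i by apply: ler_sum => i _; exact: a2.
rewrite sumr_const card_ord -mulr_natr => h.
have : 0 < 2 * e * d.+1%:R by rewrite mulr_gt0// ?ltr0n//; lra.
lra.
Qed.

End Coordinates.

(** * Poisson kernels *)

Lemma is_derive_cast {R : realType} (V : normedModType R) (f : V -> R) x v
  (l l' : R) : is_derive x v f l -> l = l' -> is_derive x v f l'.
Proof. by move=> h <-. Qed.

Section Euclid.
Context {R : realType} {d : nat}.
Implicit Types (z c xi p : 'rV[R]_d.+1) (i j : 'I_d.+1).

Lemma euclid_sqr p : euclid p ^+ 2 = \sum_(i < d.+1) p ord0 i ^+ 2.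
Proof. by rewrite sqr_sqrtr// sumr_ge0// => i _; exact: sqr_ge0. Qed.

Lemma euclid_ge0 p : 0 <= euclid p.
Proof. exact: sqrtr_ge0. Qed.

Lemma coord_le_euclid p i : `|p ord0 i| <= euclid p.
Proof.
rewrite -ler_sqr ?nnegrE ?euclid_ge0// euclid_sqr real_normK ?num_real//.
by rewrite (bigD1 i)//= lerDl sumr_ge0// => j _; exact: sqr_ge0.
Qed.

Lemma euclid_le_coord p r : (forall i, `|p ord0 i| <= r) ->
  euclid p ^+ 2 <= d.+1%:R * r ^+ 2.
Proof.
move=> pr; rewrite euclid_sqr; apply: le_trans (_ : \sum_(i < d.+1) r ^+ 2 <= _).
  apply: ler_sum => i _; rewrite -[_ ^+ 2]real_normK ?num_real//.
  by rewrite ler_sqr ?nnegrE//; exact: le_trans (pr i).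
by rewrite sumr_const card_ord mulr_natl.
Qed.

Lemma euclid_move z xi j t :
  euclid (move z j t - xi) =
  Num.sqrt (euclid (z - xi) ^+ 2 + 2 * t * (z - xi) ord0 j + t ^+ 2).
Proof.
rewrite euclid_sqr /euclid; congr Num.sqrt.
have E i : (move z j t - xi) ord0 i = (z - xi) ord0 i + (if i == j then t else 0).
  by rewrite [LHS]mxE moveE [in RHS]mxE addrAC.
rewrite (bigD1 j)//= [in RHS](bigD1 j)//= E eqxx.
rewrite (eq_bigr (fun i => (z - xi) ord0 i ^+ 2)); last first.
  by move=> i ij; rewrite E (negbTE ij) addr0.
ring.
Qed.

Lemma is_derive_euclid z xi j : 0 < euclid (z - xi) ->
  is_derive z (basis_vec j) (fun x : 'rV[R]_d.+1 => euclid (x - xi))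
    ((z - xi) ord0 j / euclid (z - xi)).
Proof.
move=> N0; rewrite -[z in is_derive z](move0 z j); apply/is_derive_line.
set b := (z - xi) ord0 j; set N := euclid (z - xi).
rewrite (_ : (fun s : R => _) =
   Num.sqrt \o (cst (N ^+ 2) + (2 * b) *: id + id ^+ 2)); last first.
  apply/funext => s; rewrite euclid_move /=; congr Num.sqrt.
  by rewrite !fctE; congr (_ + _ + _); rewrite mulrAC.
set g := (X in _ \o X).
have g0 : g 0 = N ^+ 2 by rewrite /g !fctE scaler0 expr0n !addr0.
have gp : 0 < g 0 by rewrite g0 exprn_gt0.
have dg : is_derive (0 : R) 1 g (2 * b).
  apply: expansion_is_derive => e e0; exists e => // s se.
  rewrite add0r [s *: (1 : R)]mulr1 g0 /g !fctE.
  rewrite [X in `|X|](_ : _ = s * s); last first.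
    by rewrite -[LHS]/(N ^+ 2 + 2 * b * s + s ^+ 2 - N ^+ 2 - s * (2 * b)); ring.
  by rewrite normrM ler_wpM2r// ltW.
have ds := is_derive1_sqrt gp.
apply: (is_derive_cast (is_derive1_comp ds dg)).
rewrite g0 sqrtr_sqr ger0_norm ?euclid_ge0//.
by rewrite -[LHS]/((2 * N)^-1 * (2 * b)); field; rewrite gt_eqF.
Qed.

Lemma continuous_euclid z xi : {for z, continuous (fun x : 'rV[R]_d.+1 => euclid (x - xi))}.
Proof.
have c : {for z, continuous (fun x : 'rV[R]_d.+1 => \sum_(i < d.+1) (x - xi) ord0 i ^+ 2)}.
  apply: continuous_at_sum => i; apply: continuous_atX.
  rewrite (_ : (fun _ => _) = fun x : 'rV[R]_d.+1 => x ord0 i - xi ord0 i); last first.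
    by apply/funext => x; rewrite !mxE.
  by apply: continuous_atB; [exact: coord_continuous|exact: continuous_at_cst].
change {for z, continuous (Num.sqrt \o
  (fun x : 'rV[R]_d.+1 => \sum_(i < d.+1) (x - xi) ord0 i ^+ 2))}.
by apply: continuous_comp; [exact: c|exact: sqrt_continuous].
Qed.

End Euclid.

Section Kernels.
Context {R : realType} {d : nat}.
Implicit Types (z c xi p : 'rV[R]_d.+1) (i j : 'I_d.+1).

(* A class of functions of [z - xi] closed under partial derivatives: [Ht] is
   the last coordinate, [Th i] the [i]-th direction cosine, [Inv] the inverse
   of the norm. *)
Inductive expr :=
  | Cst of R | Ht | Th of 'I_d.+1 | Inv
  | Add of expr & expr | Mul of expr & expr.

Fixpoint eval xi z (e : expr) : R :=
  match e with
  | Cst k => k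
  | Ht => z ord0 ord_max - xi ord0 ord_max
  | Th i => (z ord0 i - xi ord0 i) / euclid (z - xi)
  | Inv => (euclid (z - xi))^-1
  | Add e1 e2 => eval xi z e1 + eval xi z e2
  | Mul e1 e2 => eval xi z e1 * eval xi z e2
  end.

Fixpoint deriv (j : 'I_d.+1) (e : expr) : expr :=
  match e with
  | Cst k => Cst 0
  | Ht => Cst (j == ord_max)%:R
  | Th i => Mul Inv (Add (Cst (j == i)%:R) (Mul (Cst (-1)) (Mul (Th i) (Th j))))
  | Inv => Mul (Cst (-1)) (Mul (Th j) (Mul Inv Inv))
  | Add e1 e2 => Add (deriv j e1) (deriv j e2)
  | Mul e1 e2 => Add (Mul (deriv j e1) e2) (Mul e1 (deriv j e2))
  end.

Lemma is_derive_coord z xi i j :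
  is_derive z (basis_vec j) (fun x : 'rV[R]_d.+1 => x ord0 i - xi ord0 i) (j == i)%:R.
Proof.
apply: expansion_is_derive => e e0; exists 1 => // t _.
rewrite -/(move z j t) moveE [j == i]eq_sym.
rewrite [X in `|X|](_ : _ = 0); last by case: eqP => _ /=; ring.
by rewrite normr0 mulr_ge0 // ltW.
Qed.

Lemma is_derive_inv_euclid z xi j : 0 < euclid (z - xi) ->
  is_derive z (basis_vec j) (fun x : 'rV[R]_d.+1 => (euclid (x - xi))^-1)
    (- ((z - xi) ord0 j / euclid (z - xi)) / euclid (z - xi) ^+ 2).
Proof.
move=> N0; have [dN vN] := is_derive_euclid j N0.
split; first by apply: derivableV => //; rewrite gt_eqF.
rewrite deriveV ?gt_eqF// vN.
rewrite -[LHS]/(- (euclid (z - xi) ^+ 2)^-1 * ((z - xi) ord0 j / euclid (z - xi))).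
by rewrite mulNr mulNr mulrC.
Qed.

Lemma is_derive_eval e z xi j : 0 < euclid (z - xi) ->
  is_derive z (basis_vec j) (fun x => eval xi x e) (eval xi z (deriv j e)).
Proof.
move=> N0; elim: e => [k||i||e1 IH1 e2 IH2|e1 IH1 e2 IH2] /=.
- exact: is_derive_cst.
- exact: is_derive_coord.
- have h1 := is_derive_coord z xi i j; have h2 := is_derive_inv_euclid j N0.
  apply: (is_derive_cast (is_deriveM h1 h2)).
  rewrite -[LHS]/(_ * _ + _ * _) !mxE.
  by field; rewrite gt_eqF.
- apply: (is_derive_cast (is_derive_inv_euclid j N0)).
  by rewrite !mxE; field; rewrite gt_eqF.
- exact: is_deriveD.
- apply: (is_derive_cast (is_deriveM IH1 IH2)).
  by rewrite -[LHS]/(_ * _ + _ * _) addrC; congr (_ + _); exact: mulrC.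
Qed.

Lemma continuous_eval e z xi : 0 < euclid (z - xi) ->
  {for z, continuous (fun x => eval xi x e)}.
Proof.
move=> N0.
have ci i : {for z, continuous (fun x : 'rV[R]_d.+1 => x ord0 i - xi ord0 i)}.
  by apply: continuous_atB; [exact: coord_continuous|exact: continuous_at_cst].
have cN : {for z, continuous (fun x : 'rV[R]_d.+1 => (euclid (x - xi))^-1)}.
  apply: (@continuous_comp _ _ _ (fun x : 'rV[R]_d.+1 => euclid (x - xi)) GRing.inv).
    exact: continuous_euclid.
  by apply: inv_continuous; rewrite gt_eqF.
elim: e => [k||i||e1 IH1 e2 IH2|e1 IH1 e2 IH2] /=.
- exact: continuous_at_cst.
- exact: ci.
- exact: continuous_atM.
- exact: cN.
- exact: continuous_atD.
- exact: continuous_atM.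
Qed.

(* [bound eta h e] bounds [|e|] where [h] bounds the last coordinate and
   [eta] is a lower bound of the norm. *)
Fixpoint bound (eta h : R) (e : expr) : R :=
  match e with
  | Cst k => `|k|
  | Ht => h
  | Th _ => 1
  | Inv => eta^-1
  | Add e1 e2 => bound eta h e1 + bound eta h e2
  | Mul e1 e2 => bound eta h e1 * bound eta h e2
  end.

Lemma eval_bound eta h e z xi : 0 < eta ->
  `|z ord0 ord_max - xi ord0 ord_max| <= h -> eta <= euclid (z - xi) ->
  `|eval xi z e| <= bound eta h e.
Proof.
move=> eta0 zh zeta.
have N0 : 0 < euclid (z - xi) by exact: lt_le_trans zeta.
elim: e => [k||i||e1 IH1 e2 IH2|e1 IH1 e2 IH2] //=.
- rewrite normrM normfV [X in _ / X]ger0_norm ?euclid_ge0//.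
  rewrite ler_pdivrMr// mul1r; have := coord_le_euclid (z - xi) i.
  by rewrite !mxE.
- by rewrite normfV ger0_norm ?euclid_ge0// lef_pV2.
- exact: le_trans (ler_normD _ _) (lerD IH1 IH2).
- by rewrite normrM; exact: ler_pM.
Qed.

(** The power of the distance is kept outside the syntax: with [k = d + 1] every derivative of the
    Poisson kernel has the same decay in [xi] as the kernel, with a coefficient controlled by
    [bound]. *)
Definition weighted k e xi z : R := eval xi z e * (euclid (z - xi))^-1 ^+ k.

Definition derivW k (j : 'I_d.+1) (e : expr) : expr :=
  Add (deriv j e) (Mul (Cst (- k%:R)) (Mul (Th j) (Mul Inv e))).

Lemma is_derive_weighted k e z xi j : 0 < euclid (z - xi) ->
  is_derive z (basis_vec j) (weighted k e xi) (weighted k (derivW k j e) xi z).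
Proof.
move=> N0; rewrite /weighted.
have h1 := is_derive_eval e j N0; have h2 := is_derive_eval Inv j N0.
have h3 : is_derive z (basis_vec j) (fun x : 'rV[R]_d.+1 => (euclid (x - xi))^-1 ^+ k)
   (- k%:R * (z ord0 j - xi ord0 j) / euclid (z - xi) / euclid (z - xi)
     * (euclid (z - xi))^-1 ^+ k).
  rewrite (_ : (fun _ => _) = (fun x => eval xi x Inv) ^+ k); last first.
    by apply/funext => x; rewrite exprfctE.
  apply: (is_derive_cast (is_deriveX k h2)).
  rewrite -[LHS]/(_ * _ * _) /=; case: k => [|k] /=; first by ring.
  by rewrite exprS; ring.
apply: (is_derive_cast (is_deriveM h1 h3)).
rewrite -[LHS]/(_ * _ + _ * _) /=; ring.
Qed.

Lemma continuous_weighted k e z xi : 0 < euclid (z - xi) ->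
  {for z, continuous (weighted k e xi)}.
Proof.
move=> N0; apply: continuous_atM; first exact: continuous_eval.
exact: (@continuous_atX _ _ z (fun x => eval xi x Inv) k (@continuous_eval Inv z xi N0)).
Qed.

Lemma euclid_gt0 z xi : xi ord0 ord_max < z ord0 ord_max -> 0 < euclid (z - xi).
Proof.
move=> h; apply: lt_le_trans (coord_le_euclid (z - xi) ord_max).
by rewrite !mxE normr_gt0 subr_eq0 gt_eqF.
Qed.

Lemma euclid_gt0_near z xi j : 0 < euclid (z - xi) ->
  exists2 r : R, 0 < r & forall t : R, `|t| < r -> 0 < euclid (move z j t - xi).
Proof.
move=> N0; set N := euclid (z - xi).
exists N => // t tN; rewrite euclid_move sqrtr_gt0.
have := coord_le_euclid (z - xi) j; rewrite -/N.
set b := (z - xi) ord0 j => bN.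
have h : - (`|t| * N) <= t * b.
  rewrite lerNl; apply: le_trans (_ : `|t * b| <= _).
    by rewrite -normrN ler_norm.
  by rewrite normrM ler_wpM2l.
have : 0 < (N - `|t|) ^+ 2 by rewrite exprn_gt0// subr_gt0.
rewrite sqrrB real_normK ?num_real//; lra.
Qed.

Lemma second_diff_weighted k e z xi j : 0 < euclid (z - xi) ->
  second_diff (weighted k e xi) z j
    (weighted k (derivW k j (derivW k j e)) xi z).
Proof.
move=> N0; have [r r0 H] := euclid_gt0_near j N0.
apply: (second_diff_deriv (Du := weighted k (derivW k j e) xi) r0).
  by move=> t /H; exact: is_derive_weighted.
exact: is_derive_weighted.
Qed.

(** Unnormalised, and with a pole at any height: it is the Poisson kernel of the half-space above
    [xi]. Poles off the boundary occur in [bump]. *)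
Definition poisson xi z : R := weighted d.+1 Ht xi z.

Lemma sum_cosine_sqr z xi : 0 < euclid (z - xi) ->
  \sum_(j < d.+1) ((z ord0 j - xi ord0 j) / euclid (z - xi)) ^+ 2 = 1.
Proof.
move=> N0; under eq_bigr do rewrite expr_div_n.
rewrite -mulr_suml (eq_bigr (fun j => (z - xi) ord0 j ^+ 2)); last first.
  by move=> i _; rewrite !mxE.
by rewrite -euclid_sqr mulfV// gt_eqF// exprn_gt0.
Qed.

(** In terms of direction cosines the three contributions are [- n^2], [2 n + n^2] and [- 2 n] times
    [h / N^2], where [n = d + 1]. *)
Lemma laplacian_poisson xi z : 0 < euclid (z - xi) ->
  \sum_(j < d.+1) weighted d.+1 (derivW d.+1 j (derivW d.+1 j Ht)) xi z = 0.
Proof.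
move=> N0; rewrite -mulr_suml; set N := euclid _ in N0 *.
set n : R := d.+1%:R; set h := z ord0 ord_max - xi ord0 ord_max.
pose th j := (z ord0 j - xi ord0 j) / N.
rewrite (eq_bigr (fun j : 'I_d.+1 => - n * h / N ^+ 2 +
  ((2 * n + n ^+ 2) * h / N ^+ 2 * th j ^+ 2 +
    - 2 * n / N * ((j == ord_max)%:R * th j)))); last first.
  move=> j _ /=; rewrite eqxx /= -/N -/h -/n /th.
  by field; rewrite gt_eqF.
rewrite !big_split /= sumr_const card_ord -!mulr_sumr sum_cosine_sqr//.
rewrite (bigD1 ord_max)//= eqxx mul1r big1 ?addr0; last first.
  by move=> i /negbTE ->; rewrite mul0r.
rewrite /th -/h -[_ *+ d.+1]mulr_natr -/n.
rewrite (_ : _ + _ = 0) ?mul0r//; field; rewrite gt_eqF//.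
Qed.

(** The Laplacian of [|z - xi|^(-n)] in dimension [n = d + 1] is [2 n |z - xi|^(-n-2)]. This
    subharmonic power is the barrier of [power_barrier]. *)
Lemma laplacian_power xi z : 0 < euclid (z - xi) ->
  0 <= \sum_(j < d.+1) weighted d.+1 (derivW d.+1 j (derivW d.+1 j (Cst 1))) xi z.
Proof.
move=> N0; rewrite -mulr_suml; set N := euclid _ in N0 *.
set n : R := d.+1%:R.
pose th j := (z ord0 j - xi ord0 j) / N.
rewrite (eq_bigr (fun j : 'I_d.+1 => - n / N ^+ 2 +
  (2 * n + n ^+ 2) / N ^+ 2 * th j ^+ 2)); last first.
  move=> j _ /=; rewrite eqxx /= -/N -/n /th.
  by field; rewrite gt_eqF.
rewrite !big_split /= sumr_const card_ord -!mulr_sumr sum_cosine_sqr//.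
rewrite -[_ *+ d.+1]mulr_natr -/n.
apply: mulr_ge0; last by rewrite exprn_ge0// invr_ge0 ltW.
rewrite [X in 0 <= X](_ : _ = 2 * n / N ^+ 2); last by field; rewrite gt_eqF.
apply: divr_ge0; last by rewrite exprn_ge0// ltW.
by apply: mulr_ge0 => //; exact: ler0n.
Qed.

Lemma poissonE xi z : poisson xi z =
  (z ord0 ord_max - xi ord0 ord_max) / euclid (z - xi) ^+ d.+1.
Proof. by rewrite /poisson /weighted /= exprVn. Qed.

End Kernels.

Arguments expr : clear implicits.

(** * Sup norm, boxes and comparison on boxes *)

Section SupNorm.
Context {R : realType} {d : nat}.
Implicit Types (z c xi x y lo hi : 'rV[R]_d.+1) (i j : 'I_d.+1).

Lemma norm_le_coordP x r : 0 <= r -> `|x| <= r <-> forall i, `|x ord0 i| <= r.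
Proof.
move=> r0; have -> : `|x| = mx_norm x by [].
rewrite mx_normrE; split=> [h i|h].
  apply: le_trans h; apply/bigmax_geP; right => /=; exists (ord0, i) => //=.
apply/bigmax_leP; split => //= -[k i] _ /=; rewrite (ord1 k); exact: h.
Qed.

Lemma coord_le_norm x i : `|x ord0 i| <= `|x|.
Proof. by apply: (norm_le_coordP x (normr_ge0 x)).1. Qed.

Lemma norm_le_euclid x : `|x| <= euclid x.
Proof. by apply/norm_le_coordP => [|i]; [exact: euclid_ge0|exact: coord_le_euclid]. Qed.

Lemma euclid_le_norm x : euclid x <= d.+1%:R * `|x|.
Proof.
rewrite -ler_sqr ?nnegrE ?euclid_ge0 ?mulr_ge0//.
apply: le_trans (euclid_le_coord (coord_le_norm x)) _.
by rewrite exprMn ler_wpM2r ?sqr_ge0// -natrX ler_nat expnS expn1 leq_pmulr.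
Qed.

Lemma euclid_move_ge z xi j (t : R) :
  euclid (z - xi) - `|t| <= euclid (move z j t - xi).
Proof.
have [tN|Nt] := leP `|t| (euclid (z - xi)); last first.
  by apply: le_trans (euclid_ge0 _); rewrite subr_le0 ltW.
rewrite -ler_sqr ?nnegrE ?euclid_ge0 ?subr_ge0// euclid_move.
set N := euclid (z - xi); set b := (z - xi) ord0 j.
have bN : `|b| <= N by exact: coord_le_euclid.
have h : - (`|t| * N) <= t * b.
  rewrite lerNl; apply: le_trans (_ : `|t * b| <= _).
    by rewrite -normrN ler_norm.
  by rewrite normrM ler_wpM2l.
have e : (N - `|t|) ^+ 2 <= N ^+ 2 + 2 * t * b + t ^+ 2.
  by rewrite sqrrB real_normK ?num_real//; lra.
by rewrite sqr_sqrtr//; apply: le_trans e; exact: sqr_ge0.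
Qed.

Lemma norm_move_le z c j (t : R) : `|move z j t - c| <= `|z - c| + `|t|.
Proof.
apply/norm_le_coordP => [|i]; first by rewrite addr_ge0.
rewrite mxE moveE !mxE addrAC; apply: le_trans (ler_normD _ _) _.
apply: lerD; first by have := coord_le_norm (z - c) i; rewrite !mxE.
by case: ifP => // _; rewrite normr0.
Qed.

Definition box (lo hi : 'rV[R]_d.+1) : set 'rV[R]_d.+1 :=
  [set z | forall i, lo ord0 i <= z ord0 i <= hi ord0 i].

Lemma box_compact lo hi : compact (box lo hi).
Proof.
have := @rV_compact R d.+1 (fun i => `[lo ord0 i, hi ord0 i]%classic).
rewrite (_ : [set v | _] = box lo hi); last first.
  by apply/seteqP; split=> z h i; have := h i; rewrite /= in_itv.
by apply => i; exact: segment_compact.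
Qed.

Lemma box_bounded lo hi : exists T : R, forall z i, box lo hi z -> `|z ord0 i| <= T.
Proof.
exists (`|lo| + `|hi|) => z i /(_ i) /andP[h1 h2].
have := coord_le_norm lo i; have := coord_le_norm hi i.
rewrite !ler_norml => /andP[a1 a2] /andP[b1 b2].
have := normr_ge0 lo; have := normr_ge0 hi => ? ?.
by apply/andP; split; lra.
Qed.

Lemma box_interior lo hi z :
  (forall i, lo ord0 i < z ord0 i < hi ord0 i) ->
  forall i, exists2 r : R, 0 < r & forall t : R, `|t| < r -> box lo hi (move z i t).
Proof.
move=> h i; have /andP[h1 h2] := h i.
exists (Num.min (z ord0 i - lo ord0 i) (hi ord0 i - z ord0 i)).
  by rewrite lt_min !subr_gt0 h1.
move=> t; rewrite lt_min => /andP[]; rewrite !ltr_norml => /andP[? ?] /andP[? ?] j.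
rewrite moveE; have [->|_] := eqVneq j i; first by lra.
by rewrite addr0; have /andP[/ltW -> /ltW ->] := h j.
Qed.

(** The closed set [C] serves to cut out of the box a ball in which a barrier is singular; with
    [C := setT] this is the plain principle with data on the faces. *)
Lemma box_min_principle lo hi (w : 'rV[R]_d.+1 -> R) (C : set 'rV[R]_d.+1) :
  closed C ->
  (forall z, box lo hi z -> C z -> {for z, continuous w}) ->
  (forall z i, box lo hi z -> C z -> z ord0 i = lo ord0 i -> 0 <= w z) ->
  (forall z i, box lo hi z -> C z -> z ord0 i = hi ord0 i -> 0 <= w z) ->
  (forall z, box lo hi z -> C z -> 0 <= w z \/
    ((forall i, exists2 r : R, 0 < r & forall t : R, `|t| < r -> C (move z i t))
     /\ superharmonic_at w z)) ->
  forall z, box lo hi z -> C z -> 0 <= w z.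
Proof.
move=> clC cw wlo whi alt z bz Cz.
have [T HT] := box_bounded lo hi.
apply: (@min_principle R d (box lo hi `&` C) w T) => //.
- by apply: compact_closedI => //; exact: box_compact.
- by move=> x i [bx _]; exact: HT.
- by move=> x [bx Cx]; exact: cw.
move=> x [bx Cx].
have [/existsP[i /eqP xi]|hlo] := boolP [exists i, x ord0 i == lo ord0 i].
  by left; exact: wlo xi.
have [/existsP[i /eqP xi]|hhi] := boolP [exists i, x ord0 i == hi ord0 i].
  by left; exact: whi xi.
have [|[CI sw]] := alt x bx Cx; first by left.
right; split => // i.
have [i' |r r0 Hr] := @box_interior lo hi x _ i.
  have /andP[h1 h2] := bx i'.
  move: hlo hhi => /existsPn/(_ i') l1 /existsPn/(_ i') l2.
  by rewrite !lt_neqAle h1 h2 [lo _ _ == _]eq_sym l1 l2.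
have [s s0 Hs] := CI i; exists (Num.min r s); first by rewrite lt_min r0.
by move=> t; rewrite lt_min => /andP[tr ts]; split; [exact: Hr|exact: Hs].
Qed.

Lemma closed_euclid_ge xi (r : R) : closed [set z | r <= euclid (z - xi)].
Proof.
rewrite -[X in closed X]/((fun z => euclid (z - xi)) @^-1` [set s | r <= s]).
apply: preimage_closed; last exact: closed_ge.
by move=> z _; exact: continuous_euclid.
Qed.

(* A path changing one coordinate at a time. *)
Lemma coordinate_path (f : 'rV[R]_d.+1 -> R) c (r L : R) : 0 <= r ->
  (forall z i t, `|z - c| <= r -> `|move z i t - c| <= r ->
    `|f (move z i t) - f z| <= L * `|t|) ->
  forall z, `|z - c| <= r -> `|f z - f c| <= d.+1%:R * (`|L| * `|z - c|).
Proof.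
move=> r0 H z zc.
pose hyb k : 'rV[R]_d.+1 := \row_i (if (i < k)%N then z ord0 i else c ord0 i).
have hybr k : `|hyb k - c| <= r.
  apply/norm_le_coordP => // i; rewrite !mxE; case: ifP => _.
    by have := coord_le_norm (z - c) i; rewrite !mxE => /le_trans; apply.
  by rewrite subrr normr0.
have hybS (k : 'I_d.+1) : hyb k.+1 = move (hyb k) k (z ord0 k - c ord0 k).
  apply/rowP => i; rewrite moveE !mxE ltnS leq_eqVlt.
  have [ik|ik] /= := eqVneq i k; first by rewrite ik eqxx ltnn /=; ring.
  by rewrite -(inj_eq val_inj) /= in ik; rewrite (negbTE ik) addr0.
have key k : (k <= d.+1)%N -> `|f (hyb k) - f c| <= k%:R * (`|L| * `|z - c|).
  elim: k => [|k IH] kd.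
    rewrite (_ : hyb 0 = c) ?subrr ?normr0 ?mul0r//.
    by apply/rowP => i; rewrite mxE.
  rewrite -natr1 mulrDl mul1r.
  rewrite (_ : f _ - f c = (f (hyb k) - f c) + (f (hyb k.+1) - f (hyb k))); last by ring.
  apply: le_trans (ler_normD _ _) _; apply: lerD; first exact/IH/ltnW.
  have := H (hyb k) (Ordinal kd) (z ord0 (Ordinal kd) - c ord0 (Ordinal kd)) (hybr k).
  rewrite -(hybS (Ordinal kd)) => /(_ (hybr _)) h; apply: le_trans h _.
  apply: le_trans (_ : `|L| * `|z ord0 (Ordinal kd) - c ord0 (Ordinal kd)| <= _).
    by rewrite ler_wpM2r// ler_norm.
  by rewrite ler_wpM2l//; have := coord_le_norm (z - c) (Ordinal kd); rewrite !mxE.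
have := key d.+1 (leqnn _); rewrite (_ : hyb _ = z) //.
by apply/rowP => i; rewrite mxE ltn_ord.
Qed.

End SupNorm.

(** * A reflection estimate for bounded harmonic functions *)

Section Harnack.
Context {R : realType} {d : nat}.
Implicit Types (z c xi x y lo hi : 'rV[R]_d.+1) (i j : 'I_d.+1) (u : 'rV[R]_d.+1 -> R).

Definition harmonic_at u z := {for z, continuous u} /\
  exists2 a, forall j, second_diff u z j (a j) & \sum_j a j = 0.

(** Reflection in the hyperplane through [c] orthogonal to axis [i]. *)
Definition reflect c i z := move z i (2 * (c ord0 i - z ord0 i)).

Lemma reflectE c i z j : reflect c i z ord0 j =
  if j == i then 2 * c ord0 i - z ord0 i else z ord0 j.
Proof. by rewrite moveE; have [->|_] := eqVneq j i; ring. Qed.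

Lemma reflect_move c i z j t :
  reflect c i (move z j t) = move (reflect c i z) j (if j == i then - t else t).
Proof.
apply/rowP => k; rewrite reflectE [in RHS]moveE [in RHS]reflectE !moveE.
have [ji|ji] := eqVneq j i; [subst j|]; have [ki|ki] := eqVneq k i;
  rewrite ?ki ?eqxx ?[i == j]eq_sym ?(negbTE ji); ring.
Qed.

Lemma continuous_reflect c i : continuous (reflect c i).
Proof.
move=> z; rewrite /reflect /move.
apply: (@continuousD _ _ _ id (fun z : 'rV[R]_d.+1 => (2 * (c ord0 i - z ord0 i)) *: basis_vec i)).
  exact: cvg_id.
apply: continuousZr_tmp.
apply: (@continuous_atM _ _ z (fun=> 2) (fun z : 'rV[R]_d.+1 => c ord0 i - z ord0 i)).
  exact: continuous_at_cst.
by apply: continuous_atB; [exact: continuous_at_cst|exact: coord_continuous].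
Qed.

Lemma second_diff_reflect u c i z j a : second_diff u (reflect c i z) j a ->
  second_diff (fun x => u (reflect c i x)) z j a.
Proof.
move=> h e e0; have [r r0 H] := h e e0; exists r => // t /H.
rewrite !reflect_move; case: eqP => // _.
by rewrite opprK [u _ + u _]addrC.
Qed.

(** A gradient estimate in difference form. On a half cube the difference of [u] and its reflection
    vanishes on the mirror and has size at most [A] elsewhere, so up to sign it stays below an
    explicit barrier that grows linearly along the axis. *)
Lemma reflection_bound u c i (r A tau : R) : 0 < r -> 0 <= tau <= r ->
  (forall z, `|z - c| <= r -> harmonic_at u z /\ 0 <= u z <= A) ->
  `|u (move c i tau) - u (move c i (- tau))| <= A * d.+2%:R * (tau / r).
Proof.
move=> r0 /andP[tau0 taur] hu.
have A0 : 0 <= A.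
  by have [|_ /andP[]] := hu c; [rewrite subrr normr0 ltW|exact: le_trans].
(* The half cube on one side of the mirror: in direction [i] it starts at [c] itself. *)
pose lo : 'rV[R]_d.+1 := \row_j (if j == i then c ord0 j else c ord0 j - r).
pose hi : 'rV[R]_d.+1 := \row_j (c ord0 j + r).
have boxr z : box lo hi z -> `|z - c| <= r.
  move=> bz; apply/norm_le_coordP => [|j]; first exact: ltW.
  by have := bz j; rewrite !mxE ler_norml; case: ifP => _; lra.
have reflr z : `|z - c| <= r -> `|reflect c i z - c| <= r.
  move=> zc; apply/norm_le_coordP => [|j]; first exact: ltW.
  have := coord_le_norm (z - c) j.
  rewrite [(z - c) _ _]mxE [(reflect c i z - c) _ _]mxE reflectE !mxE => /le_trans/(_ zc).
  by case: ifP => [/eqP ->|//]; rewrite !ler_norml => /andP[? ?]; apply/andP; split; lra.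
pose q z : R := \sum_(j < d.+1) (z ord0 j - c ord0 j) ^+ 2.
(* With [s] the distance to the mirror divided by [r] and [n = d + 1], this is
   [A * (|z - c|^2 / r^2 + n * s * (1 - s))]. The two Laplacians cancel; it is at least [A] on the
   faces off the mirror and at most [A * (n + 1) * s] on the axis. *)
pose b z : R := A * (r ^- 2 * q z + d.+1%:R * (r^-1 * (z ord0 i - c ord0 i)
  + - r ^- 2 * (z ord0 i - c ord0 i) ^+ 2)).
have bE z : b z = A * (q z / r ^+ 2 + d.+1%:R * ((z ord0 i - c ord0 i) / r)
    * (1 - (z ord0 i - c ord0 i) / r)).
  by rewrite /b; field; rewrite gt_eqF.
have sb z : superharmonic_at b z /\ {for z, continuous b}.
  split.
    exists (fun j => A * (r ^- 2 * (\sum_(k < d.+1) (if j == k then 2 else 0)) +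
      d.+1%:R * (r^-1 * 0 + - r ^- 2 * (if j == i then 2 else 0)))).
      move=> j; apply: second_diffZ; apply: second_diffD; first last.
        apply: second_diffZ; apply: second_diffD; apply: second_diffZ.
          exact: second_diff_lin.
        exact: second_diff_sqr.
      by apply: second_diffZ; apply: second_diff_sum => k; exact: second_diff_sqr.
    rewrite -mulr_sumr big_split /= -!mulr_sumr big_split /= -!mulr_sumr.
    rewrite (eq_bigr (fun=> 2)); last first.
      by move=> j _; rewrite -big_mkcond /= (big_pred1 j)// => k; rewrite eq_sym.
    rewrite -[X in - _ * X]big_mkcond /= big_pred1_eq sumr_const card_ord -mulr_natr.
    rewrite sumr_const mul0rn; set n := d.+1%:R.
    by rewrite (_ : _ + _ = 0) ?mulr0//; ring.
  have cc j : {for z, continuous (fun z : 'rV[R]_d.+1 => z ord0 j - c ord0 j)}.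
    by apply: continuous_atB; [exact: coord_continuous|exact: continuous_at_cst].
  apply: continuous_atM; first exact: continuous_at_cst.
  apply: continuous_atD.
    apply: continuous_atM; first exact: continuous_at_cst.
    by apply: continuous_at_sum => j; exact: continuous_atX.
  apply: continuous_atM; first exact: continuous_at_cst.
  apply: continuous_atD.
    by apply: continuous_atM; first exact: continuous_at_cst.
  apply: continuous_atM; first exact: continuous_at_cst.
  exact: continuous_atX.
have q_ge z j : (z ord0 j - c ord0 j) ^+ 2 <= q z.
  by rewrite /q (bigD1 j)//= lerDl sumr_ge0// => k _; exact: sqr_ge0.
have b_ge0 z : box lo hi z -> A * (q z / r ^+ 2) <= b z.
  move=> bz; rewrite bE ler_wpM2l// lerDl.
  have := bz i; rewrite !mxE eqxx => /andP[h1 h2].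
  apply: mulr_ge0; first by rewrite mulr_ge0 ?ler0n// divr_ge0 ?subr_ge0// ltW.
  by rewrite subr_ge0 ler_pdivrMr// mul1r; lra.
have bnd z j : box lo hi z -> `|z ord0 j - c ord0 j| = r -> A <= b z.
  move=> bz zr; apply: le_trans (b_ge0 _ bz).
  rewrite -[leLHS]mulr1 ler_wpM2l// ler_pdivlMr ?exprn_gt0// mul1r.
  apply: le_trans (q_ge z j); rewrite -[_ ^+ 2 in leRHS]real_normK ?num_real//.
  by rewrite zr.
have key (s : R) : `|s| = 1 -> forall z, box lo hi z ->
    0 <= b z + s * (u z + -1 * u (reflect c i z)).
  move=> s1 z bz.
  have dif x : box lo hi x -> - A <= s * (u x + -1 * u (reflect c i x)).
    move=> /boxr xc.
    have [_ /andP[h1 h2]] := hu _ xc; have [_ /andP[h3 h4]] := hu _ (reflr _ xc).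
    suff: `|s * (u x + -1 * u (reflect c i x))| <= A by rewrite ler_norml => /andP[].
    by rewrite normrM s1 mul1r ler_norml; apply/andP; split; lra.
  apply: (@box_min_principle _ _ lo hi
    (fun z => b z + s * (u z + -1 * u (reflect c i z))) setT) => //.
  - move=> x /boxr xc _; apply: continuous_atD; first exact: (sb x).2.
    apply: continuous_atM; first exact: continuous_at_cst.
    apply: continuous_atD; first exact: (hu _ xc).1.1.
    apply: continuous_atM; first exact: continuous_at_cst.
    apply: continuous_comp; first exact: continuous_reflect.
    exact: (hu _ (reflr _ xc)).1.1.
  - move=> x j bx _; rewrite !mxE; have [-> xi|ji xj] := eqVneq j i.
      rewrite (_ : reflect c i x = x); last first.
        by apply/rowP => k; rewrite reflectE; case: eqP => // ->; rewrite xi; ring.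
      rewrite mulN1r subrr mulr0 addr0; apply: le_trans (b_ge0 _ bx).
      by rewrite mulr_ge0// divr_ge0 ?sqr_ge0//; apply: le_trans (q_ge x i); exact: sqr_ge0.
    have := dif _ bx; have := bnd x j bx; rewrite xj (_ : _ - _ = - r); last by ring.
    by rewrite normrN ger0_norm ?(ltW r0)// => /(_ erefl); lra.
  - move=> x j bx _; rewrite !mxE => xj.
    have := dif _ bx; have := bnd x j bx; rewrite xj (_ : _ - _ = r); last by ring.
    by rewrite ger0_norm ?(ltW r0)// => /(_ erefl); lra.
  - move=> x bx _; right; split; first by move=> j; exists 1.
    have xc := boxr _ bx.
    have [_ [a1 ha1 s1']] := (hu _ xc).1.
    have [_ [a2 ha2 s2']] := (hu _ (reflr _ xc)).1.
    have [[a0 ha0 s0] _] := sb x.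
    exists (fun j => a0 j + s * (a1 j + -1 * a2 j)).
      move=> j; apply: second_diffD; first exact: ha0.
      apply: second_diffZ; apply: second_diffD; first exact: ha1.
      by apply: second_diffZ; exact: second_diff_reflect.
    by rewrite big_split /= -mulr_sumr big_split /= -mulr_sumr s1' s2' !mulr0 !addr0 mulr0 addr0.
have bc : box lo hi (move c i tau).
  move=> j; rewrite moveE !mxE; case: eqP => [_|_]; lra.
have rc : reflect c i (move c i tau) = move c i (- tau).
  by rewrite reflect_move eqxx /reflect subrr mulr0 move0.
have bt : b (move c i tau) <= A * d.+2%:R * (tau / r).
  rewrite bE moveE eqxx.
  have -> : q (move c i tau) = tau ^+ 2.
    rewrite /q (bigD1 i)//= big1 => [|j ji]; rewrite moveE ?eqxx ?(negbTE ji); ring.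
  set x := tau / r; rewrite (_ : c ord0 i + tau - c ord0 i = tau); last by ring.
  rewrite -/x -[leRHS]mulrA ler_wpM2l// -expr_div_n -/x.
  have x0 : 0 <= x by rewrite divr_ge0// ltW.
  have x1 : x <= 1 by rewrite ler_pdivrMr// mul1r.
  have h1 : x ^+ 2 <= x by rewrite expr2 ler_piMr.
  have h2 : d.+1%:R * x * (1 - x) <= d.+1%:R * x.
    by apply: ler_piMr; [rewrite mulr_ge0// ler0n|rewrite gerBl].
  by rewrite -[d.+2]addn1 natrD mulrDl mul1r addrC lerD.
have := key 1 (normr1 _) _ bc; have := key (-1) (normrN1 _) _ bc.
by rewrite rc ler_norml; lra.
Qed.

End Harnack.

(** * Harnack's inequality *)

Section HarnackInequality.
Context {R : realType} {d : nat}.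
Implicit Types (z c xi x y : 'rV[R]_d.+1) (i j : 'I_d.+1) (u : 'rV[R]_d.+1 -> R).

Local Notation n := (d.+1%:R : R).

Lemma dim_ge1 : 1 <= n.
Proof. by rewrite ler1n. Qed.

Lemma move_half z i t x0 (rho : R) : `|z - x0| <= rho -> `|move z i t - x0| <= rho ->
  `|move z i (t / 2) - x0| <= rho.
Proof.
move=> h1 h2.
rewrite (_ : _ - x0 = 2^-1 *: ((z - x0) + (move z i t - x0))).
  rewrite normrZ ger0_norm ?invr_ge0//; have := ler_normD (z - x0) (move z i t - x0).
  lra.
apply/rowP => k; rewrite [LHS]mxE moveE !mxE.
by rewrite -[z ord0 k + t * _]/(z ord0 k + t * _) eqxx /=; case: eqP => _ /=; field.
Qed.

(** Each coordinate step of a path is read as a reflection about its midpoint, around which the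
    radius [s / 2] is still available. *)
Lemma oscillation_bound u x0 (s A rho : R) : 0 < s -> 0 <= rho <= s / 2 ->
  (forall z, `|z - x0| <= s -> harmonic_at u z /\ 0 <= u z <= A) ->
  forall x, `|x - x0| <= rho -> `|u x - u x0| <= n * (A * d.+2%:R / s * rho).
Proof.
move=> s0 /andP[rho0 rhos] hu x xr.
have A0 : 0 <= A.
  by have [|_ /andP[]] := hu x0; [rewrite subrr normr0 ltW|exact: le_trans].
have L0 : 0 <= A * d.+2%:R / s by rewrite divr_ge0 ?mulr_ge0 ?ler0n// ltW.
apply: le_trans (_ : n * (`|A * d.+2%:R / s| * `|x - x0|) <= _); last first.
  by rewrite ger0_norm// ler_wpM2l ?ler0n// ler_wpM2l.
apply: (coordinate_path rho0) => // z i t zr zr'.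
have tr : `|t| <= 2 * rho.
  have := coord_le_norm (move z i t - z) i; rewrite mxE moveE eqxx.
  rewrite mxE addrAC subrr add0r => /le_trans; apply.
  rewrite (_ : move z i t - z = (move z i t - x0) - (z - x0)).
    by apply: le_trans (ler_normB _ _) _; lra.
  by rewrite opprB addrA subrK.
have mr := move_half zr zr'.
have hm y : `|y - move z i (t / 2)| <= s / 2 -> harmonic_at u y /\ 0 <= u y <= A.
  move=> ym; apply: hu.
  rewrite (_ : y - x0 = (y - move z i (t / 2)) + (move z i (t / 2) - x0)).
    by apply: le_trans (ler_normD _ _) _; lra.
  by rewrite addrA subrK.
have := @reflection_bound R d u (move z i (t / 2)) i (s / 2) A (`|t| / 2) _ _ hm.
rewrite !moveD => /(_ ltac:(lra)).
rewrite (_ : A * d.+2%:R * (`|t| / 2 / (s / 2)) = A * d.+2%:R / s * `|t|); last first.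
  by field; rewrite gt_eqF.
have -> : 0 <= `|t| / 2 <= s / 2 by have := normr_ge0 t; lra.
move=> /(_ isT).
have [t0|t0] := leP 0 t.
  by rewrite (ger0_norm t0) -splitr subrr move0.
rewrite (ltr0_norm t0) mulNr subrr opprK -splitr move0.
by rewrite distrC.
Qed.

(** Outside the ball the barrier is [k * rho^n * (|z - x0|^(-n) - (2 n r)^(-n))]: subharmonic, at
    most [k] on the sphere, nonpositive on the faces of the cube of radius [(2 n + 1) r]. The point
    [c] is within Euclidean distance [n r] of [x0], half the distance at which the barrier vanishes,
    so at least half of the power survives there. *)
Lemma power_barrier u c x0 (r rho k : R) : 0 < r -> 0 < rho <= r -> 0 <= k ->
  `|x0 - c| <= r ->
  (forall z, `|z - c| <= (2 * n + 1) * r -> harmonic_at u z /\ 0 <= u z) ->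
  (forall z, euclid (z - x0) <= rho -> k <= u z) ->
  k * (rho / (2 * n * r)) ^+ d.+1 <= u c.
Proof.
move=> r0 /andP[rho0 rhor] k0 x0c hu uk.
have n1 := dim_ge1.
have nr0 : 0 < 2 * n * r by rewrite !mulr_gt0//; lra.
have R0 : 0 <= (2 * n + 1) * r by rewrite mulr_ge0//; lra.
have [cx|xc] := leP (euclid (c - x0)) rho.
  apply: le_trans (uk _ cx); rewrite -[leRHS]mulr1 ler_wpM2l// exprn_ile1//.
    by rewrite divr_ge0// ltW.
  rewrite ler_pdivrMr// mul1r; apply: le_trans rhor _.
  by rewrite -[leLHS]mul1r ler_pM2r//; lra.
pose p z := weighted d.+1 (Cst 1) x0 z.
pose b z := k * rho ^+ d.+1 * (p z - (2 * n * r)^-1 ^+ d.+1).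
pose lo : 'rV[R]_d.+1 := \row_j (c ord0 j - (2 * n + 1) * r).
pose hi : 'rV[R]_d.+1 := \row_j (c ord0 j + (2 * n + 1) * r).
have boxr z : box lo hi z <-> `|z - c| <= (2 * n + 1) * r.
  split=> [bz|/(norm_le_coordP _ R0) zc j].
    by apply/norm_le_coordP => // j; have := bz j; rewrite !mxE ler_norml; lra.
  by have := zc j; rewrite !mxE ler_norml; lra.
have kr0 : 0 <= k * rho ^+ d.+1 by rewrite mulr_ge0// exprn_ge0// ltW.
have far z j : `|z ord0 j - c ord0 j| = (2 * n + 1) * r -> b z <= 0.
  move=> zj; rewrite /b mulr_ge0_le0// subr_le0 /p /weighted /= mul1r.
  have N : 2 * n * r <= euclid (z - x0).
    apply: le_trans (coord_le_euclid (z - x0) j); rewrite !mxE.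
    have := coord_le_norm (x0 - c) j; rewrite !mxE => h.
    have := ler_normD (z ord0 j - x0 ord0 j) (x0 ord0 j - c ord0 j).
    by rewrite addrA subrK zj; lra.
  rewrite lerXn2r ?nnegrE ?invr_ge0 ?euclid_ge0 ?(ltW nr0)//.
  by rewrite lef_pV2 ?posrE//; exact: lt_le_trans N.
have cb z : rho <= euclid (z - x0) -> {for z, continuous b}.
  move=> h; apply: continuous_atM; first exact: continuous_at_cst.
  apply: continuous_atB; last exact: continuous_at_cst.
  by apply: continuous_weighted; exact: lt_le_trans h.
have key : 0 <= u c + -1 * b c.
  apply: (@box_min_principle _ _ lo hi (fun z => u z + -1 * b z)
      [set z | rho <= euclid (z - x0)]).
  - exact: closed_euclid_ge.
  - move=> z /boxr bz Cz; apply: continuous_atD; first exact: (hu _ bz).1.1.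
    by apply: continuous_atM; [exact: continuous_at_cst|exact: cb].
  - move=> z i /boxr bz Cz zi; have := far z i; rewrite zi !mxE.
    rewrite [X in `|X|](_ : _ = - ((2 * n + 1) * r)); last by ring.
    by rewrite normrN ger0_norm// => /(_ erefl); have [_] := hu _ bz; lra.
  - move=> z i /boxr bz Cz zi; have := far z i; rewrite zi !mxE.
    rewrite [X in `|X|](_ : _ = ((2 * n + 1) * r)); last by ring.
    by rewrite ger0_norm// => /(_ erefl); have [_] := hu _ bz; lra.
  - move=> z /boxr bz Cz; have [zrho|rhoz] := leP (euclid (z - x0)) rho.
      left; have uz := uk _ zrho.
      have Nz : euclid (z - x0) = rho by apply/le_anti; rewrite zrho.
      have : b z <= k.
        rewrite /b /p /weighted /= mul1r Nz mulrBr.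
        rewrite [X in X - _](_ : _ = k); last first.
          by rewrite -mulrA -exprMn mulfV ?gt_eqF// expr1n mulr1.
        rewrite gerBl mulr_ge0// exprn_ge0// invr_ge0 ltW//.
      lra.
    right; split.
      move=> i; exists (euclid (z - x0) - rho); first by rewrite subr_gt0.
      by move=> t tr /=; have := euclid_move_ge z x0 i t; lra.
    have N0 : 0 < euclid (z - x0) by exact: lt_trans rhoz.
    have [_ [a ha s]] := (hu _ bz).1.
    exists (fun j => a j + -1 * (k * rho ^+ d.+1 * (weighted d.+1
        (derivW d.+1 j (derivW d.+1 j (Cst 1))) x0 z + 0))).
      move=> j; apply: second_diffD; first exact: ha.
      apply: second_diffZ; apply: second_diffZ; apply: second_diffD.
        exact: second_diff_weighted.
      exact: second_diff_cst.
    rewrite big_split /= s add0r -mulr_sumr -mulr_sumr mulN1r oppr_le0 mulr_ge0//.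
    under eq_bigr do rewrite addr0.
    exact: laplacian_power.
  - by apply/boxr; rewrite subrr normr0.
  - by rewrite /= ltW.
have bc : k * (rho / (2 * n * r)) ^+ d.+1 <= b c.
  rewrite /b /p /weighted /= mul1r exprMn mulrA ler_wpM2l//.
  rewrite lerBrDr -mulr2n -[_ *+ 2]mulr_natl.
  have h1 : (n * r)^-1 <= (euclid (c - x0))^-1.
    have nr : 0 < n * r by rewrite mulr_gt0//; lra.
    rewrite lef_pV2 ?posrE ?(lt_trans rho0 xc)//.
    apply: le_trans (euclid_le_norm _) _; rewrite ler_wpM2l ?ler0n//.
    by rewrite distrC.
  apply: le_trans (_ : (n * r)^-1 ^+ d.+1 <= _); last first.
    rewrite lerXn2r ?nnegrE ?invr_ge0 ?euclid_ge0//.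
    by rewrite mulr_ge0 ?ltW//; lra.
  rewrite -mulrA invfM exprMn mulrA -[leRHS]mul1r ler_wpM2r//.
    by rewrite exprn_ge0// invr_ge0 mulr_ge0 ?ltW//; lra.
  by rewrite exprS mulrA mulfV// mul1r exprn_ile1//; lra.
lra.
Qed.

(** Maximise [(r - |x - c|)^n * u x] over the cube of radius [r]. Around the maximiser [x0], at its
    distance [s0] from the faces, [u] is at most [2^n * u x0], so it stays above [u x0 / 2] on a
    ball of radius [delta * s0]. [power_barrier] carries this to [c] with a loss proportional to
    [s0^n], which the same power in the weight compensates. *)
Lemma harnack : exists2 C : R, 0 < C & forall u c r, 0 < r ->
  (forall z, `|z - c| <= (2 * n + 1) * r -> harmonic_at u z /\ 0 < u z) ->
  forall z, `|z - c| <= r / 2 -> u z <= C * u c.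
Proof.
have n1 := dim_ge1.
(* With this value the oscillation bound on the ball of radius [delta * s0] is exactly
   [u x0 / 2]. *)
pose delta : R := (4 * n * d.+2%:R * 2 ^+ d.+1)^-1.
have two1 : 1 <= 2 ^+ d.+1 :> R by rewrite exprn_ege1//; lra.
have n2 : 1 <= d.+2%:R :> R by rewrite ler1n.
have del0 : 0 < 4 * n * d.+2%:R * 2 ^+ d.+1.
  by rewrite !mulr_gt0 ?exprn_gt0//; lra.
have delta0 : 0 < delta by rewrite invr_gt0.
have delta4 : delta <= 4^-1.
  rewrite lef_pV2 ?posrE// -[leLHS]mulr1; apply: ler_pM => //.
  by rewrite -mulrA -[leLHS]mulr1; apply: ler_pM => //; apply: mulr_ege1.
exists (2 * (4 * n / delta) ^+ d.+1).
  by rewrite mulr_gt0// exprn_gt0// divr_gt0//; lra.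
move=> u c r r0 hu z zc.
have Rr : r <= (2 * n + 1) * r by rewrite -[leLHS]mul1r ler_pM2r//; lra.
pose lo : 'rV[R]_d.+1 := \row_j (c ord0 j - r).
pose hi : 'rV[R]_d.+1 := \row_j (c ord0 j + r).
have boxr x : box lo hi x <-> `|x - c| <= r.
  split=> [bz|/(norm_le_coordP _ (ltW r0)) xc j].
    by apply/norm_le_coordP => [|j]; [exact: ltW|have := bz j; rewrite !mxE ler_norml; lra].
  by have := xc j; rewrite !mxE ler_norml; lra.
pose f x := (r - `|x - c|) ^+ d.+1 * u x.
have bc : box lo hi c by apply/boxr; rewrite subrr normr0 ltW.
have hu' x : `|x - c| <= r -> harmonic_at u x /\ 0 < u x.
  by move=> xc; apply: hu; lra.
have [||x0 /set_mem /boxr x0c fmax] := @compact_EVT_max _ R f _ _ (box_compact (lo:=lo) (hi:=hi)).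
- by exists c.
- apply: continuous_in_subspaceT => x /set_mem /boxr xc.
  apply: (@continuous_atM _ _ x (fun x => (r - `|x - c|) ^+ d.+1) u); last first.
    exact: (hu' _ xc).1.1.
  apply: continuous_atX; apply: continuous_atB; first exact: continuous_at_cst.
  apply: (@continuous_comp _ _ _ (fun x => x - c) (fun x => `|x|)).
    by apply: (@continuousB _ _ _ id (fun=> c)); [exact: cvg_id|exact: cst_continuous].
  exact: norm_continuous.
have ux0 := (hu' _ x0c).2.
pose s0 := r - `|x0 - c|.
have s00 : 0 <= s0 by rewrite subr_ge0.
have s0p : 0 < s0.
  rewrite lt_neqAle s00 andbT; apply/eqP => s0e.
  have := fmax c (mem_set bc); rewrite /f -/s0 -s0e subrr normr0 subr0 expr0n /= mul0r.
  apply/negP; rewrite -ltNge mulr_gt0 ?exprn_gt0//.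
  by apply: (hu' c _).2; rewrite subrr normr0 ltW.
have s0r : s0 <= r by rewrite gerBl.
have ub x : `|x - x0| <= s0 / 2 -> harmonic_at u x /\ 0 <= u x <= 2 ^+ d.+1 * u x0.
  move=> xx0.
  have xc : `|x - c| <= r - s0 / 2.
    rewrite (_ : x - c = (x - x0) + (x0 - c)); last by rewrite addrA subrK.
    by apply: le_trans (ler_normD _ _) _; rewrite /s0 in xx0 *; lra.
  have [ha up] := hu' x ltac:(lra); split => //; rewrite ltW//=.
  have := fmax x (mem_set ((boxr x).2 ltac:(lra))); rewrite /f -/s0 => h.
  have s2 : 0 < s0 / 2 by lra.
  rewrite -(ler_pM2l (exprn_gt0 d.+1 s2)) mulrA -exprMn divfK//.
  apply: le_trans h; rewrite ler_wpM2r ?(ltW up)// lerXn2r ?nnegrE//; lra.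
have rs : 0 <= delta * s0 <= s0 / 2 / 2.
  apply/andP; split; first by rewrite mulr_ge0// ltW.
  by apply: le_trans (_ : 4^-1 * s0 <= _); [rewrite ler_pM2r|lra].
have osc := @oscillation_bound u x0 (s0 / 2) _ _ ltac:(lra) rs ub.
have usmall x : euclid (x - x0) <= delta * s0 -> u x0 / 2 <= u x.
  move=> h; have := osc x (le_trans (norm_le_euclid _) h).
  rewrite [X in _ <= X -> _](_ : _ = u x0 / 2).
    by rewrite ler_norml => /andP[]; lra.
  by rewrite /delta; field; rewrite !gt_eqF//; lra.
have B := @power_barrier u c x0 r (delta * s0) (u x0 / 2) r0 _ _ x0c _ usmall.
have {B} : u x0 / 2 * (delta * s0 / (2 * n * r)) ^+ d.+1 <= u c.
  apply: B; last 1 first.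
  - by move=> x xc; have [? /ltW ?] := hu _ xc.
  - rewrite mulr_gt0//=; apply: le_trans s0r; rewrite -[leRHS]mul1r ler_pM2r//; lra.
  - lra.
move=> h.
have fz := fmax z (mem_set ((boxr z).2 ltac:(lra))).
have uz : 0 < u z by apply: (hu' z _).2; lra.
have zz : (r / 2) ^+ d.+1 * u z <= s0 ^+ d.+1 * u x0.
  apply: le_trans fz; rewrite /f ler_pM2r// lerXn2r ?nnegrE//; lra.
have r2 : 0 < (r / 2) ^+ d.+1 by rewrite exprn_gt0//; lra.
rewrite -(ler_pM2l r2); apply: (le_trans zz).
apply: le_trans (_ : (r / 2) ^+ d.+1 * (2 * (4 * n / delta) ^+ d.+1 *
   (u x0 / 2 * (delta * s0 / (2 * n * r)) ^+ d.+1)) <= _); last first.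
  rewrite ler_pM2l// ler_pM2l// mulr_gt0// exprn_gt0// divr_gt0//; lra.
rewrite le_eqVlt; apply/orP; left; apply/eqP.
rewrite (_ : s0 ^+ d.+1 = (r / 2) ^+ d.+1 * (4 * n / delta) ^+ d.+1 *
   (delta * s0 / (2 * n * r)) ^+ d.+1); first by field.
rewrite -!exprMn; congr (_ ^+ _); field.
by rewrite !gt_eqF//; lra.
Qed.

Definition positive_harmonic u :=
  forall z, half_space z -> harmonic_at u z /\ 0 < u z.

Lemma hplus_positive_harmonic u : hplus u -> positive_harmonic u.
Proof.
move=> [[cu lu] up] z hz; split; last exact: up.
split; first exact: (cu z hz).1.
exists (fun j => 'D_(basis_vec j) ('D_(basis_vec j) u) z); last exact: lu.
move=> j; have z0 : 0 < z ord0 ord_max by exact: hz.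
apply: (second_diff_deriv (Du := 'D_(basis_vec j) u) z0).
  move=> t tz; have hm : half_space (move z j t).
    rewrite /half_space /= moveE; move: tz; rewrite ltr_norml => /andP[? ?].
    by case: eqP => _; lra.
  by apply: DeriveDef => //; have [_ /(_ j)[]] := cu _ hm.
apply: DeriveDef => //.
by have [_ /(_ j)[_ _ /(_ j)[]]] := cu _ hz.
Qed.

(** The cube of radius [(2 n + 1) r] required by [harnack] must stay in the half-space:
    [r = h / (2 (2 n + 1))] makes its radius [h / 2], and [sigma * h] is [r / 2]. *)
Lemma harnack_half_space : exists C sigma : R, [/\ 1 <= C, 0 < sigma, sigma <= 8^-1 &
  forall u c z, positive_harmonic u -> half_space c ->
    `|z - c| <= sigma * c ord0 ord_max -> u z <= C * u c].
Proof.
have n1 := dim_ge1.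
have [C C0 H] := harnack.
exists (C + 1), (4 * (2 * n + 1))^-1; split; first lra.
- by rewrite invr_gt0; lra.
- by rewrite lef_pV2 ?posrE; lra.
move=> u c z hu hc zc.
have c0 : 0 < c ord0 ord_max := hc.
set h := c ord0 ord_max in c0 zc.
have uc := (hu c hc).2.
apply: le_trans (_ : C * u c <= _); last by rewrite ler_pM2r//; lra.
apply: (H u c (h / (2 * (2 * n + 1)))).
- by rewrite divr_gt0//; lra.
- move=> x; rewrite (_ : _ * _ = h / 2); last by field; rewrite gt_eqF//; lra.
  move=> xc; apply: hu; have := coord_le_norm (x - c) ord_max.
  rewrite !mxE -/h /half_space /= => /le_trans/(_ xc); rewrite ler_norml => /andP[]; lra.
- by apply: le_trans zc _; rewrite le_eqVlt; apply/orP; left; apply/eqP; field; rewrite gt_eqF//; lra.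
Qed.

(** A chain of [k] Harnack steps, each raising the height by the factor [1 + sigma], with
    [(1 + sigma)^k >= 4] by Bernoulli. It covers the layer [h <= y <= 4 h] from its bottom. *)
Lemma harnack_vertical : exists2 C : R, 1 <= C & forall u c t,
  positive_harmonic u -> half_space c -> 0 <= t <= 3 * c ord0 ord_max ->
  u (move c ord_max t) <= C * u c.
Proof.
have [C [sigma [C1 sig0 sig8 H]]] := harnack_half_space.
have C0 : 0 <= C by lra.
have step (k : nat) u c t : positive_harmonic u -> half_space c -> 0 <= t ->
    t <= ((1 + sigma) ^+ k - 1) * c ord0 ord_max ->
    u (move c ord_max t) <= C ^+ k * u c.
  move=> hu hc; have c0 : 0 < c ord0 ord_max := hc.
  have uc := (hu c hc).2.
  elim: k t => [|k IH] t t0 tk.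
    rewrite expr0 mul1r; move: tk; rewrite expr0 subrr mul0r => t0'.
    by rewrite (_ : t = 0) ?move0//; apply/le_anti; rewrite t0 t0'.
  (* The preceding point of the chain; the maximum with [0] covers a rise smaller than one full
     step. *)
  pose t' := Num.max 0 ((t - sigma * c ord0 ord_max) / (1 + sigma)).
  have t'0 : 0 <= t' by rewrite le_max lexx.
  have s1 : 0 < 1 + sigma by lra.
  have hm : half_space (move c ord_max t') by rewrite /half_space /= moveE eqxx; lra.
  have sk : 1 <= (1 + sigma) ^+ k by rewrite exprn_ege1//; lra.
  apply: le_trans (_ : C * u (move c ord_max t') <= _); last first.
    rewrite exprS -mulrA ler_wpM2l//; apply: IH => //.
    rewrite ge_max; apply/andP; split; first by rewrite mulr_ge0//; lra.
    rewrite ler_pdivrMr//; move: tk; rewrite exprS; lra.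
  apply: H => //; rewrite moveE eqxx.
  apply/norm_le_coordP => [|i]; first by rewrite mulr_ge0//; lra.
  rewrite mxE moveE mxE moveE.
  have [_|_] := eqVneq i ord_max; last first.
    by rewrite !addr0 subrr normr0 mulr_ge0//; lra.
  have : t' = 0 \/ t' * (1 + sigma) = t - sigma * c ord0 ord_max.
    by rewrite /t' /Num.max; case: ifP => _; [right|left] => //; rewrite divfK// gt_eqF.
  have t'le : (t - sigma * c ord0 ord_max) / (1 + sigma) <= t' by rewrite le_max lexx orbT.
  rewrite ler_pdivrMr// in t'le.
  rewrite [X in `|X|](_ : _ = t - t'); last by ring.
  rewrite ler_norml => -[t'e|t'e].
    by rewrite t'e mul0r in t'le *; apply/andP; split; have := mulr_ge0 (ltW sig0) (ltW c0); lra.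
  have := mulr_ge0 (ltW sig0) t'0; have := mulr_ge0 (ltW sig0) (ltW c0).
  by move=> ? ?; apply/andP; split; lra.
have [k hk] : exists k : nat, 4 <= (1 + sigma) ^+ k.
  exists (Num.truncn (3 / sigma)).+1.
  apply: le_trans (_ : 1 + sigma * (Num.truncn (3 / sigma)).+1%:R <= _).
    have := truncnS_gt (3 / sigma); rewrite ltr_pdivrMr// mulrC; lra.
  elim: (Num.truncn _).+1 => [|k IH]; first by rewrite mulr0 addr0 expr0.
  rewrite exprS -natr1.
  have : (1 + sigma) * (1 + sigma * k%:R) <= (1 + sigma) * (1 + sigma) ^+ k.
    by rewrite ler_pM2l//; lra.
  have : 0 <= sigma * (sigma * k%:R) by rewrite !mulr_ge0 ?ler0n// ltW.
  lra.
exists (C ^+ k); first by rewrite exprn_ege1.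
move=> u c t hu hc /andP[t0 t3]; apply: step => //.
by apply: le_trans t3 _; rewrite ler_pM2r//; lra.
Qed.

End HarnackInequality.

(** * Hyperbolic geometry and packing *)

Section HyperbolicGeometry.
Context {R : realType} {d : nat}.
Implicit Types (z w v a b : 'rV[R]_d.+1) (i j : 'I_d.+1).

Definition height z : R := z ord0 ord_max.

Definition mirror_dist z w : R := euclid (z - reflection w).

(* Comparable to [2 ^ beta z w], see [pow2_beta_le] and [le_pow2_beta]. *)
Definition hyp z w : R := mirror_dist z w ^+ 2 / (height z * height w).

Definition horiz_sqr z w : R :=
  \sum_(i < d.+1 | i != ord_max) (z ord0 i - w ord0 i) ^+ 2.

Lemma mirror_dist_sqr z w :
  mirror_dist z w ^+ 2 = horiz_sqr z w + (height z + height w) ^+ 2.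
Proof.
rewrite euclid_sqr (bigD1 ord_max)//= addrC; congr (_ + _).
  by apply: eq_bigr => i /negbTE im; rewrite !mxE im.
by rewrite !mxE eqxx opprK.
Qed.

Lemma euclid_sqr_horiz z w :
  euclid (z - w) ^+ 2 = horiz_sqr z w + (height z - height w) ^+ 2.
Proof.
rewrite euclid_sqr (bigD1 ord_max)//= addrC; congr (_ + _); last by rewrite !mxE.
by apply: eq_bigr => i _; rewrite !mxE.
Qed.

Lemma horiz_sqr_ge0 z w : 0 <= horiz_sqr z w.
Proof. by apply: sumr_ge0 => i _; exact: sqr_ge0. Qed.

Lemma horiz_sqr_sym z w : horiz_sqr z w = horiz_sqr w z.
Proof. by apply: eq_bigr => i _; rewrite -sqrrN opprB. Qed.

Lemma mirror_dist_ge0 z w : 0 <= mirror_dist z w.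
Proof. exact: euclid_ge0. Qed.

Lemma mirror_dist_sym z w : mirror_dist z w = mirror_dist w z.
Proof.
apply/eqP; rewrite -(eqrXn2 (n := 2)) ?mirror_dist_ge0//.
by rewrite !mirror_dist_sqr horiz_sqr_sym addrC [height z + _]addrC addrC.
Qed.

Lemma hyp_sym z w : hyp z w = hyp w z.
Proof. by rewrite /hyp mirror_dist_sym mulrC [height z * _]mulrC mulrC. Qed.

Lemma le_mirror_dist z w : half_space z -> half_space w ->
  height z + height w <= mirror_dist z w.
Proof.
rewrite /half_space /= -/(height z) -/(height w) => z0 w0.
rewrite -ler_sqr ?nnegrE ?mirror_dist_ge0//; last lra.
by rewrite mirror_dist_sqr lerDr horiz_sqr_ge0.
Qed.

Lemma coord_le_mirror_dist z w i : i != ord_max ->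
  `|z ord0 i - w ord0 i| <= mirror_dist z w.
Proof.
move=> /negbTE im; have := coord_le_euclid (z - reflection w) i.
by rewrite !mxE im.
Qed.

Lemma mirror_dist_gt0 z w : half_space z -> half_space w -> 0 < mirror_dist z w.
Proof.
move=> hz hw; apply: lt_le_trans (le_mirror_dist hz hw).
by rewrite addr_gt0.
Qed.

Lemma hyp_ge4 z w : half_space z -> half_space w -> 4 <= hyp z w.
Proof.
move=> hz hw; have z0 : 0 < height z := hz; have w0 : 0 < height w := hw.
rewrite ler_pdivlMr ?mulr_gt0// mirror_dist_sqr.
by have := horiz_sqr_ge0 z w; have := sqr_ge0 (height z - height w); lra.
Qed.

Lemma hyp_gt0 z w : half_space z -> half_space w -> 0 < hyp z w.
Proof. by move=> hz hw; have := hyp_ge4 hz hw; lra. Qed.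

Lemma hyp_ge_ratio z w : half_space z -> half_space w ->
  height z / height w <= hyp z w.
Proof.
move=> hz hw; have z0 : 0 < height z := hz; have w0 : 0 < height w := hw.
rewrite ler_pdivlMr ?mulr_gt0// [leLHS](_ : _ = height z ^+ 2); last first.
  by field; rewrite gt_eqF.
rewrite ler_sqr ?nnegrE ?mirror_dist_ge0 ?ltW//.
by have := le_mirror_dist hz hw; lra.
Qed.

(** Both mirror distances to [v] are at least [height v], so the sum of their squares times
    [height v ^+ 2] is at most twice the product of the squares; the other factor [2] comes from
    squaring the triangle inequality. *)
Lemma hyp_quasi_triangle z v w : half_space z -> half_space v -> half_space w ->
  hyp z w <= 4 * hyp z v * hyp v w.
Proof.
move=> hz hv hw; have z0 : 0 < height z := hz; have w0 : 0 < height w := hw.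
have v0 : 0 < height v := hv.
have hor : horiz_sqr z w <= 2 * horiz_sqr z v + 2 * horiz_sqr v w.
  rewrite /horiz_sqr !mulr_sumr -big_split /=; apply: ler_sum => i _.
  have := sqr_ge0 ((z ord0 i - v ord0 i) - (v ord0 i - w ord0 i)); lra.
have D1 : height v ^+ 2 <= mirror_dist z v ^+ 2.
  by rewrite ler_sqr ?nnegrE ?mirror_dist_ge0 ?ltW//; have := le_mirror_dist hz hv; lra.
have D2 : height v ^+ 2 <= mirror_dist v w ^+ 2.
  by rewrite ler_sqr ?nnegrE ?mirror_dist_ge0 ?ltW//; have := le_mirror_dist hv hw; lra.
have v2 : 0 < height v ^+ 2 by rewrite exprn_gt0.
have D3 : mirror_dist z w ^+ 2 <= 2 * (mirror_dist z v ^+ 2 + mirror_dist v w ^+ 2).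
  rewrite !mirror_dist_sqr; have := sqr_ge0 (height z - height w).
  have := mulr_gt0 z0 v0; have := mulr_gt0 w0 v0; lra.
have D4 : mirror_dist z w ^+ 2 * height v ^+ 2 <=
    4 * (mirror_dist z v ^+ 2 * mirror_dist v w ^+ 2).
  apply: le_trans (_ : 2 * (mirror_dist z v ^+ 2 + mirror_dist v w ^+ 2) * height v ^+ 2 <= _).
    by rewrite ler_pM2r.
  have := ler_pM (ltW v2) (ltW v2) D1 (lexx (height v ^+ 2)).
  have e1 : mirror_dist z v ^+ 2 * height v ^+ 2 <= mirror_dist z v ^+ 2 * mirror_dist v w ^+ 2.
    by rewrite ler_wpM2l// sqr_ge0.
  have e2 : mirror_dist v w ^+ 2 * height v ^+ 2 <= mirror_dist v w ^+ 2 * mirror_dist z v ^+ 2.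
    by rewrite ler_wpM2l// sqr_ge0.
  lra.
rewrite /hyp (_ : 4 * _ * _ = 4 * (mirror_dist z v ^+ 2 * mirror_dist v w ^+ 2) /
   height v ^+ 2 / (height z * height w)); last by field; rewrite !gt_eqF.
by rewrite ler_pM2r ?invr_gt0 ?mulr_gt0// ler_pdivlMr.
Qed.

Lemma ln2_gt0 : 0 < ln 2 :> R.
Proof. by apply: ln_gt0; rewrite ltr1n. Qed.

Lemma pow2_log2 (x : R) : 0 < x -> 2 `^ (log2 x) = x.
Proof.
move=> x0; rewrite /powR /log2 pnatr_eq0 /= divfK ?gt_eqF ?ln2_gt0//.
by rewrite lnK.
Qed.

Lemma log2_pow2 (x : R) : log2 (2 `^ x) = x.
Proof. by rewrite /log2 ln_powR mulfK// gt_eqF// ln2_gt0. Qed.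

Lemma le_log2 (x y : R) : 0 < x -> x <= y -> log2 x <= log2 y.
Proof.
move=> x0 xy; rewrite /log2 ler_pM2r ?invr_gt0 ?ln2_gt0//.
by rewrite ler_ln ?posrE//; exact: lt_le_trans xy.
Qed.

(** Rationalised: the sum and the difference of the mirror distance and the distance multiply to
    [4 * (height z * height w)], so no subtraction is left. *)
Lemma beta_quotient z w : half_space z -> half_space w ->
  (1 + rho z w) / (1 - rho z w) =
  (euclid (z - w) + mirror_dist z w) ^+ 2 / (4 * (height z * height w)).
Proof.
move=> hz hw; have z0 : 0 < height z := hz; have w0 : 0 < height w := hw.
have b0 := mirror_dist_gt0 hz hw.
rewrite /rho -/(mirror_dist z w); set a := euclid _; set b := mirror_dist z w in b0 *.
have ab : b ^+ 2 - a ^+ 2 = 4 * (height z * height w).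
  by rewrite mirror_dist_sqr euclid_sqr_horiz; ring.
have ba : b - a != 0.
  apply/eqP => h; have : 0 < b ^+ 2 - a ^+ 2 by rewrite ab !mulr_gt0.
  by rewrite subr_sqr h mul0r ltxx.
have ba' : b + a != 0 by rewrite gt_eqF// ltr_wpDr// euclid_ge0.
rewrite -ab subr_sqr; field; rewrite ba ba' gt_eqF//=.
Qed.

Lemma pow2_beta z w : half_space z -> half_space w ->
  2 `^ (beta z w) =
  (euclid (z - w) + mirror_dist z w) ^+ 2 / (4 * (height z * height w)).
Proof.
move=> hz hw; have z0 : 0 < height z := hz; have w0 : 0 < height w := hw.
rewrite /beta beta_quotient// pow2_log2//; apply: divr_gt0; last by rewrite !mulr_gt0.
by apply: exprn_gt0; rewrite ltr_wpDl ?euclid_ge0// mirror_dist_gt0.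
Qed.

Lemma pow2_beta_le z w : half_space z -> half_space w -> 2 `^ (beta z w) <= hyp z w.
Proof.
move=> hz hw; have z0 : 0 < height z := hz; have w0 : 0 < height w := hw.
rewrite pow2_beta// /hyp invfM mulrA ler_pM2r ?invr_gt0 ?mulr_gt0//.
rewrite ler_pdivrMr//.
have : euclid (z - w) <= mirror_dist z w.
  rewrite -ler_sqr ?nnegrE ?euclid_ge0 ?mirror_dist_ge0//.
  rewrite mirror_dist_sqr euclid_sqr_horiz; have := mulr_gt0 z0 w0; lra.
move=> h; apply: le_trans (_ : (mirror_dist z w + mirror_dist z w) ^+ 2 <= _); last lra.
by rewrite ler_sqr ?nnegrE ?addr_ge0 ?euclid_ge0 ?mirror_dist_ge0// lerD2r.
Qed.

Lemma le_pow2_beta z w : half_space z -> half_space w -> hyp z w <= 4 * 2 `^ (beta z w).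
Proof.
move=> hz hw; have z0 : 0 < height z := hz; have w0 : 0 < height w := hw.
rewrite pow2_beta// /hyp (_ : 4 * _ = (euclid (z - w) + mirror_dist z w) ^+ 2 /
  (height z * height w)); last by field; rewrite !gt_eqF.
rewrite ler_pM2r ?invr_gt0 ?mulr_gt0//.
by rewrite ler_sqr ?nnegrE ?addr_ge0 ?euclid_ge0 ?mirror_dist_ge0// lerDr euclid_ge0.
Qed.

Lemma beta_ge0 z w : half_space z -> half_space w -> 0 <= beta z w.
Proof.
move=> hz hw; have z0 : 0 < height z := hz; have w0 : 0 < height w := hw.
rewrite -(log2_pow2 0) -[beta z w]log2_pow2 powRr0; apply: le_log2 => //.
have := le_pow2_beta hz hw; have := hyp_ge4 hz hw; lra.
Qed.

Lemma euclid0 : euclid (0 : 'rV[R]_d.+1) = 0.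
Proof. by rewrite /euclid big1 ?sqrtr0// => i _; rewrite mxE expr0n. Qed.

Lemma beta_refl z : beta z z = 0.
Proof.
by rewrite /beta /rho subrr euclid0 mul0r addr0 subr0 divr1 /log2 ln1 mul0r.
Qed.

Lemma beta_sym z w : half_space z -> half_space w -> beta z w = beta w z.
Proof.
move=> hz hw; rewrite -[LHS]log2_pow2 -[RHS]log2_pow2 !pow2_beta//.
have -> : euclid (z - w) = euclid (w - z).
  by rewrite /euclid; congr Num.sqrt; apply: eq_bigr => i _; rewrite !mxE -sqrrN opprB.
by rewrite mirror_dist_sym (mulrC (height z)).
Qed.

(** The [6] is [log2 (4 * 4 * 4)]: one [4] from [hyp_quasi_triangle], two from comparing [hyp] with
    [2 ^ beta]. *)
Lemma beta_quasi_triangle z v w : half_space z -> half_space v -> half_space w ->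
  beta z w <= beta z v + beta v w + 6.
Proof.
move=> hz hv hw; rewrite -[beta z w]log2_pow2 -[leRHS]log2_pow2.
apply: le_log2; first by rewrite powR_gt0.
rewrite powRD ?pnatr_eq0 ?implybT// powRD ?pnatr_eq0 ?implybT//.
have -> : 2 `^ 6 = 64 :> R by rewrite (powR_mulrn 6)//; ring.
apply: le_trans (pow2_beta_le hz hw) _; apply: le_trans (hyp_quasi_triangle hz hv hw) _.
have h1 := le_pow2_beta hz hv; have h2 := le_pow2_beta hv hw.
have h3 := ler_pM (ltW (hyp_gt0 hz hv)) (ltW (hyp_gt0 hv hw)) h1 h2.
rewrite -mulrA; apply: le_trans (_ : 4 * ((4 * 2 `^ beta z v) * (4 * 2 `^ beta v w)) <= _).
  by rewrite ler_pM2l.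
move: (2 `^ beta z v) (2 `^ beta v w) => A B.
by rewrite le_eqVlt; apply/orP; left; apply/eqP; ring.
Qed.

(** Used in the contrapositive: separated points differ in some coordinate by a fixed multiple of
    the height. *)
Lemma beta_small (delta : R) : 0 < delta -> exists c : R, [/\ 0 < c, c <= 1 &
  forall a b, half_space a -> half_space b -> `|a - b| <= c * height a ->
    beta a b < delta].
Proof.
move=> delta0; pose T : R := 2 `^ delta.
have T1 : 1 < T.
  rewrite /T /powR pnatr_eq0 /= expR_gt1 mulr_gt0// ln2_gt0//.
(* Half of the value at which [(1 + x) / (1 - x)] reaches [T]. *)
pose r0 := (T - 1) / (2 * (T + 1)).
have r00 : 0 < r0 by rewrite divr_gt0//; lra.
have r01 : r0 < 2^-1.
  by rewrite ltr_pdivrMr; lra.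
exists (r0 / d.+1%:R); split; first by rewrite divr_gt0.
  rewrite ler_pdivrMr// mul1r; apply: le_trans (_ : 1 <= _); last by rewrite ler1n.
  lra.
move=> a b ha hb ab; have a0 : 0 < height a := ha; have b0 : 0 < height b := hb.
have m0 := mirror_dist_gt0 ha hb.
have rle : rho a b <= r0.
  rewrite /rho -/(mirror_dist a b) ler_pdivrMr//.
  apply: le_trans (euclid_le_norm _) _.
  apply: le_trans (_ : r0 * height a <= _).
    by rewrite mulrC -ler_pdivlMr ?ltr0n//; apply: le_trans ab _; rewrite mulrAC.
  by rewrite ler_pM2l//; have := le_mirror_dist ha hb; lra.
have rge : 0 <= rho a b by rewrite divr_ge0// ?euclid_ge0.
have q : (1 + rho a b) / (1 - rho a b) < T.
  rewrite ltr_pdivrMr; last lra.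
  have : T * (1 - r0) <= T * (1 - rho a b) by rewrite ler_pM2l; lra.
  have : r0 * (2 * (T + 1)) = T - 1 by rewrite divfK// gt_eqF//; lra.
  lra.
rewrite /beta -[delta]log2_pow2 -/T /log2 ltr_pM2r ?invr_gt0 ?ln2_gt0//.
rewrite ltr_ln ?posrE//; last lra.
by rewrite divr_gt0//; lra.
Qed.

End HyperbolicGeometry.

(** * Dyadic sums and counting of separated points *)

Section Layers.
Context {R : realType}.

Lemma sum_layers_lt (I : eqType) (s : seq I) (f : I -> R) (cl : I -> nat) (t : nat -> R) N :
  (forall k, k \in s -> (cl k < N)%N) ->
  (forall p, (p < N)%N -> \sum_(k <- s | cl k == p) f k <= t p) ->
  \sum_(k <- s) f k <= \sum_(p < N) t p.
Proof.
move=> clN ft; apply: le_trans (_ : \sum_(p < N) \sum_(k <- s | cl k == p) f k <= _).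
  under [leRHS]eq_bigr do rewrite big_mkcond.
  rewrite exchange_big /= le_eqVlt; apply/orP; left; apply/eqP.
  apply: eq_big_seq => k /clN kN.
  rewrite (bigD1 (Ordinal kN))//= eqxx big1 ?addr0// => p pk.
  by rewrite ifN//; apply: contra pk => /eqP kp; apply/eqP/val_inj.
by apply: ler_sum => p _; exact: ft.
Qed.

Lemma sum_layers (I : eqType) (s : seq I) (f : I -> R) (cl : I -> nat) (t : nat -> R) (C : R) :
  (forall p, \sum_(k <- s | cl k == p) f k <= t p) ->
  (forall P, \sum_(p < P) t p <= C) ->
  \sum_(k <- s) f k <= C.
Proof.
move=> ft tC; apply: le_trans (tC (\max_(k <- s) cl k).+1).
by apply: sum_layers_lt => // k ks; rewrite ltnS; exact: leq_bigmax_seq.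
Qed.

Definition floor_log2 (x : R) : nat := trunc_log 2 (Num.truncn x).

Lemma floor_log2_itv x : 1 <= x -> 2 ^+ floor_log2 x <= x < 2 ^+ (floor_log2 x).+1.
Proof.
move=> x1; have x0 : 0 <= x by lra.
have /andP[h1 h2] := truncn_itv x0.
have t0 : (0 < Num.truncn x)%N by rewrite truncn_gt0.
have /andP[h3 h4] := trunc_log_bounds (ltnSn 1) t0.
rewrite -!natrX; apply/andP; split; first by apply: le_trans h1; rewrite ler_nat.
by apply: lt_le_trans h2 _; rewrite ler_nat.
Qed.

Lemma geometric_sum (q : R) P : 0 <= q < 1 -> \sum_(p < P) q ^+ p <= (1 - q)^-1.
Proof.
move=> /andP[q0 q1]; rewrite -[leRHS]mul1r ler_pdivlMr ?subr_gt0//.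
elim: P => [|P IH]; first by rewrite big_ord0 mul0r.
suff -> : (\sum_(p < P.+1) q ^+ p) * (1 - q) = 1 - q ^+ P.+1.
  by rewrite gerBl exprn_ge0.
elim: P {IH} => [|P IH]; first by rewrite big_ord1 expr0 expr1; ring.
by rewrite big_ord_recr /= mulrDl IH [q ^+ P.+2]exprS; ring.
Qed.

Lemma size_le_sum1 (I : Type) (s : seq I) : (size s)%:R = \sum_(k <- s) 1 :> R.
Proof. by rewrite big_const_seq count_predT iter_addr addr0. Qed.

End Layers.

Section Packing.
Context {R : realType} {d : nat}.
Context (z : nat -> 'rV[R]_d.+1) (delta : R).
Context (hz : forall n, half_space (z n)).
Context (delta0 : 0 < delta).
Context (sep : forall n m, n <> m -> delta <= beta (z n) (z m)).

(** Cut the region into cells of side [e * h]. Two points in one cell would be too close for the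
    separation, so the cell map is injective. The ratio [4] of the layer is what the product of two
    dyadic ranges needs in [packing_sum]. *)
Lemma packing : exists2 C : R, 0 <= C & forall (s : seq nat) (h r : R) (c : 'rV[R]_d.+1),
  uniq s -> 0 < h -> 0 <= r ->
  (forall k, k \in s -> h <= height (z k) <= 4 * h) ->
  (forall k i, k \in s -> i != ord_max -> `|z k ord0 i - c ord0 i| <= r) ->
  (size s)%:R <= C * (1 + r / h) ^+ d.
Proof.
have [e [e0 e1 esmall]] := beta_small (R := R) (d := d) delta0.
(* The heights fill an interval of length [3 * h], that is [3 / e] cells. *)
pose B := (Num.truncn (3 / e)).+1.
exists ((2 / e) ^+ d * B%:R) => [|s h r c us h0 r0 sh sr].
  by rewrite mulr_ge0 ?ler0n// exprn_ge0// divr_ge0// ltW.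
pose A := (Num.truncn (2 * r / (e * h))).+1.
have eh0 : 0 < e * h by rewrite mulr_gt0.
pose ix i : 'I_d.+1 := lift ord_max i.
pose cell k : {ffun 'I_d -> 'I_A} * 'I_B :=
  ([ffun i => inord (Num.truncn ((z k ord0 (ix i) - c ord0 (ix i) + r) / (e * h)))],
   inord (Num.truncn ((height (z k) - h) / (e * h)))).
have ixm i : ix i != ord_max by rewrite eq_sym neq_lift.
have trunc_eq (x y : R) : 0 <= x -> 0 <= y -> Num.truncn x = Num.truncn y -> `|x - y| <= 1.
  move=> x0 y0 xy; have /andP[h1 h2] := truncn_itv x0; have /andP[h3 h4] := truncn_itv y0.
  by move: h1 h2; rewrite xy -!natr1 in h4 * => h1 h2; rewrite ler_norml; lra.
have inA k i : k \in s -> 0 <= (z k ord0 (ix i) - c ord0 (ix i) + r) / (e * h) /\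
    (Num.truncn ((z k ord0 (ix i) - c ord0 (ix i) + r) / (e * h)) < A)%N.
  move=> ks; have := sr k (ix i) ks (ixm i); rewrite ler_norml => /andP[h1 h2].
  split; first by apply: divr_ge0; [lra|exact: ltW].
  rewrite ltnS; apply: le_truncn; rewrite ler_pM2r ?invr_gt0//; lra.
have inB k : k \in s -> 0 <= (height (z k) - h) / (e * h) /\
    (Num.truncn ((height (z k) - h) / (e * h)) < B)%N.
  move=> ks; have /andP[h1 h2] := sh k ks.
  split; first by apply: divr_ge0; [lra|exact: ltW].
  rewrite ltnS; apply: le_truncn; rewrite invfM mulrA ler_pdivrMr// mulrAC.
  by rewrite ler_pM2r ?invr_gt0//; lra.
have inj : {in s &, injective cell}.
  move=> k l ks ls [] /ffunP kl1 kl2; apply/eqP/negP => /negP/eqP kl.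
  have := sep kl; apply/negP; rewrite -ltNge; apply: esmall => //.
  have hk := sh k ks.
  apply/norm_le_coordP => [|i]; first by rewrite mulr_ge0 ?ltW//; exact: hz.
  apply: le_trans (_ : 1 * (e * h) <= _); last first.
    by rewrite mul1r ler_pM2l//; lra.
  rewrite -ler_pdivrMr//.
  rewrite -[e * h in X in X <= _]gtr0_norm// -normf_div.
  have [->|im] := eqVneq i ord_max.
    have [p1 q1] := inB k ks; have [p2 q2] := inB l ls.
    move: kl2 => /(congr1 val) /=; rewrite !inordK// => /(trunc_eq _ _ p1 p2).
    by rewrite -mulrBl !mxE -/(height (z k)) -/(height (z l)) opprB addrA subrK.
  have [i' ii'|] := unliftP ord_max i; last by move/eqP; rewrite (negbTE im).
  rewrite -/(ix i') in ii'; subst i.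
  have [p1 q1] := inA k i' ks; have [p2 q2] := inA l i' ls.
  have := kl1 i'; rewrite !ffunE => /(congr1 val) /=; rewrite !inordK// => /(trunc_eq _ _ p1 p2).
  rewrite -mulrBl !mxE; congr (`| _ / _ | <= _); ring.
have sz : (size s <= A ^ d * B)%N.
  rewrite -(size_map cell); have : uniq (map cell s) by rewrite map_inj_in_uniq.
  move=> /card_uniqP <-; apply: leq_trans (max_card _) _.
  by rewrite card_prod card_ffun !card_ord.
apply: le_trans (_ : (A ^ d * B)%:R <= _); first by rewrite ler_nat.
rewrite natrM natrX mulrAC ler_wpM2r ?ler0n// -exprMn.
have x0 : 0 <= 2 * r / (e * h) by apply: divr_ge0; [rewrite mulr_ge0|exact: ltW].
have AB : A%:R <= 2 / e * (1 + r / h).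
  have /andP[h1 _] := truncn_itv x0; rewrite /A -natr1.
  have -> : 2 / e * (1 + r / h) = 2 / e + 2 * r / (e * h) by field; rewrite !gt_eqF.
  rewrite addrC lerD//; apply: le_trans (_ : 2 <= _); first by rewrite ler1n.
  by rewrite ler_pdivlMr//; lra.
by rewrite lerXn2r ?nnegrE ?ler0n//; exact: le_trans AB.
Qed.

(** With [m] the mirror distance put [X = m / height w] and [Y = m / height (z k)], so that
    [hyp = X * Y]. In the class [X ~ 2^q], [Y ~ 2^p] packing allows about [2^(p d)] points, which
    [Y^(-d)] cancels; [hyp^(-theta)] then sums geometrically in [p] and [q]. *)
Lemma packing_sum (theta : R) : 0 < theta ->
  exists2 C : R, 0 <= C & forall (s : seq nat) (w : 'rV[R]_d.+1), uniq s -> half_space w ->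
  \sum_(k <- s) (height (z k) / mirror_dist (z k) w) ^+ d * hyp (z k) w `^ (- theta) <= C.
Proof.
move=> th0; have [C C0 HC] := packing.
pose g : R := 2 `^ (- theta).
have g0 : 0 <= g < 1.
  rewrite powR_ge0 /= /g powRN invf_lt1 ?powR_gt0//.
  by rewrite /powR pnatr_eq0 /= expR_gt1 mulr_gt0// ln2_gt0.
have /andP[g00 g1] := g0.
exists (C * 8 ^+ d * (1 - g)^-1 * (1 - g)^-1).
  by rewrite !mulr_ge0 ?exprn_ge0 ?invr_ge0 ?subr_ge0 ?(ltW g1).
move=> s w us hw; have w0 : 0 < height w := hw.
pose Y k := mirror_dist (z k) w / height (z k).
pose X k := mirror_dist (z k) w / height w.
have zk0 k : 0 < height (z k) := hz k.
have Y1 k : 1 <= Y k.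
  by rewrite ler_pdivlMr// mul1r; have := le_mirror_dist (hz k) hw; have := zk0 k; lra.
have X1 k : 1 <= X k.
  by rewrite ler_pdivlMr// mul1r; have := le_mirror_dist (hz k) hw; have := zk0 k; lra.
have fE k : (height (z k) / mirror_dist (z k) w) ^+ d * hyp (z k) w `^ (- theta) =
    (Y k)^-1 ^+ d * (X k * Y k) `^ (- theta).
  by rewrite /Y invf_div /hyp; congr (_ * _ `^ _); rewrite /X; field; rewrite !gt_eqF.
under eq_bigr do rewrite fE.
apply: (@sum_layers _ _ _ _ (fun k => floor_log2 (Y k))
    (fun p => C * 8 ^+ d * (1 - g)^-1 * g ^+ p)); last first.
  by move=> P; rewrite -mulr_sumr ler_wpM2l ?geometric_sum// !mulr_ge0 ?exprn_ge0 ?invr_ge0 ?subr_ge0 ?(ltW g1).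
move=> p; rewrite -big_filter; set s1 := [seq k <- s | floor_log2 (Y k) == p].
apply: (@sum_layers _ _ _ _ (fun k => floor_log2 (X k))
    (fun q => C * 8 ^+ d * g ^+ p * g ^+ q)); last first.
  move=> P; rewrite -mulr_sumr [leRHS]mulrAC ler_wpM2l ?geometric_sum//.
  by rewrite !mulr_ge0 ?exprn_ge0.
move=> q; rewrite -big_filter; set s2 := [seq k <- s1 | floor_log2 (X k) == q].
have s2P k : k \in s2 -> 2 ^+ p <= Y k < 2 ^+ p.+1 /\ 2 ^+ q <= X k < 2 ^+ q.+1.
  rewrite !mem_filter => /andP[/eqP <- /andP[/eqP <- _]].
  by split; exact: floor_log2_itv.
have p2 m : 0 < 2 ^+ m :> R by rewrite exprn_gt0.
(* In this class the heights lie between [2^q * height w / 2^(p+1)] and four times that, and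
   horizontal coordinates differ from those of [w] by at most [2^(q+1) * height w]. *)
have szs : (size s2)%:R <= C * (1 + 2 ^+ q.+1 * height w / (2 ^+ q * height w / 2 ^+ p.+1)) ^+ d.
  apply: (HC s2 _ _ w).
  - by rewrite !filter_uniq.
  - by rewrite divr_gt0// mulr_gt0.
  - by rewrite mulr_ge0// ltW.
  - move=> k /s2P[/andP[y1 y2] /andP[x1 x2]].
    have zE : height (z k) = X k * height w / Y k.
      rewrite /X /Y; field; rewrite !gt_eqF// mirror_dist_gt0//.
    have Yk0 : 0 < Y k by apply: lt_le_trans (Y1 k).
    have xw : 2 ^+ q * height w <= X k * height w < 2 ^+ q.+1 * height w.
      by rewrite ler_pM2r// ltr_pM2r// x1.
    have /andP[xw1 xw2] := xw.
    rewrite zE; apply/andP; split.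
      apply: ler_pM => //; first by rewrite mulr_ge0// ltW.
      by rewrite lef_pV2 ?posrE// ltW.
    apply: le_trans (_ : 2 ^+ q.+1 * height w / 2 ^+ p <= _).
      apply: ler_pM; [|by rewrite invr_ge0 ltW|exact: ltW|by rewrite lef_pV2 ?posrE].
      by rewrite mulr_ge0 ?ltW//; have := X1 k; lra.
    rewrite le_eqVlt; apply/orP; left; apply/eqP; rewrite !exprS; field.
    by rewrite gt_eqF.
  - move=> k i /s2P[_ /andP[_ x2]] im.
    apply: le_trans (coord_le_mirror_dist _ _ im) _.
    by rewrite -ler_pdivrMr// ltW.
have term k : k \in s2 -> (Y k)^-1 ^+ d * (X k * Y k) `^ (- theta) <= (2 ^+ p)^-1 ^+ d * (g ^+ p * g ^+ q).
  move=> /s2P[/andP[y1 y2] /andP[x1 x2]].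
  have Yk0 : 0 < Y k by apply: lt_le_trans (Y1 k).
  have Xk0 : 0 < X k by apply: lt_le_trans (X1 k).
  apply: ler_pM; rewrite ?powR_ge0 ?exprn_ge0 ?invr_ge0 ?(ltW Yk0)//.
    by rewrite lerXn2r ?nnegrE ?invr_ge0 ?(ltW Yk0) ?(ltW (p2 p))// lef_pV2 ?posrE.
  rewrite -exprD powRN /g powRN exprVn lef_pV2 ?posrE ?exprn_gt0 ?powR_gt0//; last exact: mulr_gt0.
  rewrite -powR_mulrn ?powR_ge0// -powRrM mulrC powRrM powR_mulrn//.
  apply: ge0_ler_powR; first exact: ltW.
  - by rewrite nnegrE exprn_ge0.
  - by rewrite nnegrE mulr_ge0// ltW.
  by rewrite addnC exprD; apply: ler_pM => //; exact: ltW.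
apply: le_trans (_ : \sum_(k <- s2) (2 ^+ p)^-1 ^+ d * (g ^+ p * g ^+ q) <= _).
  by rewrite big_seq [leRHS]big_seq; apply: ler_sum => k; exact: term.
rewrite big_const_seq count_predT iter_addr addr0 -[leLHS]mulr_natl.
apply: le_trans (_ : C * (1 + 2 ^+ q.+1 * height w / (2 ^+ q * height w / 2 ^+ p.+1)) ^+ d *
   ((2 ^+ p)^-1 ^+ d * (g ^+ p * g ^+ q)) <= _).
  by rewrite ler_wpM2r// !mulr_ge0 ?exprn_ge0 ?invr_ge0// ltW.
set T := (X in C * X ^+ d).
rewrite -[leLHS]mulrA -[leRHS]mulrA -[X in _ <= X]mulrA ler_wpM2l// [leLHS]mulrA -exprMn.
rewrite ler_wpM2r ?mulr_ge0 ?exprn_ge0//.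
have T0 : 0 <= T.
  by rewrite /T addr_ge0// divr_ge0 ?mulr_ge0 ?exprn_ge0 ?invr_ge0 ?exprn_ge0// ltW.
rewrite lerXn2r ?nnegrE ?(mulr_ge0 T0) ?invr_ge0 ?exprn_ge0// /T.
rewrite (_ : 2 ^+ q.+1 * height w / _ = 4 * 2 ^+ p); last first.
  by rewrite !exprS; field; rewrite !gt_eqF.
rewrite ler_pdivrMr//; have : 1 <= 2 ^+ p :> R by rewrite exprn_ege1// ler1n.
lra.
Qed.

Context (M alpha : R).
Context (alpha0 : 0 < alpha).
Context (M0 : 0 < M).
Context (growth : forall (l n : nat) (s : seq nat), (0 < l)%N -> uniq s ->
  (forall k, k \in s -> beta (z k) (z n) <= l%:R) ->
  (size s)%:R <= M * 2 `^ (alpha * d%:R * l%:R)).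

(** In the shell [2^p <= hyp < 2^(p+1)] one has [beta <= p + 1], so it holds [O(2^(alpha d p))]
    points of weight at most [2^(- sigma p)] each. *)
Lemma growth_sum (sigma : R) : alpha * d%:R < sigma ->
  exists2 C : R, 0 <= C & forall (s : seq nat) (n : nat), uniq s ->
  \sum_(k <- s) hyp (z k) (z n) `^ (- sigma) <= C.
Proof.
have [a aE] : exists a, a = alpha * d%:R by exists (alpha * d%:R).
have gr := growth; rewrite -aE in gr * => asig.
have a0 : 0 <= a by rewrite aE mulr_ge0 ?ler0n// ltW.
pose g : R := 2 `^ (a - sigma).
have g0 : 0 <= g < 1.
  rewrite powR_ge0 /= /g -opprB powRN invf_lt1 ?powR_gt0//.
  by rewrite /powR pnatr_eq0 /= expR_gt1 mulr_gt0 ?ln2_gt0// subr_gt0.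
have /andP[g00 g1] := g0.
exists (M * 2 `^ a * (1 - g)^-1).
  by rewrite !mulr_ge0 ?powR_ge0 ?invr_ge0 ?subr_ge0 ?(ltW M0) ?(ltW g1).
move=> s n us.
apply: (@sum_layers _ _ _ _ (fun k => floor_log2 (hyp (z k) (z n)))
    (fun p => M * 2 `^ a * g ^+ p)); last first.
  by move=> P; rewrite -mulr_sumr ler_wpM2l ?geometric_sum// mulr_ge0 ?powR_ge0// ltW.
move=> p; rewrite -big_filter; set s1 := [seq k <- s | floor_log2 (hyp (z k) (z n)) == p].
have s1P k : k \in s1 -> 2 ^+ p <= hyp (z k) (z n) < 2 ^+ p.+1.
  rewrite mem_filter => /andP[/eqP <- _]; apply: floor_log2_itv.
  by have := hyp_ge4 (hz k) (hz n); lra.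
have p2 m : 0 < 2 ^+ m :> R by rewrite exprn_gt0.
have sz : (size s1)%:R <= M * 2 `^ (a * p.+1%:R).
  apply: (gr _ n) => //; first by rewrite filter_uniq.
  move=> k /s1P /andP[_ h]; rewrite -[leLHS]log2_pow2 -[leRHS]log2_pow2.
  apply: le_log2; first by rewrite powR_gt0.
  by rewrite powR_mulrn// ltW//; apply: le_lt_trans h; exact: pow2_beta_le.
apply: le_trans (_ : \sum_(k <- s1) (2 ^+ p) `^ (- sigma) <= _).
  rewrite big_seq [leRHS]big_seq; apply: ler_sum => k /s1P/andP[h1 h2].
  rewrite !powRN lef_pV2 ?posrE ?powR_gt0//; last exact: lt_le_trans h1.
  apply: ge0_ler_powR; rewrite ?nnegrE ?(ltW (p2 p))//; first lra.
  exact: ltW (lt_le_trans (p2 p) h1).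
rewrite big_const_seq count_predT iter_addr addr0 -[leLHS]mulr_natl.
apply: le_trans (_ : M * 2 `^ (a * p.+1%:R) * (2 ^+ p) `^ (- sigma) <= _).
  by rewrite ler_wpM2r// powR_ge0.
rewrite -!mulrA ler_wpM2l ?(ltW M0)// /g -[p.+1%:R]natr1 mulrDr mulr1.
rewrite powRD ?pnatr_eq0 ?implybT// [X in X * _]mulrC -mulrA ler_wpM2l ?powR_ge0//.
rewrite -powR_mulrn// -powRrM -powRD ?pnatr_eq0 ?implybT//.
rewrite -[leRHS]powR_mulrn ?powR_ge0// -powRrM.
by rewrite le_eqVlt; apply/orP; left; apply/eqP; congr (_ `^ _); ring.
Qed.

End Packing.

(** * Growth of interpolating sequences *)

Section Necessity.
Context {R : realType} {d : nat}.
Context (z : nat -> 'rV[R]_d.+1) (delta : R).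
Context (hz : forall n, half_space (z n)).
Context (delta0 : 0 < delta).
Context (sep : forall n m, n <> m -> delta <= beta (z n) (z m)).
Context (hd : (1 < d)%N).

Lemma bernoulli_sub (x : R) m : 0 <= x <= 1 -> 1 - m%:R * x <= (1 - x) ^+ m.
Proof.
move=> /andP[x0 x1]; elim: m => [|m IH]; first by rewrite expr0 mul0r subr0.
rewrite exprS -natr1; apply: le_trans (_ : (1 - x) * (1 - m%:R * x) <= _).
  have : 0 <= m%:R * (x * x) by rewrite !mulr_ge0 ?ler0n.
  lra.
by rewrite ler_wpM2l//; lra.
Qed.

Lemma bump_coefficient_le (c t e q U H y W hd' : R) :
  0 <= c -> 0 <= t -> 0 <= e -> 0 <= q -> 0 <= U -> 0 <= W ->
  H <= y * W -> y * q <= hd' -> c * t * (e * q) * (U * H) <= c * U * (t * hd') * (e * W).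
Proof.
move=> c0 t0 e0 q0 U0 W0 HW yq.
apply: le_trans (_ : c * t * e * q * U * (y * W) <= _).
  rewrite (_ : c * t * (e * q) * (U * H) = c * t * e * q * U * H); last by ring.
  by rewrite ler_wpM2l ?mulr_ge0.
rewrite (_ : _ * (y * W) = c * t * e * U * W * (y * q)); last by ring.
rewrite (_ : c * U * _ * _ = c * t * e * U * W * hd'); last by ring.
by rewrite ler_wpM2l ?mulr_ge0.
Qed.

Lemma expr_le_self (x : R) m : 0 <= x <= 1 -> (0 < m)%N -> x ^+ m <= x.
Proof.
by move=> /andP[x0 x1]; case: m => // m _; rewrite exprS ler_piMr// exprn_ile1.
Qed.

Lemma expr_1D_le2 (x : R) m : 0 <= x -> m%:R * x <= 2^-1 -> (1 + x) ^+ m <= 2.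
Proof.
move=> x0 mx; have [->|m0] := posnP m; first by rewrite expr0; lra.
have x1 : x <= 1.
  have : 1 * x <= m%:R * x by rewrite ler_wpM2r// ler1n.
  lra.
have := bernoulli_sub m (x := x) ltac:(lra) => h.
have h2 : ((1 + x) * (1 - x)) ^+ m <= 1.
  apply: exprn_ile1; have := mulr_ge0 x0 x0; last lra.
  by move=> _; apply: mulr_ge0; lra.
rewrite exprMn in h2.
have p0 : 0 <= (1 + x) ^+ m by rewrite exprn_ge0//; lra.
have h3 : 2^-1 <= 1 - m%:R * x by lra.
have := ler_wpM2l p0 (le_trans h3 h); lra.
Qed.

(** The inverse of [hyp] is [height a / m] times [height w / m], both at most [1]. Keeping one power
    of the second factor turns the bound into a Poisson kernel evaluated at [w]. *)
Lemma hyp_inv_expr_le (a w : 'rV[R]_d.+1) : half_space a -> half_space w ->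
  (hyp a w)^-1 ^+ d <= height a ^+ d * (height w / mirror_dist a w ^+ d.+1).
Proof.
move=> ha hw; have m0 := mirror_dist_gt0 ha hw; have le_m := le_mirror_dist ha hw.
have a0 : 0 < height a := ha; have w0 : 0 < height w := hw.
rewrite /hyp; move: (mirror_dist a w) (height a) (height w) m0 le_m a0 w0 => m x y m0 le_m x0 y0.
rewrite (_ : _^-1 = (x / m) * (y / m)); last by field; rewrite !gt_eqF.
rewrite (_ : x ^+ d * _ = (x / m) ^+ d * (y / m)); last first.
  by rewrite exprMn exprVn exprS; field; rewrite !gt_eqF ?exprn_gt0.
rewrite exprMn ler_wpM2l ?exprn_ge0 ?divr_ge0 ?(ltW x0) ?(ltW m0)//.
apply: expr_le_self; last exact: ltnW.
by rewrite divr_ge0 ?(ltW y0) ?(ltW m0)//= ler_pdivrMr// mul1r; lra.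
Qed.

Definition at_height (x : 'rV[R]_d.+1) (y : R) : 'rV[R]_d.+1 :=
  \row_i (if i == ord_max then y else x ord0 i).

Lemma at_height_last x y : at_height x y ord0 ord_max = y.
Proof. by rewrite mxE eqxx. Qed.

Lemma euclid_sqr_at_height a x y :
  euclid (a - at_height x y) ^+ 2 = horiz_sqr a x + (height a - y) ^+ 2.
Proof.
rewrite euclid_sqr_horiz /height at_height_last; congr (_ + _).
by apply: eq_bigr => i /negbTE im; rewrite mxE im.
Qed.

(* The harmonic function below the comparison point, positive near the point
   of the hyperplane [y = h] above its pole, nonpositive elsewhere on it. *)
Definition bump (tau h : R) (x a : 'rV[R]_d.+1) : R :=
  poisson (at_height x ((1 - tau) * h)) a + - 2^-1 *
  poisson (at_height x ((1 - 4 * tau) * h)) a.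

Lemma bump_le_poisson tau h x a : 0 < tau <= 4^-1 -> 0 < h -> h <= height a ->
  bump tau h x a <= poisson (at_height x ((1 - tau) * h)) a.
Proof.
move=> /andP[t0 t4] h0 ha; have th := mulr_gt0 t0 h0.
rewrite /bump gerDl mulNr oppr_le0 mulr_ge0// poissonE at_height_last.
rewrite divr_ge0 ?exprn_ge0 ?euclid_ge0//; rewrite /height in ha; lra.
Qed.

Lemma poisson_le_power tau h x a : 0 < tau <= 4^-1 -> 0 < h -> h <= height a ->
  poisson (at_height x ((1 - tau) * h)) a <=
    (euclid (a - at_height x ((1 - tau) * h)))^-1 ^+ d.
Proof.
move=> /andP[t0 t4] h0 ha; have th := mulr_gt0 t0 h0.
rewrite poissonE exprS invfM exprVn mulrA ler_piMl//.
  by rewrite invr_ge0 exprn_ge0// euclid_ge0.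
have N0 : 0 < euclid (a - at_height x ((1 - tau) * h)).
  by apply: euclid_gt0; rewrite at_height_last; rewrite /height in ha; lra.
rewrite ler_pdivrMr// mul1r.
have := coord_le_euclid (a - at_height x ((1 - tau) * h)) ord_max.
by rewrite [(_ - _ : 'rV[R]_d.+1) _ _]mxE [(- _ : 'rV[R]_d.+1) _ _]mxE at_height_last ler_norml => /andP[].
Qed.

(** At height [h] the numerators are [tau * h] and [4 * tau * h], so with the coefficient [1/2] the
    sign is that of [N2^n - 2 * N1^n]. Beyond horizontal distance [sigma * h] the two depths hardly
    matter: the choice of [tau] gives [N2 <= (1 + eta) * N1] with [eta = 1 / (2 n)], and
    [(1 + eta)^n <= 2]. *)
Lemma bump_le0 tau sigma h x a : 0 < sigma <= 1 -> tau = sigma / (4 * d.+1%:R) ->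
  0 < h -> height a = h -> sigma ^+ 2 * h ^+ 2 <= horiz_sqr a x ->
  bump tau h x a <= 0.
Proof.
move=> /andP[s0 s1] tauE h0 ha far.
have n1 : 1 <= d.+1%:R :> R by rewrite ler1n.
have t0 : 0 < tau by rewrite tauE divr_gt0//; lra.
have th := mulr_gt0 t0 h0.
have t4 : tau <= 4^-1.
  rewrite tauE ler_pdivrMr; last lra.
  lra.
rewrite /bump !poissonE !at_height_last -/(height a) ha.
set N1 := euclid _; set N2 := euclid _.
have N10 : 0 < N1 by apply: euclid_gt0; rewrite at_height_last -/(height a) ha; lra.
have N20 : 0 < N2 by apply: euclid_gt0; rewrite at_height_last -/(height a) ha; lra.
have N1E : N1 ^+ 2 = horiz_sqr a x + tau ^+ 2 * h ^+ 2.
  by rewrite /N1 euclid_sqr_at_height ha; ring.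
have N2E : N2 ^+ 2 = horiz_sqr a x + 16 * (tau ^+ 2 * h ^+ 2).
  by rewrite /N2 euclid_sqr_at_height ha; ring.
pose eta : R := (2 * d.+1%:R)^-1.
have eta0 : 0 < eta by rewrite invr_gt0; lra.
have N12 : N2 <= N1 * (1 + eta).
  have eta1 : 0 <= 1 + eta by lra.
  rewrite -ler_sqr ?nnegrE ?(mulr_ge0 (ltW N10) eta1) ?(ltW N20)//.
  rewrite exprMn N2E N1E.
  have te : 16 * (tau ^+ 2 * h ^+ 2) <= 2 * eta * (sigma ^+ 2 * h ^+ 2).
    rewrite (_ : 16 * (tau ^+ 2 * h ^+ 2) = d.+1%:R^-1 * d.+1%:R^-1 * (sigma ^+ 2 * h ^+ 2)).
      rewrite ler_pM2r ?mulr_gt0 ?exprn_gt0// (_ : 2 * eta = d.+1%:R^-1 * 1).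
        by rewrite ler_pM2l ?invr_gt0 ?invf_le1//; lra.
      by rewrite /eta; field; rewrite gt_eqF//; lra.
    by rewrite tauE; field; rewrite gt_eqF//; lra.
  have : 2 * eta * (sigma ^+ 2 * h ^+ 2) <= 2 * eta * horiz_sqr a x.
    by rewrite ler_pM2l//; lra.
  have h3 := horiz_sqr_ge0 a x.
  have h4 : 0 <= tau ^+ 2 * h ^+ 2 by rewrite mulr_ge0// sqr_ge0.
  move: te h3 h4 (ltW eta0); clear.
  move: (horiz_sqr a x) (tau ^+ 2 * h ^+ 2) (sigma ^+ 2 * h ^+ 2) eta => X t S e.
  move=> te X0 t0 e0 eS; have := mulr_ge0 e0 t0.
  have := mulr_ge0 (mulr_ge0 e0 e0) X0; have := mulr_ge0 (mulr_ge0 e0 e0) t0.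
  rewrite expr2; lra.
have N12n : N2 ^+ d.+1 <= 2 * N1 ^+ d.+1.
  apply: le_trans (_ : (N1 * (1 + eta)) ^+ d.+1 <= _).
    have eta1 : 0 <= 1 + eta by lra.
    by rewrite lerXn2r ?nnegrE ?(mulr_ge0 (ltW N10) eta1) ?(ltW N20).
  rewrite exprMn mulrC ler_pM2r ?exprn_gt0//; apply: expr_1D_le2; first exact: ltW.
  by rewrite /eta invfM mulrCA mulfV ?mulr1// gt_eqF//; lra.
rewrite (_ : h - (1 - tau) * h = tau * h); last by ring.
rewrite (_ : h - (1 - 4 * tau) * h = 4 * (tau * h)); last by ring.
rewrite (_ : _ + _ = tau * h * ((N1 ^+ d.+1)^-1 - 2 / N2 ^+ d.+1)); last first.
  by field; rewrite !gt_eqF ?exprn_gt0.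
rewrite mulr_ge0_le0 ?(ltW th)// subr_le0 ler_pdivlMr ?exprn_gt0// mulrC.
by rewrite ler_pdivrMr ?exprn_gt0.
Qed.

(** Since [N1 <= N2], both kernels may be given the denominator [N1^n]; the numerator left over is
    [(height a - h) / 2 - tau * h], at least [height a / 8]. *)
Lemma bump_ge tau h x a : 0 < tau <= 8^-1 -> 0 < h -> 2 * h <= height a ->
  0 < height x ->
  8^-1 * (height a / mirror_dist x a ^+ d.+1) <= bump tau h x a.
Proof.
move=> /andP[t0 t8] h0 ha x0; have th := mulr_gt0 t0 h0.
have th8 : tau * h <= 8^-1 * h by rewrite ler_pM2r.
have m0 : 0 < mirror_dist x a by apply: mirror_dist_gt0 => //; rewrite /half_space /= -/(height a); lra.
rewrite /bump !poissonE !at_height_last -/(height a).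
set N1 := euclid _; set N2 := euclid _.
have N10 : 0 < N1 by apply: euclid_gt0; rewrite at_height_last -/(height a); lra.
have N20 : 0 < N2 by apply: euclid_gt0; rewrite at_height_last -/(height a); lra.
have N12 : N1 <= N2.
  rewrite -ler_sqr ?nnegrE ?(ltW N10) ?(ltW N20)// !euclid_sqr_at_height lerD2l ler_sqr ?nnegrE; lra.
have N1m : N1 <= mirror_dist x a.
  rewrite -ler_sqr ?nnegrE ?(ltW N10) ?(ltW m0)// euclid_sqr_at_height mirror_dist_sqr horiz_sqr_sym.
  by rewrite lerD2l ler_sqr ?nnegrE; lra.
apply: le_trans (_ : 8^-1 * (height a / N1 ^+ d.+1) <= _).
  rewrite ler_pM2l// ler_pM2l; last lra.
  by rewrite lef_pV2 ?posrE ?exprn_gt0// lerXn2r ?nnegrE ?(ltW N10) ?(ltW m0).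
have : (height a - (1 - 4 * tau) * h) / N2 ^+ d.+1 <= (height a - (1 - 4 * tau) * h) / N1 ^+ d.+1.
  rewrite ler_pM2l; last lra.
  by rewrite lef_pV2 ?posrE ?exprn_gt0// lerXn2r ?nnegrE ?(ltW N10) ?(ltW N20).
have I0 : 0 < (N1 ^+ d.+1)^-1 by rewrite invr_gt0 exprn_gt0.
have : 8^-1 * height a * (N1 ^+ d.+1)^-1 <= (height a - (1 - tau) * h
   - 2^-1 * (height a - (1 - 4 * tau) * h)) * (N1 ^+ d.+1)^-1.
  by rewrite ler_pM2r//; lra.
lra.
Qed.

Lemma superharmonic_bump (u : 'rV[R]_d.+1 -> R) tau h (b : nat -> R) (s : seq nat) (e : R) a :
  0 < tau <= 8^-1 -> 0 < h -> h <= height a -> harmonic_at u a ->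
  let w x := u x + -1 * (\sum_(k <- s) b k * bump tau h (z k) x) + e in
  {for a, continuous w} /\ superharmonic_at w a.
Proof.
move=> /andP[t0 t8] h0 ha [cu [a0 ha0 s0]] w; have th := mulr_gt0 t0 h0.
have th8 : tau * h <= 8^-1 * h by rewrite ler_pM2r.
have N1 k : 0 < euclid (a - at_height (z k) ((1 - tau) * h)).
  by apply: euclid_gt0; rewrite at_height_last -/(height a); lra.
have N2 k : 0 < euclid (a - at_height (z k) ((1 - 4 * tau) * h)).
  by apply: euclid_gt0; rewrite at_height_last -/(height a); lra.
split.
  apply: continuous_atD; last exact: continuous_at_cst.
  apply: continuous_atD => //; apply: continuous_atM; first exact: continuous_at_cst.
  apply: continuous_at_sum => k; apply: continuous_atM; first exact: continuous_at_cst.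
  apply: continuous_atD; first exact: continuous_weighted.
  by apply: continuous_atM; [exact: continuous_at_cst|exact: continuous_weighted].
pose L xi j : R := weighted d.+1 (derivW d.+1 j (derivW d.+1 j (@Ht R d))) xi a.
exists (fun j => a0 j + -1 * (\sum_(k <- s) b k * (L (at_height (z k) ((1 - tau) * h)) j +
   - 2^-1 * L (at_height (z k) ((1 - 4 * tau) * h)) j)) + 0).
  move=> j; apply: second_diffD; last exact: second_diff_cst.
  apply: second_diffD => //; apply: second_diffZ; apply: second_diff_sum => k.
  apply: second_diffZ; apply: second_diffD; first exact: second_diff_weighted.
  by apply: second_diffZ; exact: second_diff_weighted.
under eq_bigr do rewrite addr0.
rewrite big_split /= s0 add0r -mulr_sumr exchange_big /= big1 ?mulr0// => k _.
by rewrite -mulr_sumr big_split /= -mulr_sumr !laplacian_poisson// mulr0 addr0 mulr0.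
Qed.

(** For the outer faces of a large box around [w]: the kernel is at most the inverse distance to its
    pole once that distance is at least [1], and [4 * h] pays for the gap between the heights of the
    pole and of [x]. *)
Lemma bump_far tau h (x w a : 'rV[R]_d.+1) i (Q T : R) : 0 < tau <= 4^-1 -> 0 < h ->
  h <= height x <= 4 * h -> h <= height a -> `|a ord0 i - w ord0 i| = T ->
  2 * `|w - x| + 2 * (Q + 1) + 4 * h <= T -> 0 <= Q ->
  bump tau h x a <= (Q + 1)^-1.
Proof.
move=> tau4 h0 hx ha aT QT Q0; have [t0 t4] := andP tau4; have th := mulr_gt0 t0 h0.
have th4 : tau * h <= 4^-1 * h by rewrite ler_pM2r.
apply: le_trans (bump_le_poisson _ _ _ _) _ => //.
apply: le_trans (poisson_le_power _ _ _ _) _ => //.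
set N := euclid _.
have N1 : Q + 1 <= N.
  apply: le_trans (coord_le_euclid _ i); rewrite [X in `|X|]mxE [(- _ : 'rV[R]_d.+1) _ _]mxE mxE.
  have := coord_le_norm (w - x) i; rewrite !mxE => wx.
  have nw := normr_ge0 (w - x).
  have [im|im] := eqVneq i ord_max; last first.
    have := ler_normD (a ord0 i - x ord0 i) (x ord0 i - w ord0 i).
    by rewrite addrA subrK aT (distrC (x ord0 i)); lra.
  rewrite im -/(height w) -/(height x) -/(height a) in aT wx *.
  have := ler_normD (height a - (1 - tau) * h) ((1 - tau) * h - height w).
  rewrite addrA subrK aT.
  have := ler_normD ((1 - tau) * h - height x) (height x - height w).
  rewrite addrA subrK (distrC (height x) (height w)).
  have : `|(1 - tau) * h - height x| <= 4 * h.
    by rewrite ler_norml; apply/andP; split; lra.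
  lra.
have N0 : 0 < N by apply: lt_le_trans N1; lra.
have Nle : N^-1 <= (Q + 1)^-1 by rewrite lef_pV2 ?posrE//; lra.
apply: le_trans Nle; apply: expr_le_self; last exact: ltnW.
by rewrite invr_ge0 (ltW N0) /= invf_le1//; lra.
Qed.

Lemma bump_term_ge tau h (x w : 'rV[R]_d.+1) (c U : R) : 0 < tau <= 8^-1 -> 0 < h ->
  half_space x -> h <= height x <= 4 * h -> 2 * h <= height w -> 0 <= c -> 0 <= U ->
  c * tau ^+ d * (8^-1 * 4^-1 ^+ d) * (U * (hyp x w)^-1 ^+ d) <=
  c * U * (tau * h) ^+ d * bump tau h x w.
Proof.
move=> tau8 h0 hx xh hw c0 U0; have [t0 t8] := andP tau8.
have hw' : half_space w by rewrite /half_space /= -/(height w); lra.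
have x0 : 0 < height x := hx.
have b0 : 0 <= c * U * (tau * h) ^+ d.
  by rewrite !mulr_ge0 ?exprn_ge0 ?mulr_ge0 ?(ltW t0) ?(ltW h0).
apply: le_trans (ler_wpM2l b0 (bump_ge tau8 h0 hw x0)).
have hk4d : height x ^+ d * 4^-1 ^+ d <= h ^+ d.
  by rewrite -exprMn lerXn2r ?nnegrE ?mulr_ge0 ?(ltW x0) ?(ltW h0)//; lra.
have L := hyp_inv_expr_le hx hw'.
have m0 := mirror_dist_gt0 hx hw'; have w0 : 0 < height w := hw'.
have W0 : 0 <= height w / mirror_dist x w ^+ d.+1.
  by rewrite divr_ge0 ?exprn_ge0 ?(ltW w0) ?(ltW m0).
move: L W0; move: (hyp x w)^-1 (height w / _) => H W L W0.
rewrite exprMn; apply: (bump_coefficient_le c0 _ _ _ U0 W0 L hk4d).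
- by rewrite exprn_ge0// ltW.
- by rewrite invr_ge0.
- by rewrite exprn_ge0.
Qed.

(** The coefficients are [c2 * u (z k) * (tau * h)^d]. On [y = h] a bump can be positive only if all
    horizontal coordinates are within [sigma * h]; there it is at most [(tau * h)^(-d)], and
    Harnack, vertically and then horizontally, gives [u (z k) <= CV * CH * u x]. Packing allows at
    most [K] such [k], and [c2] is the inverse of [K * (CV * CH)]. *)
Lemma layer_bound : exists2 c : R, 0 < c &
  forall (u : 'rV[R]_d.+1 -> R) (s : seq nat) (h : R) (w : 'rV[R]_d.+1),
  positive_harmonic u -> uniq s -> 0 < h -> 2 * h <= height w ->
  (forall k, k \in s -> h <= height (z k) <= 4 * h) ->
  c * (\sum_(k <- s) u (z k) * (hyp (z k) w)^-1 ^+ d) <= u w.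
Proof.
have n1 : 1 <= d.+1%:R :> R by rewrite ler1n.
have [CV CV1 HV] := harnack_vertical (R := R) (d := d).
have [CH [sigma [CH1 sig0 sig8 HH]]] := harnack_half_space (R := R) (d := d).
have [CP CP0 HP] := packing hz delta0 sep.
pose K := CP * (1 + sigma) ^+ d + 1.
have K0 : 0 < K by rewrite ltr_wpDl// mulr_ge0// exprn_ge0//; lra.
pose tau := sigma / (4 * d.+1%:R).
have tau0 : 0 < tau by rewrite divr_gt0//; lra.
have tau8 : tau <= 8^-1.
  by rewrite /tau ler_pdivrMr; lra.
pose c2 := (K * (CV * CH))^-1.
have c20 : 0 < c2 by rewrite invr_gt0 !mulr_gt0//; lra.
exists (c2 * tau ^+ d * (8^-1 * 4^-1 ^+ d)).
  by rewrite !mulr_gt0 ?exprn_gt0// invr_gt0.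
move=> u s h w hu us h0 hw hs.
have th := mulr_gt0 tau0 h0.
have w0 : 0 < height w by lra.
have uz0 k : 0 < u (z k) by exact: (hu _ (hz k)).2.
pose b k := c2 * u (z k) * (tau * h) ^+ d.
have b0 k : 0 <= b k by rewrite !mulr_ge0 ?exprn_ge0// ltW.
pose v x := \sum_(k <- s) b k * bump tau h (z k) x.
have bd x : height x = h -> v x <= u x.
  move=> xh; have hx : half_space x by rewrite /half_space /= -/(height x) xh.
  pose near k := [forall i : 'I_d.+1, (i != ord_max) ==> (`|z k ord0 i - x ord0 i| <= sigma * h)].
  apply: le_trans (_ : \sum_(k <- s | near k) c2 * (CV * CH * u x) <= _).
    rewrite [leRHS]big_mkcond; rewrite /v big_seq [leRHS]big_seq; apply: ler_sum => k ks.
    case: ifPn => [/forallP nk|nk].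
      have hk := hs k ks.
      have b1 : bump tau h (z k) x <= (tau * h)^-1 ^+ d.
        apply: le_trans (bump_le_poisson _ _ _ _) _ => //; [lra|by rewrite xh|].
        apply: le_trans (poisson_le_power _ _ _ _) _ => //; [lra|by rewrite xh|].
        have e0 : tau * h <= euclid (x - at_height (z k) ((1 - tau) * h)).
          apply: le_trans (coord_le_euclid _ ord_max).
          by rewrite !mxE eqxx -/(height x) xh ler_normr; apply/orP; left; lra.
        have e1 : 0 < euclid (x - at_height (z k) ((1 - tau) * h)) by exact: lt_le_trans e0.
        by rewrite lerXn2r ?nnegrE ?invr_ge0 ?(ltW e1) ?(ltW th)// lef_pV2 ?posrE.
      apply: le_trans (ler_wpM2l (b0 k) b1) _.
      rewrite /b -[leLHS]mulrA -exprMn mulfV ?gt_eqF// expr1n mulr1 ler_pM2l//.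
      pose c := at_height (z k) h.
      have hc : half_space c by rewrite /half_space /= at_height_last.
      have -> : z k = move c ord_max (height (z k) - h).
        apply/rowP => i; rewrite moveE mxE; case: eqP => [->|_]; last by rewrite addr0.
        by rewrite /height; ring.
      apply: le_trans (HV u c _ hu hc _) _; first by rewrite at_height_last; lra.
      rewrite -mulrA ler_pM2l; last lra.
      apply: HH => //; apply/norm_le_coordP => [|i]; first by rewrite mulr_ge0 ?ltW.
      rewrite !mxE; have := nk i; have [->|im] /= := eqVneq i ord_max.
        by rewrite -/(height x) xh subrr normr0 mulr_ge0// ltW.
      by rewrite -/(height x) xh.
    apply: mulr_ge0_le0 => //.
    apply: (@bump_le0 tau sigma) => //; first by lra.
    move/forallPn: nk => [i]; rewrite negb_imply -ltNge => /andP[im /ltW si].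
    apply: le_trans (_ : (x ord0 i - z k ord0 i) ^+ 2 <= _).
      rewrite -exprMn -[leRHS]real_normK ?num_real// ler_sqr ?nnegrE//.
        by rewrite distrC.
      by rewrite mulr_ge0 ?ltW.
    by rewrite /horiz_sqr (bigD1 i)//= lerDl sumr_ge0// => j _; exact: sqr_ge0.
  rewrite -big_filter; set s' := [seq k <- s | near k].
  have sz : (size s')%:R <= K.
    apply: le_trans (_ : CP * (1 + sigma * h / h) ^+ d <= _).
      apply: (HP s' h (sigma * h) x) => //.
      - by rewrite filter_uniq.
      - by rewrite mulr_ge0 ?ltW.
      - by move=> k; rewrite mem_filter => /andP[_ /hs].
      - by move=> k i; rewrite mem_filter => /andP[/forallP/(_ i)/implyP nk _] /nk.
    by rewrite mulfK ?gt_eqF// /K lerDl.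
  have ux := (hu x hx).2.
  rewrite big_const_seq count_predT iter_addr addr0 -[leLHS]mulr_natl.
  apply: le_trans (_ : K * (c2 * (CV * CH * u x)) <= _).
    by rewrite ler_wpM2r// !mulr_ge0 ?(ltW ux)//; lra.
  rewrite le_eqVlt; apply/orP; left; apply/eqP; rewrite /c2; field.
  by rewrite !gt_eqF//; lra.
have vw : v w <= u w.
  (* The region above [y = h] is unbounded, so the comparison is made with a slack [e] on a box so
     large that [v <= e] on its other faces. *)
  apply/ler_addgt0Pr => e e0.
  pose B := \sum_(k <- s) b k.
  have B0 : 0 <= B by apply: sumr_ge0.
  pose T := 2 * (\sum_(k <- s) `|w - z k|) + 2 * (B / e + 1) + 4 * h.
  have Be0 : 0 <= B / e by rewrite divr_ge0// ltW.
  have T0 : 0 < T.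
    have : 0 <= \sum_(k <- s) `|w - z k| by apply: sumr_ge0.
    by rewrite /T; lra.
  have far x : h <= height x -> (exists i, `|x ord0 i - w ord0 i| = T) -> v x <= e.
    move=> hx [i xi]; apply: le_trans (_ : \sum_(k <- s) b k * (B / e + 1)^-1 <= _).
      rewrite /v big_seq [leRHS]big_seq; apply: ler_sum => k ks; rewrite ler_wpM2l//.
      apply: (bump_far (i := i) (w := w) (T := T)) => //; [lra|exact: hs|].
      have : `|w - z k| <= \sum_(k <- s) `|w - z k|.
        by rewrite (big_rem k)//= lerDl sumr_ge0.
      by rewrite /T; lra.
    rewrite -mulr_suml -/B ler_pdivrMr; last lra.
    by rewrite mulrDr mulr1 mulrC divfK ?gt_eqF//; lra.
  pose lo : 'rV[R]_d.+1 := \row_i (if i == ord_max then h else w ord0 i - T).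
  pose hi : 'rV[R]_d.+1 := \row_i (w ord0 i + T).
  have boxh x : box lo hi x -> h <= height x.
    by move=> /(_ ord_max); rewrite !mxE eqxx => /andP[].
  have key := @box_min_principle R d lo hi (fun x => u x + -1 * v x + e) setT.
  suff : 0 <= u w + -1 * v w + e by lra.
  apply: key => //.
  - move=> x /boxh xh _; have hx : half_space x by rewrite /half_space /= -/(height x); lra.
    have [//|c _] := @superharmonic_bump u tau h b s e x _ h0 xh (hu x hx).1; first lra.
    exact: c.
  - move=> x i bx _; rewrite mxE; have xh := boxh _ bx.
    have ux : 0 < u x by apply: (hu x _).2; rewrite /half_space /= -/(height x); lra.
    have [-> /bd|im xi] := eqVneq i ord_max; first lra.
    have := far x xh; have : exists i, `|x ord0 i - w ord0 i| = T.
      exists i; rewrite xi (_ : _ - _ = - T); last by ring.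
      by rewrite normrN gtr0_norm.
    by move=> h1 /(_ h1); lra.
  - move=> x i bx _; rewrite mxE => xi; have xh := boxh _ bx.
    have ux : 0 < u x by apply: (hu x _).2; rewrite /half_space /= -/(height x); lra.
    have := far x xh; have : exists i, `|x ord0 i - w ord0 i| = T.
      exists i; rewrite xi (_ : _ - _ = T); last by ring.
      by rewrite gtr0_norm.
    by move=> h1 /(_ h1); lra.
  - move=> x /boxh xh _; right; split; first by move=> i; exists 1.
    have hx : half_space x by rewrite /half_space /= -/(height x); lra.
    by have [|_] := @superharmonic_bump u tau h b s e x _ h0 xh (hu x hx).1; first lra.
  - move=> i; rewrite !mxE; case: eqP => [->|_]; last by lra.
    by rewrite -/(height w); lra.
apply: le_trans vw; rewrite mulr_sumr /v big_seq [leRHS]big_seq; apply: ler_sum => k ks.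
by apply: bump_term_ge => //; rewrite ?tau0//; [exact: hs|exact: ltW|exact: ltW].
Qed.

End Necessity.

Section GrowthOfInterpolating.
Local Opaque beta height powR mirror_dist ln.
Context {R : realType} {d : nat}.
Context (z : nat -> 'rV[R]_d.+1) (delta : R).
Context (hz : forall n, half_space (z n)).
Context (delta0 : 0 < delta).
Context (sep : forall n m, n <> m -> delta <= beta (z n) (z m)).
Context (hd : (1 < d)%N).

Lemma count_identity (S c q A : R) : 0 < c -> 0 < q -> 0 < A ->
  S = c * (S * (q^-1 * A^-1)) * (q / c * A).
Proof. by move=> c0 q0 A0; field; rewrite !gt_eqF. Qed.

(** The additive [6] of the quasi-triangle inequality is at most [6 / delta] times the distance of
    two distinct points, so it becomes part of a Lipschitz constant; this makes the data
    [2^(e * beta)] admissible. *)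
Lemma beta_lipschitz n k m :
  `|beta (z k) (z n) - beta (z m) (z n)| <= (1 + 6 / delta) * beta (z k) (z m).
Proof.
have [->|km] := eqVneq k m; first by rewrite subrr normr0 beta_refl mulr0.
have h := sep (elimN eqP km).
have h6 : 6 <= 6 / delta * beta (z k) (z m).
  rewrite mulrAC ler_pdivlMr//; lra.
have := beta_quasi_triangle (hz k) (hz m) (hz n).
have := beta_quasi_triangle (hz m) (hz k) (hz n).
rewrite (beta_sym (hz m) (hz k)).
move: (beta _ _) (beta _ _) (beta _ _) h6 => a b c' h6 h1 h2.
by rewrite ler_norml; apply/andP; split; lra.
Qed.

Local Transparent powR.
Lemma powR_lin (a x : R) : 1 + a * ln 2 * x <= 2 `^ (a * x).
Proof.
rewrite /powR pnatr_eq0 /= (_ : a * ln 2 * x = a * x * ln 2); last by rewrite mulrAC.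
exact: expR_ge1Dx.
Qed.

Local Opaque powR.

Lemma interpolating_growth : interpolating setT z ->
  exists M alpha : R, [/\ 0 < M, 0 < alpha, alpha < 1 &
    forall (l n : nat) (s : seq nat), (0 < l)%N -> uniq s ->
    (forall k, k \in s -> beta (z k) (z n) <= l%:R) ->
    (size s)%:R <= M * 2 `^ (alpha * d%:R * l%:R)].
Proof.
move=> [eps eps0 Hint].
have d1 : 1 <= d%:R :> R by rewrite ler1n ltnW.
have [c c0 Hc] := layer_bound hz delta0 sep hd.
have [CP CP0 HP] := packing hz delta0 sep.
pose L : R := 1 + 6 / delta.
have L0 : 0 < L by rewrite ltr_wpDr// divr_ge0// ltW.
(* The bound [eps / L] makes the data admissible; the bound [1/2] makes [2^(d l / 2)] at most
   [A = 2^((d - e) l)] in the high layers. *)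
pose e := Num.min (eps / L) 2^-1.
have e0 : 0 < e by rewrite lt_min divr_gt0//= invr_gt0.
have eL : e * L <= eps by rewrite -ler_pdivlMr// ge_min lexx.
have e2 : e <= 2^-1 by rewrite ge_min lexx orbT.
pose K := Num.max (4 ^+ d / c) (CP * 5 ^+ d).
have K0 : 0 < K by rewrite lt_max divr_gt0// exprn_gt0.
pose kap := e / 2 * ln 2.
have kap0 : 0 < kap by rewrite mulr_gt0 ?ln2_gt0// divr_gt0.
(* The exponent [d l] improves by [e * l]; one half of the gain is spent on the [2 l + 5] layers,
   the other half stays in [alpha]. *)
exists (K * (5 + 2 / kap)), (1 - e / 2 / d%:R); split.
- by rewrite mulr_gt0// ltr_wpDr// divr_ge0// ltW.
- by rewrite subr_gt0 ltr_pdivrMr; lra.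
- by rewrite gtrDl oppr_lt0 divr_gt0//; lra.
move=> l n s l0 us hs.
pose w k := 2 `^ (e * beta (z k) (z n)).
have lw k : log2 (w k) = e * beta (z k) (z n) by exact: log2_pow2.
have [u hu uw] : exists2 u, hplus u & forall k, setT k -> u (z k) = w k.
  apply: (Hint w) => [k _|k m _ _]; first exact: powR_gt0.
  have -> : log2 (w k) - log2 (w m) = e * (beta (z k) (z n) - beta (z m) (z n)).
    by rewrite [RHS]mulrBr; congr (_ - _); [exact: lw|exact: lw].
  rewrite normrM (gtr0_norm e0).
  apply: le_trans (_ : e * (L * beta (z k) (z m)) <= _).
    by rewrite ler_pM2l//; exact: beta_lipschitz.
  by rewrite mulrA ler_wpM2r// beta_ge0.
have {}hu := hplus_positive_harmonic hu.
have un : u (z n) = 1 by rewrite uw// /w beta_refl mulr0 powRr0.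
set H := height (z n); have H0 : 0 < H := hz n.
pose A : R := 2 `^ ((d%:R - e) * l%:R).
have A0 : 0 < A by exact: powR_gt0.
have p2 m : 0 < 2 ^+ m :> R by rewrite exprn_gt0.
have hypl k : k \in s -> hyp (z k) (z n) <= 2 ^+ (l + 2).
  move=> /hs h; apply: le_trans (le_pow2_beta (hz k) (hz n)) _.
  rewrite exprD mulrC; apply: ler_pM; rewrite ?powR_ge0//; last by rewrite expr2; lra.
  by rewrite -powR_mulrn//; apply: ler_powR; rewrite ?ler1n.
(* Heights in the ball lie between [H / 2^(l+2)] and [H * 2^(l+2)]; the shift makes [x k >= 1], so
   the dyadic classes take at most [2 l + 5] values. *)
pose x k := 2 ^+ (l + 2) * (height (z k) / H).
have x1 k : k \in s -> 1 <= x k.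
  move=> ks; have zk0 : 0 < height (z k) := hz k.
  have := hyp_ge_ratio (hz n) (hz k); rewrite hyp_sym => /le_trans/(_ (hypl k ks)).
  rewrite ler_pdivrMr// => h; rewrite /x mulrA ler_pdivlMr// mul1r.
  by rewrite -/H.
have xN k : k \in s -> (floor_log2 (x k) < 2 * l + 5)%N.
  move=> ks; have /andP[h1 _] := floor_log2_itv (x1 k ks).
  rewrite ltnNge; apply/negP => h2.
  have : 2 ^+ (2 * l + 5) <= x k by apply: le_trans h1; rewrite ler_eXn2l// ltr1n.
  have lE : (2 * l + 5 = (l + 2) + (l + 3))%N by clear; lia.
  apply/negP; rewrite -ltNge lE exprD /x ltr_pM2l//; apply: le_lt_trans (hyp_ge_ratio (hz k) (hz n)) _.
  by apply: le_lt_trans (hypl k ks) _; rewrite ltr_eXn2l ?ltr1n// ltn_add2l.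
have layer p : (p < 2 * l + 5)%N -> \sum_(k <- s | floor_log2 (x k) == p) (1 : R) <= K * A.
  move=> _; rewrite -big_filter; set s1 := [seq k <- s | floor_log2 (x k) == p].
  rewrite -size_le_sum1.
  pose h : R := 2 ^+ p * H / 2 ^+ (l + 2).
  have h0 : 0 < h by rewrite divr_gt0 ?mulr_gt0.
  have s1s k : k \in s1 -> k \in s by rewrite mem_filter => /andP[].
  have hk k : k \in s1 -> h <= height (z k) < 2 * h.
    rewrite mem_filter => /andP[/eqP xp ks].
    have /andP[y1 y2] := floor_log2_itv (x1 k ks); rewrite xp in y1 y2.
    have zE : height (z k) = x k * (H / 2 ^+ (l + 2)).
      by rewrite /x; move: (height (z k)) => y; field; rewrite !gt_eqF.
    have hE : h = 2 ^+ p * (H / 2 ^+ (l + 2)) by rewrite /h mulrA.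
    have q0 : 0 < H / 2 ^+ (l + 2) by rewrite divr_gt0.
    rewrite zE hE; move: (x k) (H / _) q0 y1 y2 => X q q0 y1 y2.
    apply/andP; split; first by rewrite ler_pM2r.
    by rewrite [ltRHS]mulrA -exprS ltr_pM2r.
  have us1 : uniq s1 by rewrite filter_uniq.
  (* Layers well below [z n] are handled by [layer_bound]. In a layer with [2 * h > H] the ball has
     horizontal radius only of order [2^(l/2) * h], and packing alone gives [O(2^(d l / 2))]
     points. *)
  have [hH|Hh] := leP (2 * h) H.
    have hk4 k : k \in s1 -> h <= height (z k) <= 4 * h.
      by move=> /hk/andP[y1 y2]; apply/andP; split; lra.
    have := Hc u s1 h (z n) hu us1 h0 hH hk4.
    rewrite un => sum1.
    have term k : k \in s1 -> 4^-1 ^+ d * A^-1 <= u (z k) * (hyp (z k) (z n))^-1 ^+ d.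
      move=> ks; have ks' := s1s k ks.
      rewrite uw// /w; set b := beta (z k) (z n).
      have hb := le_pow2_beta (hz k) (hz n); rewrite -/b in hb.
      have h4 := hyp_gt0 (hz k) (hz n).
      apply: le_trans (_ : 2 `^ (e * b) * ((4 * 2 `^ b)^-1 ^+ d) <= _); last first.
        have b0 : 0 < 4 * 2 `^ b by rewrite mulr_gt0 ?powR_gt0.
        have hi : (4 * 2 `^ b)^-1 <= (hyp (z k) (z n))^-1 by rewrite lef_pV2 ?posrE.
        by rewrite ler_wpM2l ?powR_ge0// lerXn2r ?nnegrE ?invr_ge0 ?(ltW h4) ?(ltW b0).
      rewrite invfM exprMn mulrCA ler_pM2l ?exprn_gt0//.
      rewrite exprVn -powR_mulrn ?powR_ge0// -powRrM -!powRN -powRD ?pnatr_eq0 ?implybT//.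
      apply: ler_powR; first by rewrite ler1n.
      have bl : b <= l%:R by exact: hs.
      have : (d%:R - e) * b <= (d%:R - e) * l%:R by rewrite ler_wpM2l//; lra.
      lra.
    have : c * ((size s1)%:R * (4^-1 ^+ d * A^-1)) <= 1.
      apply: le_trans sum1; rewrite ler_pM2l// mulr_natl.
      rewrite -[_ *+ size s1]addr0 -iter_addr -(count_predT s1) -big_const_seq.
      rewrite big_seq [leRHS]big_seq; apply: ler_sum => k; exact: term.
    set S : R := (size s1)%:R => h1.
    have q0 : 0 < 4 ^+ d :> R by rewrite exprn_gt0.
    have SE := count_identity S c0 q0 A0; rewrite -exprVn in SE; rewrite SE.
    have qcA : 0 < 4 ^+ d / c * A by rewrite mulr_gt0// divr_gt0.
    apply: le_trans (_ : 1 * (4 ^+ d / c * A) <= _); first by rewrite ler_pM2r.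
    by rewrite mul1r ler_pM2r// le_max lexx.
  pose r := 4 * 2 `^ (l%:R / 2) * h.
  have r0 : 0 < r by rewrite !mulr_gt0// powR_gt0.
  have cnt : (size s1)%:R <= CP * (1 + r / h) ^+ d.
    apply: (HP s1 h r (z n)) => //.
    - exact: ltW.
    - by move=> k /hk/andP[y1 y2]; apply/andP; split; lra.
    move=> k i ks im; apply: le_trans (coord_le_mirror_dist _ _ im) _.
    have ks' := s1s k ks; have /andP[y1 y2] := hk k ks.
    have zk0 : 0 < height (z k) := hz k.
    rewrite -ler_sqr ?nnegrE ?mirror_dist_ge0 ?(ltW r0)//.
    have : hyp (z k) (z n) <= 4 * 2 `^ (l%:R).
      apply: le_trans (hypl k ks') _; rewrite powR_mulrn// exprD mulrC ler_pM2r//.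
      by rewrite expr2; lra.
    rewrite /hyp -/H ler_pdivrMr ?mulr_gt0// => h1; apply: (le_trans h1).
    have -> : r ^+ 2 = 16 * 2 `^ l%:R * h ^+ 2.
      rewrite /r [in RHS](_ : l%:R = l%:R / 2 + l%:R / 2); last by lra.
      rewrite powRD ?pnatr_eq0 ?implybT//.
      by move: (2 `^ _) => t; ring.
    have : height (z k) * H <= (2 * h) * (2 * h) by apply: ler_pM; rewrite ?ltW.
    have q0 : 0 < 2 `^ l%:R :> R by exact: powR_gt0.
    move: (height (z k) * H) (2 `^ l%:R) q0 => X q q0 hX.
    rewrite [leRHS](_ : _ = 4 * q * (2 * h * (2 * h))); last by ring.
    by rewrite ler_pM2l ?mulr_gt0.
  apply: (le_trans cnt); apply: le_trans (_ : CP * 5 ^+ d * A <= _); last first.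
    by rewrite ler_pM2r// le_max lexx orbT.
  rewrite -mulrA ler_wpM2l// /r mulfK ?gt_eqF//.
  have t1 : 1 <= 2 `^ (l%:R / 2) :> R.
    by rewrite -[leLHS](powRr0 2); apply: ler_powR; rewrite ?ler1n// divr_ge0.
  apply: le_trans (_ : (5 * 2 `^ (l%:R / 2)) ^+ d <= _).
    by rewrite lerXn2r ?nnegrE; lra.
  rewrite exprMn ler_pM2l ?exprn_gt0// -powR_mulrn ?powR_ge0// -powRrM.
  apply: ler_powR; first by rewrite ler1n.
  have l0' : 0 <= l%:R :> R by rewrite ler0n.
  have l2 : 0 <= 2^-1 * l%:R :> R by rewrite mulr_ge0.
  have := ler_wpM2l l2 d1.
  have : e * l%:R <= 2^-1 * l%:R by rewrite ler_wpM2r.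
  lra.
have := @sum_layers_lt R _ s (fun=> 1) _ (fun=> K * A) _ xN layer.
rewrite -size_le_sum1 sumr_const card_ord -[leRHS]mulr_natr => sz.
apply: (le_trans sz).
have Asplit : 2 `^ ((1 - e / 2 / d%:R) * d%:R * l%:R) = A * 2 `^ (e / 2 * l%:R).
  rewrite /A -powRD ?pnatr_eq0 ?implybT//; congr (_ `^ _); field.
  by rewrite gt_eqF//; lra.
rewrite Asplit.
rewrite [leRHS](_ : _ = K * A * ((5 + 2 / kap) * 2 `^ (e / 2 * l%:R))); last first.
  by move: (2 `^ (_ * _)) => t; ring.
rewrite ler_pM2l ?mulr_gt0//.
apply: le_trans (_ : (5 + 2 / kap) * (1 + kap * l%:R) <= _); last first.
  rewrite ler_wpM2l ?powR_lin// addr_ge0// divr_ge0// ltW//.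
have l0' : 0 <= l%:R :> R by rewrite ler0n.
rewrite natrD natrM.
have -> : (5 + 2 / kap) * (1 + kap * l%:R) = 5 + 2 / kap + 5 * (kap * l%:R) + 2 * l%:R.
  by move: kap kap0 => kp kp0; field; rewrite gt_eqF.
have := mulr_ge0 (ltW kap0) l0'.
have : 0 <= 2 / kap by rewrite divr_ge0// ltW.
lra.
Qed.

End GrowthOfInterpolating.

Section GrowthBound.
Context {R : realType} {d : nat}.
Context (z : nat -> 'rV[R]_d.+1) (M alpha : R).
Context (zinj : injective z).

(** The definition counts points of an image, the estimates count indices in duplicate-free lists;
    injectivity matches the two. Finiteness follows from the bound: an infinite ball would contain a
    list exceeding it. *)
Lemma growth_boundP : 0 <= M ->
  growth_bound z M alpha <->
  forall (l n : nat) (s : seq nat), (0 < l)%N -> uniq s ->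
    (forall k, k \in s -> beta (z k) (z n) <= l%:R) ->
    (size s)%:R <= M * 2 `^ (alpha * d%:R * l%:R).
Proof.
move=> M0; split=> [G l n s l0 us hs|G l n l0].
  have [finB cardB] := G l n l0; apply: le_trans cardB; rewrite ler_nat.
  rewrite -(size_map z) -(undup_id (s := map z s)) ?map_inj_uniq//.
  apply: uniq_leq_size; first exact: undup_uniq.
  move=> x; rewrite mem_undup => /mapP[k ks ->].
  by rewrite in_fset_set// inE; exists k => //=; exact: hs.
set S := [set k | beta (z k) (z n) <= l%:R].
have sb (B : {fset nat}) : [set` B] `<=` S -> (size (enum_fset B))%:R <= M * 2 `^ (alpha * d%:R * l%:R).
  by move=> BS; apply: (G l n (enum_fset B)) => //; exact: fset_uniq.
have finS : finite_set S.
  apply: contrapT => /infinite_set_fset infS.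
  have [B BS cB] := infS (Num.truncn (M * 2 `^ (alpha * d%:R * l%:R))).+1.
  have := sb B BS; apply/negP; rewrite -ltNge.
  by apply: lt_le_trans (truncnS_gt _) _; rewrite ler_nat.
split; first exact: finite_image.
apply: le_trans (sb (fset_set S) _); last by rewrite fset_setK.
rewrite ler_nat fset_set_image//; exact: leq_imfset_card.
Qed.

End GrowthBound.

(** * Interpolation kernels *)

Section Poles.
Context {R : realType} {d : nat}.
Context (hd : (1 < d)%N).
Local Opaque beta powR ln.
Implicit Types (a b xi : 'rV[R]_d.+1).

(** An upper Bernoulli bound, from [((1 + x) (1 - x))^m <= 1] and the lower bound for
    [(1 - x)^m]. *)
Lemma bernoulli_div (x k : R) m : 0 <= x -> m%:R * x <= k / 8 -> 0 <= k <= 1 ->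
  (1 + x) ^+ m <= 1 + k / 4.
Proof.
move=> x0 mx /andP[k0 k1]; have [->|m0] := posnP m; first by rewrite expr0; lra.
have x1 : x <= 1.
  have : 1 * x <= m%:R * x by rewrite ler_wpM2r// ler1n.
  lra.
have x01 : 0 <= x <= 1 by rewrite x0.
have h := bernoulli_sub m x01.
have h2 : ((1 + x) * (1 - x)) ^+ m <= 1.
  by apply: exprn_ile1; have := mulr_ge0 x0 x0; [move=> _; apply: mulr_ge0; lra|lra].
rewrite exprMn in h2.
have p0 : 0 <= (1 + x) ^+ m by rewrite exprn_ge0//; lra.
have h3 : 1 - k / 8 <= 1 - m%:R * x by lra.
have := ler_wpM2l p0 (le_trans h3 h); set E := (1 + x) ^+ m in p0 h2 *.
move=> h4; have h5 : E * (1 - k / 8) <= 1 by lra.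
have k8 : 0 < 1 - k / 8 by lra.
rewrite -(ler_pM2r k8); apply: (le_trans h5).
have := mulr_ge0 k0 k0; have : k * k <= k * 1 by rewrite ler_wpM2l.
lra.
Qed.

(** The case of [b] lower than [a]: for a pole far away relative to [h], [Nb >= (1 - eta) * Na], and
    the ratio of the heights decides. *)
Lemma pole_below (h y k eta Na Nb : R) : 0 < h -> 0 < y -> 0 < k <= 32^-1 ->
  eta = k / (8 * d.+1%:R) -> y <= (1 - k) * h ->
  0 < Na -> 0 < Nb -> Na ^+ 2 - h ^+ 2 <= Nb ^+ 2 -> h ^+ 2 <= eta * Na ^+ 2 ->
  (1 + k / 2) * y * Na ^+ d.+1 <= h * Nb ^+ d.+1.
Proof.
move=> h0 y0 /andP[k0 k32] etaE yk Na0 Nb0 NN hN.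
have n1 : 1 <= d.+1%:R :> R by rewrite ler1n.
have n0 : d.+1%:R != 0 :> R by rewrite gt_eqF//; lra.
have eta0 : 0 < eta by rewrite etaE divr_gt0//; lra.
have eta1 : eta <= 1 by rewrite etaE ler_pdivrMr; lra.
have Nab : (1 - eta) * Na <= Nb.
  have q0 : 0 <= (1 - eta) * Na by rewrite mulr_ge0 ?(ltW Na0)//; lra.
  rewrite -ler_sqr ?nnegrE ?(ltW Nb0)// exprMn.
  apply: le_trans (_ : (1 - eta) * Na ^+ 2 <= _); last lra.
  rewrite ler_wpM2r ?sqr_ge0// expr2 ler_piMr; lra.
have B : 1 - k / 8 <= (1 - eta) ^+ d.+1.
  have -> : k / 8 = d.+1%:R * eta by rewrite etaE; field.
  by apply: bernoulli_sub; rewrite (ltW eta0).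
have Nabn : (1 - k / 8) * Na ^+ d.+1 <= Nb ^+ d.+1.
  apply: le_trans (_ : ((1 - eta) * Na) ^+ d.+1 <= _).
    by rewrite exprMn ler_wpM2r// exprn_ge0// ltW.
  by rewrite lerXn2r ?nnegrE ?(ltW Nb0)// mulr_ge0 ?(ltW Na0)//; lra.
have P0 : 0 < Na ^+ d.+1 by rewrite exprn_gt0.
apply: le_trans (_ : h * ((1 - k / 8) * Na ^+ d.+1) <= _); last by rewrite ler_pM2l.
rewrite mulrA ler_pM2r//.
apply: le_trans (_ : (1 + k / 2) * ((1 - k) * h) <= _).
  by rewrite ler_pM2l//; lra.
rewrite mulrA [leRHS]mulrC ler_pM2r//; have := mulr_ge0 (ltW k0) (ltW k0); lra.
Qed.

(** The case of [b] higher than [a]: the kernel at [b] is at most [y^(-d)], below [h^(-d)] by the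
    factor [1 + k], and a pole under [a] gives nearly [h^(-d)] at [a]. *)
Lemma pole_above (h y k Na Nb : R) : 0 < h -> 0 < k <= 32^-1 ->
  (1 + k) * h <= y -> 0 < Na -> y <= Nb -> Na ^+ d.+1 <= (1 + k / 4) * h ^+ d.+1 ->
  (1 + k / 2) * y * Na ^+ d.+1 <= h * Nb ^+ d.+1.
Proof.
move=> h0 /andP[k0 k32] yk Na0 yN NaP.
have y0 : 0 < y by apply: lt_le_trans yk; rewrite mulr_gt0//; lra.
have hN : 0 < h ^+ d by rewrite exprn_gt0.
have yd : (1 + k) * h ^+ d <= y ^+ d.
  apply: le_trans (_ : ((1 + k) * h) ^+ d <= _).
    rewrite exprMn ler_pM2r//; have d0 : (0 < d)%N by exact: ltnW.
    by rewrite -(prednK d0) exprS ler_peMr ?exprn_ege1//; lra.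
  by rewrite lerXn2r ?nnegrE ?(ltW y0)// mulr_ge0 ?(ltW h0)//; lra.
apply: le_trans (_ : (1 + k / 2) * y * ((1 + k / 4) * h ^+ d.+1) <= _).
  by rewrite ler_pM2l// mulr_gt0//; lra.
apply: le_trans (_ : h * (y * ((1 + k) * h ^+ d)) <= _); last first.
  rewrite ler_pM2l//; apply: le_trans (_ : y ^+ d.+1 <= _).
    by rewrite exprS ler_pM2l.
  by rewrite lerXn2r ?nnegrE ?(ltW y0) ?(le_trans (ltW y0) yN).
rewrite (_ : _ * _ = (y * h ^+ d.+1) * ((1 + k / 2) * (1 + k / 4))); last by ring.
rewrite (_ : h * _ = (y * h ^+ d.+1) * (1 + k)); last by rewrite exprS; ring.
rewrite ler_pM2l ?mulr_gt0 ?exprn_gt0//.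
have : k * k <= k * 1 by rewrite ler_pM2l//; lra.
lra.
Qed.

(** The case of nearly equal heights, where [b] must lie to the side: [Nb^2] exceeds [h^2] by the
    factor [1 + 6 k], and [d + 1 >= 2] powers of the distance outweigh a height advantage of
    [1 + k]. *)
Lemma pole_beside (h y k Na Nb : R) : 0 < h -> 0 < k <= 32^-1 ->
  0 < y <= (1 + k) * h -> 0 < Na -> 0 < Nb -> (1 + 6 * k) * h ^+ 2 <= Nb ^+ 2 ->
  Na ^+ d.+1 <= (1 + k / 4) * h ^+ d.+1 ->
  (1 + k / 2) * y * Na ^+ d.+1 <= h * Nb ^+ d.+1.
Proof.
move=> h0 /andP[k0 k32] /andP[y0 yk] Na0 Nb0 NbP NaP.
have hNb : h <= Nb.
  rewrite -ler_sqr ?nnegrE ?(ltW h0) ?(ltW Nb0)//; apply: le_trans NbP.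
  by rewrite ler_peMl ?sqr_ge0//; lra.
have E : h * ((1 + 6 * k) * h ^+ d.+1) <= h * Nb ^+ d.+1.
  rewrite ler_pM2l//; case: d hd => [//|d' _].
  rewrite !exprS.
  rewrite (_ : (1 + 6 * k) * _ = (1 + 6 * k) * h ^+ 2 * h ^+ d'); last by rewrite expr2; ring.
  rewrite (_ : Nb * _ = Nb ^+ 2 * Nb ^+ d'); last by rewrite expr2; ring.
  apply: ler_pM => //; rewrite ?exprn_ge0 ?(ltW h0)//.
    by rewrite mulr_ge0 ?sqr_ge0//; lra.
  by rewrite lerXn2r ?nnegrE ?(ltW h0) ?(ltW Nb0).
apply: le_trans E.
have hn : 0 < h ^+ d.+1 by rewrite exprn_gt0.
apply: le_trans (_ : (1 + k / 2) * ((1 + k) * h) * ((1 + k / 4) * h ^+ d.+1) <= _).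
  apply: ler_pM => //; rewrite ?exprn_ge0 ?(ltW Na0)//.
    by rewrite mulr_ge0 ?(ltW y0)//; lra.
  by rewrite ler_pM2l//; lra.
rewrite (_ : _ * _ = (h * h ^+ d.+1) * ((1 + k / 2) * (1 + k) * (1 + k / 4))); last by ring.
rewrite [leRHS](_ : _ = (h * h ^+ d.+1) * (1 + 6 * k)); last by ring.
rewrite ler_pM2l ?mulr_gt0//.
have k2 : k * k <= k * 32^-1 by rewrite ler_pM2l.
have : k * k * k <= k * k * 1 by rewrite ler_wpM2l ?mulr_ge0 ?(ltW k0)//; lra.
lra.
Qed.

Lemma euclid_sqr_boundary a xi : height xi = 0 ->
  euclid (a - xi) ^+ 2 = horiz_sqr a xi + height a ^+ 2.
Proof. by move=> xi0; rewrite euclid_sqr_horiz xi0 subr0. Qed.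

Lemma height_le_euclid a xi : height xi = 0 -> 0 < height a -> height a <= euclid (a - xi).
Proof.
move=> xi0 a0; rewrite -ler_sqr ?nnegrE ?euclid_ge0 ?(ltW a0)//.
by rewrite euclid_sqr_boundary// lerDr horiz_sqr_ge0.
Qed.

Lemma horiz_sqr_le a xi (r : R) : (forall i, i != ord_max -> `|a ord0 i - xi ord0 i| <= r) ->
  horiz_sqr a xi <= d.+1%:R * r ^+ 2.
Proof.
move=> ar; rewrite /horiz_sqr big_mkcond.
apply: le_trans (_ : \sum_(i < d.+1) r ^+ 2 <= _).
  apply: ler_sum => i _; case: ifP => [im|_]; last exact: sqr_ge0.
  rewrite -[_ ^+ 2 in leLHS]real_normK ?num_real// ler_sqr ?nnegrE//; first exact: ar.
  exact: le_trans (ar i im).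
by rewrite sumr_const card_ord mulr_natl.
Qed.

Lemma coord_sqr_le_horiz a xi i : i != ord_max ->
  (a ord0 i - xi ord0 i) ^+ 2 <= horiz_sqr a xi.
Proof.
by move=> im; rewrite /horiz_sqr (bigD1 i)//= lerDl sumr_ge0// => j _; exact: sqr_ge0.
Qed.

(* Some direct neighbourhood of boundary points at scale [height a] is seen
   from [a] better than from [b], uniformly in [b]. *)
Lemma pole_exists (delta : R) : 0 < delta -> exists k C r : R,
  [/\ 0 < k, 1 <= C, 0 < r, r <= 1 & forall a b, half_space a -> half_space b ->
    delta <= beta a b -> exists x0 : 'rV[R]_d.+1, forall xi, height xi = 0 ->
    (forall i, i != ord_max -> x0 ord0 i <= xi ord0 i <= x0 ord0 i + r * height a) ->
    (forall i, i != ord_max -> `|a ord0 i - xi ord0 i| <= C * height a) /\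
    (1 + k) * poisson xi b <= poisson xi a].
Proof.
move=> delta0; have [c [c0 c1 Hc]] := beta_small (R := R) (d := d) delta0.
have n1 : 1 <= d.+1%:R :> R by rewrite ler1n.
have n0 : 0 < d.+1%:R :> R by lra.
(* In units of [height a], a horizontal gap [c / 2] contributes [c^2 / 4 = 8 k] to the squared
   distance from [b], and the height at least [1 - 2 k]: hence the [1 + 6 k] of [pole_beside]. *)
pose k := c ^+ 2 / 32.
have c2 : c ^+ 2 <= c by rewrite expr2 ler_piMr// ltW.
have k0 : 0 < k by rewrite divr_gt0// exprn_gt0.
have k32 : 0 < k <= 32^-1.
  by rewrite k0 /k; move: (c ^+ 2) c2 => C2 hC2; lra.
have /andP[_ k32'] := k32.
pose eta := k / (8 * d.+1%:R).
have eta0 : 0 < eta by rewrite divr_gt0//; lra.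
have etan : d.+1%:R * eta = k / 8 by rewrite /eta; field; rewrite gt_eqF.
have etak : eta <= k / 8.
  by rewrite -etan ler_peMl// ltW.
pose r := eta / d.+1%:R.
have r0 : 0 < r by rewrite divr_gt0.
have reta : r <= eta by rewrite ler_pdivrMr// ler_peMr// ltW.
have kc : k <= c / 32 by rewrite /k ler_pM2r.
have r1 : r <= 1 by lra.
pose C := eta^-1 + 1.
have C1 : 1 <= C by rewrite lerDr invr_ge0 ltW.
exists (k / 2), (C + 1), r; split => //; [lra|lra|].
move=> a b ha hb hab; have a0 : 0 < height a := ha; have b0 : 0 < height b := hb.
have ra0 : 0 <= r * height a by rewrite mulr_ge0 ?ltW.
have rah : r * height a <= height a by rewrite ler_piMl// ltW.
have final xi : height xi = 0 ->
    (1 + k / 2) * height b * euclid (a - xi) ^+ d.+1 <= height a * euclid (b - xi) ^+ d.+1 ->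
    (1 + k / 2) * poisson xi b <= poisson xi a.
  move=> xi0; have := height_le_euclid xi0 a0; have := height_le_euclid xi0 b0.
  rewrite !poissonE -!/(height _) xi0 !subr0.
  move: (height a) (height b) (euclid _) (euclid _) a0 b0 => A B Nb Na A0 B0 hNb hNa h.
  have Na0 : 0 < Na ^+ d.+1 by rewrite exprn_gt0//; lra.
  have Nb0 : 0 < Nb ^+ d.+1 by rewrite exprn_gt0//; lra.
  by rewrite mulrA ler_pdivrMr// [leRHS]mulrAC ler_pdivlMr.
have [yk|ky] := leP (height b) ((1 - k) * height a).
  (* The poles are put at distance about [C * height a], in each horizontal coordinate on the side
     away from [b], so that [b] is horizontally no closer to them than [a]. *)
  pose x0 : 'rV[R]_d.+1 := \row_i (if a ord0 i <= b ord0 i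
    then a ord0 i - C * height a else a ord0 i + C * height a).
  exists x0 => xi xi0 hxi.
  have CA : 0 <= eta^-1 * height a by rewrite mulr_ge0 ?invr_ge0 ?ltW.
  have key i : i != ord_max -> [/\ `|a ord0 i - xi ord0 i| <= (C + 1) * height a,
      `|a ord0 i - xi ord0 i| <= `|b ord0 i - xi ord0 i| &
      eta^-1 * height a <= `|a ord0 i - xi ord0 i|].
    move=> im; have := hxi i im; rewrite mxE /C; case: (leP (a ord0 i) (b ord0 i)) => ab /andP[h1 h2].
      have s1 : 0 <= a ord0 i - xi ord0 i by lra.
      have s2 : 0 <= b ord0 i - xi ord0 i by lra.
      by rewrite (ger0_norm s1) (ger0_norm s2); split; lra.
    have s1 : a ord0 i - xi ord0 i <= 0 by lra.
    have s2 : b ord0 i - xi ord0 i <= 0 by lra.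
    by rewrite (ler0_norm s1) (ler0_norm s2); split; lra.
  split=> [i /key[]//|]; apply: final => //.
  have Na := euclid_sqr_boundary a xi0; have Nb := euclid_sqr_boundary b xi0.
  have hor : horiz_sqr a xi <= horiz_sqr b xi.
    apply: ler_sum => i /key[_ h _].
    by rewrite -[leLHS]real_normK ?num_real// -[leRHS]real_normK ?num_real// ler_sqr ?nnegrE.
  pose i0 : 'I_d.+1 := ord0.
  have i0m : i0 != ord_max by rewrite -(inj_eq val_inj) /= eq_sym -lt0n ltnW.
  have [_ _ far] := key i0 i0m.
  have far2 : (eta^-1 * height a) ^+ 2 <= horiz_sqr a xi.
    apply: le_trans (coord_sqr_le_horiz a xi i0m).
    by rewrite -[leRHS]real_normK ?num_real// ler_sqr ?nnegrE.
  apply: (pole_below (eta := eta)) => //.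
  - exact: lt_le_trans (height_le_euclid xi0 a0).
  - exact: lt_le_trans (height_le_euclid xi0 b0).
  - by rewrite Na Nb; have := sqr_ge0 (height b); lra.
  rewrite Na; apply: le_trans (_ : eta * (eta^-1 * height a) ^+ 2 <= _); last first.
    by rewrite ler_pM2l//; have := sqr_ge0 (height a); lra.
  rewrite (_ : eta * _ = eta^-1 * height a ^+ 2); last first.
    by move: (height a) => A; field; rewrite gt_eqF.
  by rewrite ler_peMl ?sqr_ge0// invf_ge1//; lra.
(* In the other two cases the poles go right under [a]. *)
exists a => xi xi0 hxi.
have near i : i != ord_max -> `|a ord0 i - xi ord0 i| <= r * height a.
  by move=> /hxi/andP[h1 h2]; rewrite ler_norml; apply/andP; split; lra.
split=> [i /near h|].
  by apply: le_trans h _; rewrite ler_pM2r//; lra.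
apply: final => //.
have Na0 : 0 < euclid (a - xi) by exact: lt_le_trans (height_le_euclid xi0 a0).
have Nb0 : 0 < euclid (b - xi) by exact: lt_le_trans (height_le_euclid xi0 b0).
have NaP : euclid (a - xi) ^+ d.+1 <= (1 + k / 4) * height a ^+ d.+1.
  apply: le_trans (_ : ((1 + eta) * height a) ^+ d.+1 <= _).
    have q0 : 0 <= (1 + eta) * height a by rewrite mulr_ge0 ?(ltW a0)//; lra.
    rewrite lerXn2r ?nnegrE ?euclid_ge0// -ler_sqr ?nnegrE ?euclid_ge0//.
    rewrite euclid_sqr_boundary// exprMn.
    apply: le_trans (_ : d.+1%:R * (r * height a) ^+ 2 + height a ^+ 2 <= _).
      by rewrite lerD2r; exact: horiz_sqr_le.
    rewrite (_ : d.+1%:R * _ = (r * eta) * height a ^+ 2); last first.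
      rewrite /r; move: (height a) (d.+1%:R : R) n0 => A N N0; field.
      by rewrite gt_eqF.
    rewrite -[X in _ + X]mul1r -mulrDl ler_wpM2r ?sqr_ge0//.
    have : r * eta <= eta * 1 by apply: ler_pM; [exact: ltW|exact: ltW|exact: reta|lra].
    rewrite sqrrD; have := sqr_ge0 eta; lra.
  rewrite exprMn ler_pM2r ?exprn_gt0//; apply: bernoulli_div; first exact: ltW.
    by rewrite etan.
  by apply/andP; split; lra.
have [ky'|yk'] := leP ((1 + k) * height a) (height b).
  by apply: pole_above => //; exact: height_le_euclid.
apply: pole_beside => //; first by rewrite b0 ltW.
have [i im hi] : exists2 i, i != ord_max & c * height a < `|a ord0 i - b ord0 i|.
  have nab : ~~ (`|a - b| <= c * height a).
    by apply/negP => h; have := Hc a b ha hb h; lra.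
  have ca0 : 0 <= c * height a by rewrite mulr_ge0 ?ltW.
  apply: contrapT => H; case/negP: nab; apply/norm_le_coordP => // i.
  rewrite !mxE; have [->|im] := eqVneq i ord_max.
    rewrite -!/(height _); have : k * height a <= c * height a by rewrite ler_pM2r//; lra.
    by rewrite ler_norml => ?; apply/andP; split; lra.
  by rewrite leNgt; apply/negP => hi; apply: H; exists i.
rewrite euclid_sqr_boundary//.
have bi : c / 2 * height a <= `|b ord0 i - xi ord0 i|.
  have := near i im; have : r * height a <= c / 2 * height a by rewrite ler_pM2r//; lra.
  have := ler_normD (a ord0 i - xi ord0 i) (xi ord0 i - b ord0 i).
  by rewrite addrA subrK (distrC (xi ord0 i)); lra.
have bi2 : (c / 2 * height a) ^+ 2 <= horiz_sqr b xi.
  apply: le_trans (coord_sqr_le_horiz b xi im).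
  rewrite -[leRHS]real_normK ?num_real// ler_sqr ?nnegrE// mulr_ge0 ?(ltW a0)//; lra.
have yb : ((1 - k) * height a) ^+ 2 <= height b ^+ 2.
  rewrite ler_sqr ?nnegrE ?(ltW b0) ?(ltW ky)// mulr_ge0 ?(ltW a0)//; lra.
have ck : c ^+ 2 = 32 * k by rewrite /k; lra.
apply: le_trans (lerD bi2 yb).
rewrite !exprMn ck -mulrDl ler_wpM2r ?sqr_ge0//.
rewrite sqrrB; have := sqr_ge0 k; lra.
Qed.

End Poles.

(** * Finite grids of boundary poles *)

Section Grid.
Context {R : realType} {d : nat}.
Context (x0 : 'rV[R]_d.+1) (q : R) (Q : nat).
Context (q0 : 0 < q).

Definition grid_point (k : {ffun 'I_d -> 'I_Q}) : 'rV[R]_d.+1 :=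
  \row_i (if unlift ord_max i is Some j then x0 ord0 i + q * (k j : nat)%:R else 0).

Lemma grid_point_height k : height (grid_point k) = 0.
Proof. by rewrite /height mxE unlift_none. Qed.

Lemma grid_point_lift k j :
  grid_point k ord0 (lift ord_max j) = x0 ord0 (lift ord_max j) + q * (k j : nat)%:R.
Proof. by rewrite mxE liftK. Qed.

Lemma grid_point_itv k i : i != ord_max ->
  x0 ord0 i <= grid_point k ord0 i <= x0 ord0 i + q * Q%:R.
Proof.
move=> im; have [j ->|] := unliftP ord_max i; last by move/eqP; rewrite (negbTE im).
rewrite grid_point_lift lerDl mulr_ge0 ?ler0n ?(ltW q0)//= lerD2l ler_pM2l// ler_nat.
exact/ltnW/ltn_ord.
Qed.

Lemma card_interval_le (t s : R) : 0 <= s ->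
  #|[pred m : 'I_Q | `|t + q * (m : nat)%:R| <= s]|%:R <= 2 * s / q + 1.
Proof.
move=> s0; set P := [pred m : 'I_Q | _].
have s20 : 0 <= 2 * s / q by rewrite divr_ge0 ?mulr_ge0// ltW.
have [m Pm|P0] := pickP P; last by rewrite eq_card0//; lra.
case: (arg_minnP (fun m : 'I_Q => m : nat) Pm) => m0 Pm0 minm0.
set B := Num.truncn (2 * s / q).
have sub k : k \in enum P -> (k : nat) \in iota m0 B.+1.
  rewrite mem_enum => Pk; rewrite mem_iota minm0//= addnS ltnS -leq_subLR.
  rewrite /B truncn_ge_nat// natrB ?minm0// ler_pdivlMr// mulrC mulrBr.
  by move: Pk Pm0; rewrite !inE !ler_norml => /andP[? ?] /andP[? ?]; lra.
apply: le_trans (_ : B.+1%:R <= _).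
  rewrite ler_nat cardE -(size_map val) -[leqRHS](size_iota m0).
  apply: uniq_leq_size; first by rewrite map_inj_uniq ?enum_uniq//; exact: val_inj.
  by move=> x /mapP[k kP ->]; exact: sub.
by rewrite -natr1 lerD2r; have /andP[] := truncn_itv s20.
Qed.

(** In each coordinate an interval of length [2 s] holds at most [2 s / q + 1] grid values, and
    [q <= s] absorbs the [1]. *)
Lemma grid_count (x : 'rV[R]_d.+1) (s : R) : q <= s ->
  #|[pred k : {ffun 'I_d -> 'I_Q} |
     [forall j : 'I_d, `|x ord0 (lift ord_max j) - grid_point k ord0 (lift ord_max j)| <= s]]|%:R
    <= (3 * s / q) ^+ d.
Proof.
move=> qs; have s0 : 0 <= s by apply: le_trans qs; exact: ltW.
pose A (j : 'I_d) := [pred m : 'I_Q |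
  `|(x0 ord0 (lift ord_max j) - x ord0 (lift ord_max j)) + q * (m : nat)%:R| <= s].
rewrite (_ : #|_| = #|family A|); last first.
  apply: eq_card => k; rewrite inE; apply/forallP/familyP => h j; have := h j;
    by rewrite inE grid_point_lift distrC addrAC.
rewrite card_family foldrE big_map big_enum /= natr_prod.
apply: le_trans (_ : \prod_(j < d) (3 * s / q) <= _); last by rewrite prodr_const card_ord.
apply: ler_prod => j _; rewrite ler0n /=.
apply: le_trans (card_interval_le _ s0) _.
rewrite (_ : 3 * s / q = 2 * s / q + s / q); last by rewrite -mulrDl; congr (_ / _); ring.
by rewrite lerD2l ler_pdivlMr// mul1r.
Qed.

(* Summing over the dyadic shells around [a]. *)
Lemma grid_tail (a : 'rV[R]_d.+1) (s : R) (G : seq {ffun 'I_d -> 'I_Q}) :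
  uniq G -> q <= s -> (forall k, k \in G -> s <= euclid (a - grid_point k)) ->
  \sum_(k <- G) (euclid (a - grid_point k))^-1 ^+ d.+1 <= 2 * 6 ^+ d / (s * q ^+ d).
Proof.
move=> uG qs far; have s0 : 0 < s by exact: lt_le_trans qs.
have p2 m : 0 < 2 ^+ m :> R by rewrite exprn_gt0.
pose N k := euclid (a - grid_point k).
apply: le_trans (_ : \sum_(k <- G) (if k \in G then (N k)^-1 ^+ d.+1 else 0) <= _).
  by rewrite big_seq [leRHS]big_seq; apply: ler_sum => k ->.
apply: (@sum_layers _ _ _ _ (fun k => floor_log2 (N k / s))
    (fun p => 6 ^+ d / (s * q ^+ d) * 2^-1 ^+ p)); last first.
  move=> P; rewrite -mulr_sumr [leRHS](_ : _ = 6 ^+ d / (s * q ^+ d) * 2); last by ring.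
  rewrite ler_wpM2l//; first by rewrite divr_ge0 ?mulr_ge0 ?exprn_ge0 ?(ltW s0) ?(ltW q0).
  rewrite [leRHS](_ : _ = (1 - 2^-1)^-1); last by field.
  by apply: geometric_sum; apply/andP; split; lra.
move=> p; rewrite -big_filter; set G1 := [seq k <- G | _].
have G1P k : k \in G1 -> k \in G /\ 2 ^+ p * s <= N k < 2 ^+ p.+1 * s.
  rewrite mem_filter => /andP[/eqP <- kG]; split => //.
  rewrite -ler_pdivlMr// -ltr_pdivrMr//; apply: floor_log2_itv.
  by rewrite ler_pdivlMr// mul1r; exact: far.
pose r := 2 ^+ p.+1 * s.
have qr : q <= r by apply: le_trans qs _; rewrite ler_peMl ?(ltW s0)// exprn_ege1// ler1n.
have cnt : (size G1)%:R <= (3 * r / q) ^+ d.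
  apply: le_trans (grid_count a qr); rewrite ler_nat cardE.
  apply: uniq_leq_size; first by rewrite filter_uniq.
  move=> k /G1P[_ /andP[_ kr]]; rewrite mem_enum inE; apply/forallP => j.
  have := coord_le_euclid (a - grid_point k) (lift ord_max j).
  by rewrite [X in `|X|]mxE [(- _ : 'rV[R]_d.+1) _ _]mxE => /le_trans; apply; exact: ltW.
apply: le_trans (_ : \sum_(k <- G1) (2 ^+ p * s)^-1 ^+ d.+1 <= _).
  rewrite big_seq [leRHS]big_seq; apply: ler_sum => k /G1P[-> /andP[h1 _]].
  have N0 : 0 < N k by apply: lt_le_trans h1; rewrite mulr_gt0.
  by rewrite lerXn2r ?nnegrE ?invr_ge0 ?mulr_ge0 ?(ltW N0) ?(ltW s0) ?(ltW (p2 _))// lef_pV2 ?posrE ?mulr_gt0.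
rewrite big_const_seq count_predT iter_addr addr0 -[leLHS]mulr_natl.
apply: le_trans (_ : (3 * r / q) ^+ d * (2 ^+ p * s)^-1 ^+ d.+1 <= _).
  by rewrite ler_wpM2r// exprn_ge0// invr_ge0 mulr_ge0// ltW.
rewrite le_eqVlt; apply/orP; left; apply/eqP; rewrite /r.
rewrite [X in _ * X = _]exprSr [LHS]mulrA -exprMn.
rewrite (_ : 3 * (2 ^+ p.+1 * s) / q * (2 ^+ p * s)^-1 = 6 / q); last first.
  by rewrite exprS; move: (2 ^+ p) (p2 p) => t t0; field; rewrite !gt_eqF.
rewrite exprMn !exprVn.
have qd : 0 < q ^+ d by rewrite exprn_gt0.
move: (6 ^+ d) (q ^+ d) (2 ^+ p) qd (p2 p) => x y t y0 t0.
by field; rewrite !gt_eqF.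
Qed.

End Grid.

Section PoissonSums.
Context {R : realType} {d : nat}.
Implicit Types (a b xi : 'rV[R]_d.+1) (g : 'rV[R]_d.+1 -> R).

Definition poisson_comb (s : seq (R * 'rV[R]_d.+1)) (a : 'rV[R]_d.+1) : R :=
  \sum_(p <- s) p.1 * poisson p.2 a.

Definition poisson_sum g := exists2 s : seq (R * 'rV[R]_d.+1),
  (forall p, p \in s -> 0 <= p.1 /\ height p.2 = 0) & g = poisson_comb s.

Lemma poisson_sumZ k g : 0 <= k -> poisson_sum g -> poisson_sum (fun a => k * g a).
Proof.
move=> k0 [s hs ->]; exists [seq (k * p.1, p.2) | p <- s].
  by move=> _ /mapP[p /hs[p0 ph] ->] /=; rewrite mulr_ge0.
apply/funext => a; rewrite /poisson_comb big_map mulr_sumr.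
by apply: eq_bigr => p _; rewrite mulrA.
Qed.

Lemma poisson_sum_sum (I : Type) (r : seq I) (f : I -> 'rV[R]_d.+1 -> R) :
  (forall i, poisson_sum (f i)) -> poisson_sum (fun a => \sum_(i <- r) f i a).
Proof.
move=> hf; elim: r => [|i r [s hs sE]].
  exists [::] => //; apply/funext => a; by rewrite /poisson_comb !big_nil.
have [t ht tE] := hf i; exists (t ++ s).
  by move=> p; rewrite mem_cat => /orP[/ht|/hs].
apply/funext => a; rewrite big_cons /poisson_comb big_cat /=; congr (_ + _).
  by rewrite tE.
by have := congr1 (@^~ a) sE.
Qed.

Lemma poisson_boundary xi a : height xi = 0 ->
  poisson xi a = height a / euclid (a - xi) ^+ d.+1.
Proof. by move=> xi0; rewrite poissonE -!/(height _) xi0 subr0. Qed.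

Lemma poisson_gt0 xi a : height xi = 0 -> half_space a -> 0 < poisson xi a.
Proof.
move=> xi0 ha; rewrite poisson_boundary// divr_gt0// exprn_gt0//.
exact: lt_le_trans (height_le_euclid xi0 ha).
Qed.

Lemma poisson_ge_near xi a (C : R) : height xi = 0 -> half_space a -> 1 <= C ->
  (forall i, i != ord_max -> `|a ord0 i - xi ord0 i| <= C * height a) ->
  [/\ euclid (a - xi) <= (d.+1%:R * C + 1) * height a &
   ((d.+1%:R * C + 1) ^+ d.+1 * height a ^+ d)^-1 <= poisson xi a].
Proof.
move=> xi0 ha C1 near; have a0 : 0 < height a := ha.
have n1 : 1 <= d.+1%:R :> R by rewrite ler1n.
have N0 := lt_le_trans a0 (height_le_euclid xi0 a0).
have D0 : 0 < d.+1%:R * C + 1 by have := mulr_ge0 (ler0n R d.+1) (le_trans ler01 C1); lra.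
have le1 : euclid (a - xi) <= (d.+1%:R * C + 1) * height a.
  rewrite -ler_sqr ?nnegrE ?euclid_ge0 ?mulr_ge0 ?(ltW a0) ?(ltW D0)//.
  rewrite euclid_sqr_boundary// [leRHS]exprMn.
  apply: le_trans (lerD (horiz_sqr_le near) (lexx _)) _.
  rewrite exprMn mulrA -[X in _ + X]mul1r -mulrDl ler_wpM2r ?sqr_ge0//.
  rewrite sqrrD expr1n mulr1 exprMn lerD2r.
  have : d.+1%:R * C ^+ 2 <= d.+1%:R ^+ 2 * C ^+ 2.
    by rewrite ler_wpM2r ?sqr_ge0// expr2 ler_peMr//; lra.
  have := mulr_ge0 (ler0n R d.+1) (le_trans ler01 C1).
  by rewrite mulr2n; lra.
split => //; rewrite poisson_boundary//.
apply: le_trans (_ : height a / ((d.+1%:R * C + 1) * height a) ^+ d.+1 <= _).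
  rewrite exprMn [height a ^+ d.+1]exprS.
  move: (_ ^+ d.+1) (height a ^+ d) (exprn_gt0 d.+1 D0) (exprn_gt0 d a0) => E Y E0 Y0.
  rewrite le_eqVlt; apply/orP; left; apply/eqP.
  by move: (height a) a0 => y y0; field; rewrite !gt_eqF.
rewrite ler_pM2l// lef_pV2 ?posrE ?exprn_gt0 ?mulr_gt0//.
by rewrite lerXn2r ?nnegrE ?mulr_ge0 ?(ltW a0) ?(ltW N0) ?(ltW D0).
Qed.

(** The pole is close to [a] on the scale of the mirror distance, hence at least half as far from
    [b] as the mirror image of [a]. *)
Lemma poisson_le_far xi a b (D : R) : height xi = 0 -> half_space a -> half_space b ->
  euclid (a - xi) <= D * height a -> 2 * D * height a <= mirror_dist b a ->
  poisson xi b <= 2 ^+ d.+1 * (height b / mirror_dist b a ^+ d.+1).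
Proof.
move=> xi0 ha hb hD far; have a0 : 0 < height a := ha; have b0 : 0 < height b := hb.
have Na0 := lt_le_trans a0 (height_le_euclid xi0 a0).
have Nb0 := lt_le_trans b0 (height_le_euclid xi0 b0).
have m0 := mirror_dist_gt0 hb ha.
have hor : horiz_sqr b a <= 2 * horiz_sqr b xi + 2 * horiz_sqr a xi.
  rewrite /horiz_sqr !mulr_sumr -big_split /=; apply: ler_sum => i _.
  have := sqr_ge0 ((b ord0 i - xi ord0 i) + (a ord0 i - xi ord0 i)); lra.
have mN : mirror_dist b a <= 2 * euclid (b - xi).
  rewrite -ler_sqr ?nnegrE ?mulr_ge0 ?(ltW m0) ?(ltW Nb0)//.
  have h1 : mirror_dist b a ^+ 2 <= 2 * euclid (b - xi) ^+ 2 + 2 * euclid (a - xi) ^+ 2.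
    rewrite mirror_dist_sqr !euclid_sqr_boundary//.
    have := sqr_ge0 (height b - height a); lra.
  have h2 : (2 * euclid (a - xi)) ^+ 2 <= mirror_dist b a ^+ 2.
    rewrite ler_sqr ?nnegrE ?mulr_ge0 ?(ltW m0) ?(ltW Na0)//; lra.
  rewrite !exprMn in h2 *; lra.
rewrite poisson_boundary// mulrCA ler_pM2l//.
rewrite -[2 ^+ d.+1]invrK -invfM lef_pV2 ?posrE ?mulr_gt0 ?invr_gt0 ?exprn_gt0//.
rewrite mulrC ler_pdivrMr ?exprn_gt0// mulrC -exprMn.
by rewrite lerXn2r ?nnegrE ?mulr_ge0 ?(ltW m0) ?(ltW Nb0).
Qed.

End PoissonSums.

Section Kernel.
Context {R : realType} {d : nat}.
Context (z : nat -> 'rV[R]_d.+1) (delta : R).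
Context (hz : forall n, half_space (z n)).
Context (delta0 : 0 < delta).
Context (sep : forall n m, n <> m -> delta <= beta (z n) (z m)).
Context (hd : (1 < d)%N).
Local Opaque beta ln.

Lemma sum_indicator (T : finType) (P : pred T) : \sum_(k : T) (P k)%:R = #|P|%:R :> R.
Proof.
rewrite -sum1_card natr_sum [RHS]big_mkcond /=.
by apply: eq_bigr => k _; rewrite unfold_in; case: (P k).
Qed.

(* The poles left in a grid after deleting those close to some [z m], [m \in F]:
   at least half of them remain. *)
Lemma grid_survivors (x0 : 'rV[R]_d.+1) (q : R) (Q : nat) (F : seq nat) (s : nat -> R) :
  0 < q -> (forall m, m \in F -> q <= s m) ->
  \sum_(m <- F) (3 * s m / q) ^+ d <= 2^-1 * Q%:R ^+ d ->
  exists G : seq {ffun 'I_d -> 'I_Q}, [/\ uniq G, 2^-1 * Q%:R ^+ d <= (size G)%:R :> R &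
    forall k m, k \in G -> m \in F -> s m <= euclid (z m - grid_point x0 q k)].
Proof.
move=> q0 qs bad.
pose B m := [pred k : {ffun 'I_d -> 'I_Q} | [forall j : 'I_d,
  `|z m ord0 (lift ord_max j) - grid_point x0 q k ord0 (lift ord_max j)| <= s m]].
pose G := [seq k <- enum {: {ffun 'I_d -> 'I_Q}} | all (fun m => ~~ B m k) F].
exists G; split.
- by rewrite filter_uniq// enum_uniq.
- have tot : Q%:R ^+ d <= (size G)%:R + \sum_(m <- F) (3 * s m / q) ^+ d.
    have -> : Q%:R ^+ d = \sum_(k : {ffun 'I_d -> 'I_Q}) 1 :> R.
      by rewrite sumr_const card_ffun !card_ord natrX.
    apply: le_trans (_ : \sum_(k : {ffun 'I_d -> 'I_Q}) ((k \in G)%:R + \sum_(m <- F) (B m k)%:R) <= _).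
      apply: ler_sum => k _; have [kG|kG] := boolP (k \in G).
        by rewrite lerDl sumr_ge0.
      rewrite add0r; move: kG; rewrite mem_filter mem_enum andbT => /allPn[m mF /negPn Bm].
      apply: le_trans (_ : (B m k)%:R <= _); first by rewrite Bm.
      by rewrite (big_rem m mF) lerDl sumr_ge0.
    rewrite big_split /= exchange_big /=; apply: lerD.
      rewrite (sum_indicator (mem G)) ler_nat (eq_card (B := mem G))//.
      by rewrite (card_uniqP _)// filter_uniq// enum_uniq.
    rewrite big_seq [leRHS]big_seq; apply: ler_sum => m mF.
    rewrite (sum_indicator (B m)).
    exact: (grid_count x0 Q q0 (z m) (qs m mF)).
  lra.
move=> k m; rewrite mem_filter => /andP[/allP h _] /h /forallPn[j].
rewrite -ltNge => /ltW h1; apply: le_trans h1 _.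
have := coord_le_euclid (z m - grid_point x0 q k) (lift ord_max j).
by rewrite [X in `|X|]mxE [(- _ : 'rV[R]_d.+1) _ _]mxE.
Qed.

(** Yields one mesh finer than all the shadows; this is where [F] has to be finite. *)
Lemma finite_lower_bound (F : seq nat) (s : nat -> R) : (forall m, 0 < s m) ->
  exists2 e : R, 0 < e & forall m, m \in F -> e <= s m.
Proof.
move=> s0; elim: F => [|m F [e e0 h]]; first by exists 1.
exists (Num.min e (s m)); first by rewrite lt_min e0 s0.
move=> k; rewrite in_cons => /orP[/eqP ->|/h]; first by rewrite ge_min lexx orbT.
by apply: le_trans; rewrite ge_min lexx.
Qed.

Context (M alpha : R).
Context (alpha0 : 0 < alpha) (alpha1 : alpha < 1) (M0 : 0 < M).
Context (growth : forall (l n : nat) (s : seq nat), (0 < l)%N -> uniq s ->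
  (forall k, k \in s -> beta (z k) (z n) <= l%:R) ->
  (size s)%:R <= M * 2 `^ (alpha * d%:R * l%:R)).

Let tau := (1 - alpha) / 2.

Lemma survivors_identity (x y h t u v w D : R) :
  0 < h -> 0 < t -> 0 < u -> 0 < v -> 0 < w -> 0 < D ->
  y * (2 * x / (h * t^-1 * (u * v / w))) =
  4 * x * D / u * (y / h * t) * (2^-1 * w * (D * v)^-1).
Proof. by move=> *; field; rewrite !gt_eqF. Qed.

Lemma far_identity (x y u v m D : R) : 0 < D -> 0 < u -> 0 < v -> 0 < m ->
  x * (y / (m * v)) = x * D * (y / m * (u / v)) * (D * u)^-1.
Proof. by move=> *; field; rewrite !gt_eqF. Qed.

(** Equal weights on the surviving poles, normalised at [z n]. The shadow of [z m] has radius
    [height (z n) * hyp^(-(1 - tau))]: as [(1 - tau) * d] exceeds [alpha * d], [growth_sum] bounds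
    the total volume of the shadows, while the distance kept by the survivors gives the bound at
    [z m]. The kernel depends on [F], the constants do not. *)
Lemma interpolation_kernel : exists k C K L0 : R, [/\ 0 < k, 0 < C, 0 < K, 1 <= L0 &
  forall (F : seq nat) n b, uniq F -> n <> b ->
  exists g, [/\ poisson_sum g, g (z n) = 1, (1 + k) * g (z b) <= 1,
   forall m, m \in F -> L0 <= hyp (z m) (z n) ->
     g (z m) <= C * (height (z m) / height (z n) * hyp (z m) (z n) `^ (1 - tau)) &
   forall a, half_space a -> K * height (z n) <= mirror_dist a (z n) ->
     g a <= C * (height a / mirror_dist a (z n) * (height (z n) / mirror_dist a (z n)) ^+ d)]].
Proof.
have [k [C1 [r [k0 C11 r0 r1 Hpole]]]] := pole_exists hd delta0.
have d0 : 0 < d%:R :> R by rewrite ltr0n ltnW.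
have tau0 : 0 < tau by rewrite divr_gt0 ?subr_gt0.
have tau1 : tau < 2^-1.
  by rewrite /tau -[ltRHS]mul1r ltr_pM2r ?invr_gt0// gtrDl oppr_lt0.
(* The exponent [(1 - tau) * d] is split into [sig], which is above the growth exponent and makes
   the sum converge, and [sig'], which leaves the small factor [L0^(- sig')]. *)
pose sig := alpha * d%:R + (1 - alpha) / 4 * d%:R.
have asig : alpha * d%:R < sig by rewrite ltrDl mulr_gt0// divr_gt0// subr_gt0.
have [CB CB0 HB] := growth_sum hz alpha0 M0 growth asig.
pose sig' := (1 - alpha) / 4 * d%:R.
have sig'0 : 0 < sig' by rewrite mulr_gt0// divr_gt0// subr_gt0.
have sigE : (1 - tau) * d%:R = sig + sig' by rewrite /tau /sig /sig'; field.
pose D := d.+1%:R * C1 + 1.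
have D1 : 1 <= D by rewrite lerDr mulr_ge0 ?ler0n//; lra.
have D0 : 0 < D by lra.
pose E := (3 / r) ^+ d * CB.
have E0 : 0 <= E by rewrite mulr_ge0// exprn_ge0// divr_ge0// ltW.
(* Only points with [hyp >= L0] cast shadows; this threshold keeps half of the grid alive. *)
pose L0 := Num.max 1 ((2 * E + 1) `^ (sig'^-1)).
have L01 : 1 <= L0 by rewrite le_max lexx.
have EL : E * L0 `^ (- sig') <= 2^-1.
  have L00 : 0 < L0 by lra.
  rewrite powRN ler_pdivrMr ?powR_gt0//.
  have : 2 * E + 1 <= L0 `^ sig'.
    rewrite -[leLHS]powRr1; last by lra.
    rewrite -[X in _ `^ X <= _](mulVf (lt0r_neq0 sig'0)) powRrM.
    apply: ge0_ler_powR; rewrite ?nnegrE ?powR_ge0 ?(ltW L00) ?(ltW sig'0)//.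
    by rewrite le_max lexx orbT.
  lra.
pose C := Num.max (4 * 6 ^+ d * D ^+ d.+1 / r ^+ d) (2 ^+ d.+1 * D ^+ d.+1).
have C0 : 0 < C by rewrite lt_max; apply/orP; right; rewrite mulr_gt0 ?exprn_gt0.
exists k, C, (2 * D), L0; split => //; first by rewrite mulr_gt0.
move=> F n b uF nb.
set a := z n; have ha : half_space a := hz n; set h := height a; have h0 : 0 < h := ha.
have [x0 Hx0] := Hpole a (z b) ha (hz b) (sep nb).
pose hp m := hyp (z m) a.
have hp0 m : 0 < hp m by exact: hyp_gt0.
pose s m := h * hp m `^ (- (1 - tau)).
have s0 m : 0 < s m by rewrite mulr_gt0 ?powR_gt0.
pose F' := [seq m <- F | L0 <= hp m].
have [q1 q10 hq1] := finite_lower_bound F s0.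
pose Q := (Num.truncn (r * h / q1)).+1.
have Q0 : 0 < Q%:R :> R by rewrite ltr0n.
have rh0 : 0 < r * h by rewrite mulr_gt0.
pose q := r * h / Q%:R.
have q0 : 0 < q by rewrite divr_gt0.
have qQ : q * Q%:R = r * h by rewrite /q divfK// gt_eqF.
have qs m : m \in F' -> q <= s m.
  rewrite mem_filter => /andP[_ /hq1]; apply: le_trans.
  rewrite ler_pdivrMr// [leRHS]mulrC -ler_pdivrMr//.
  exact: ltW (truncnS_gt _).
have bad : \sum_(m <- F') (3 * s m / q) ^+ d <= 2^-1 * Q%:R ^+ d.
  apply: le_trans (_ : \sum_(m <- F') (3 / r) ^+ d * Q%:R ^+ d * L0 `^ (- sig') * (hp m `^ (- sig)) <= _).
    rewrite big_seq [leRHS]big_seq; apply: ler_sum => m; rewrite mem_filter => /andP[Lm _].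
    rewrite (_ : 3 * s m / q = 3 / r * Q%:R * hp m `^ (- (1 - tau))); last first.
      rewrite /s /q; move: (hp m `^ _) => t; move: Q%:R Q0 => X X0.
      by field; rewrite !gt_eqF.
    rewrite exprMn [X in X * _ <= _]exprMn -[leRHS]mulrA ler_wpM2l//.
      by rewrite mulr_ge0 ?exprn_ge0 ?divr_ge0 ?(ltW r0) ?(ltW Q0).
    rewrite -powR_mulrn ?powR_ge0// -powRrM mulNr sigE opprD addrC powRD; last first.
      by apply/implyP => _; rewrite gt_eqF.
    rewrite ler_wpM2r ?powR_ge0// !powRN lef_pV2 ?posrE ?powR_gt0//; last by lra.
    by apply: ge0_ler_powR; rewrite ?nnegrE ?(ltW sig'0) ?(ltW (hp0 m))//; lra.
  rewrite -mulr_sumr.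
  apply: le_trans (_ : (3 / r) ^+ d * Q%:R ^+ d * L0 `^ (- sig') * CB <= _).
    rewrite ler_wpM2l//.
      by rewrite !mulr_ge0 ?exprn_ge0 ?powR_ge0 ?divr_ge0 ?(ltW r0) ?(ltW Q0).
    by apply: HB; rewrite filter_uniq.
  rewrite (_ : _ * CB = Q%:R ^+ d * (E * L0 `^ (- sig'))); last first.
    by rewrite /E; move: (L0 `^ _) => t; ring.
  by rewrite [leRHS]mulrC ler_wpM2l// exprn_ge0// ltW.
have [G [uG szG farG]] := grid_survivors x0 q0 qs bad.
pose xi (k' : {ffun 'I_d -> 'I_Q}) := grid_point x0 q k'.
have xih k' : height (xi k') = 0 by exact: grid_point_height.
have xiP k' : (forall i, i != ord_max -> `|a ord0 i - xi k' ord0 i| <= C1 * h) /\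
    (1 + k) * poisson (xi k') (z b) <= poisson (xi k') a.
  by apply: Hx0 => // i im; rewrite -/h -qQ; exact: grid_point_itv.
have nearP k' := poisson_ge_near (xih k') ha C11 (xiP k').1.
pose Z := \sum_(k' <- G) poisson (xi k') a.
have DD0 : 0 < D ^+ d.+1 * h ^+ d by rewrite mulr_gt0 ?exprn_gt0.
have Qd0 : 0 < Q%:R ^+ d :> R by rewrite exprn_gt0.
have Zge : 2^-1 * Q%:R ^+ d * (D ^+ d.+1 * h ^+ d)^-1 <= Z.
  apply: le_trans (_ : (size G)%:R * (D ^+ d.+1 * h ^+ d)^-1 <= _).
    by rewrite ler_wpM2r// invr_ge0 ltW.
  rewrite mulr_natl -[_ *+ size G]addr0 -iter_addr -(count_predT G) -big_const_seq.
  by apply: ler_sum => k' _; have [_] := nearP k'.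
have Z0 : 0 < Z by apply: lt_le_trans Zge; rewrite !mulr_gt0 ?invr_gt0.
pose g x := \sum_(k' <- G) Z^-1 * poisson (xi k') x.
have gE x : g x = (\sum_(k' <- G) poisson (xi k') x) / Z.
  by rewrite /g -mulr_sumr mulrC.
exists g; split.
- exists [seq (Z^-1, xi k') | k' <- G].
    by move=> _ /mapP[k' _ ->] /=; rewrite invr_ge0 ltW.
  by apply/funext => x; rewrite /poisson_comb big_map.
- by rewrite gE -/Z mulfV// gt_eqF.
- rewrite gE mulrA ler_pdivrMr// mul1r mulr_sumr; apply: ler_sum => k' _.
  by have [] := xiP k'.
- move=> m mF Lm; have mF' : m \in F' by rewrite mem_filter Lm.
  have zm0 : 0 < height (z m) := hz m.
  rewrite gE ler_pdivrMr//.
  apply: le_trans (_ : height (z m) * (2 * 6 ^+ d / (s m * q ^+ d)) <= _).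
    rewrite (eq_bigr (fun k' => height (z m) * (euclid (z m - xi k'))^-1 ^+ d.+1)); last first.
      by move=> k' _; rewrite poisson_boundary// exprVn.
    rewrite -mulr_sumr ler_pM2l//; apply: grid_tail => //; first exact: qs.
    by move=> k' k'G; exact: farG.
  apply: le_trans (_ : C * (height (z m) / h * hp m `^ (1 - tau)) *
    (2^-1 * Q%:R ^+ d * (D ^+ d.+1 * h ^+ d)^-1) <= _); last first.
    by rewrite ler_wpM2l// !mulr_ge0 ?powR_ge0 ?invr_ge0 ?(ltW C0) ?(ltW zm0) ?(ltW h0).
  have -> : q ^+ d = r ^+ d * h ^+ d / Q%:R ^+ d.
    by rewrite -exprMn -qQ [in RHS]exprMn mulfK// gt_eqF.
  rewrite /s powRN -/(hp m); have := powR_gt0 (1 - tau) (hp0 m).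
  move: (hp m `^ (1 - tau)) => t t0.
  apply: le_trans (_ : (4 * 6 ^+ d * D ^+ d.+1 / r ^+ d) * (height (z m) / h * t) *
    (2^-1 * Q%:R ^+ d * (D ^+ d.+1 * h ^+ d)^-1) <= _); last first.
    rewrite ler_pM2r; last by rewrite !mulr_gt0 ?invr_gt0.
    rewrite ler_pM2r; last by rewrite mulr_gt0// divr_gt0.
    by rewrite le_max lexx.
  have rd0 : 0 < r ^+ d by rewrite exprn_gt0.
  have hd0 : 0 < h ^+ d by rewrite exprn_gt0.
  have Dd0 : 0 < D ^+ d.+1 by rewrite exprn_gt0.
  by rewrite le_eqVlt; apply/orP; left; apply/eqP; exact: survivors_identity.
- move=> x hx far; have hx0 : 0 < height x := hx.
  have m0 := mirror_dist_gt0 hx ha.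
  rewrite gE ler_pdivrMr// mulr_sumr; apply: ler_sum => k' _.
  have [le1 le2] := nearP k'.
  apply: le_trans (poisson_le_far (xih k') ha hx le1 far) _.
  apply: le_trans (_ : C * (height x / mirror_dist x a * (h / mirror_dist x a) ^+ d) *
    (D ^+ d.+1 * h ^+ d)^-1 <= _); last first.
    apply: ler_wpM2l le2; rewrite !mulr_ge0 ?exprn_ge0 ?mulr_ge0 ?invr_ge0 ?(ltW C0) ?(ltW hx0) ?(ltW m0) ?(ltW h0)//.
  apply: le_trans (_ : 2 ^+ d.+1 * D ^+ d.+1 * (height x / mirror_dist x a * (h / mirror_dist x a) ^+ d) *
    (D ^+ d.+1 * h ^+ d)^-1 <= _); last first.
    rewrite ler_pM2r ?invr_gt0// ler_pM2r; last by rewrite mulr_gt0 ?exprn_gt0 ?divr_gt0.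
    by rewrite le_max lexx orbT.
  rewrite expr_div_n [mirror_dist x a ^+ d.+1]exprS.
  have hd0 : 0 < h ^+ d by rewrite exprn_gt0.
  have Dd0 : 0 < D ^+ d.+1 by rewrite exprn_gt0.
  have md0 : 0 < mirror_dist x a ^+ d by rewrite exprn_gt0.
  by rewrite le_eqVlt; apply/orP; left; apply/eqP; exact: far_identity.
Qed.

End Kernel.

(** * Row sums and the linear system *)

Section RowSums.
Context {R : realType} {d : nat}.
Context (hd : (1 < d)%N).
Local Opaque beta ln powR.

Lemma ler_powRN (x y r : R) : 0 < x -> x <= y -> 0 <= r -> y `^ (- r) <= x `^ (- r).
Proof.
move=> x0 xy r0; have y0 : 0 < y by exact: lt_le_trans xy.
rewrite !powRN lef_pV2 ?posrE ?powR_gt0//.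
by apply: ge0_ler_powR; rewrite ?nnegrE ?(ltW x0) ?(ltW y0).
Qed.

(** [Y ^+ 2 / H] is the height ratio of the near bound and [8 * e] is its [tau]. The powers of [H]
    on the left combine to [- 7 e], and since [Y <= K] the missing powers of [Y] cost only
    [K^(d+2)]. *)
Lemma row_near (e K Y H : R) : 0 < e -> 0 < K -> 0 < Y -> Y <= K -> 1 <= H ->
  H `^ e * (Y ^+ 2 / H * H `^ (1 - 8 * e)) <=
  K ^+ d.+2 * (H `^ (- e) * (Y^-1 ^+ d * H `^ (- e))).
Proof.
move=> e0 K0 Y0 YK H1; have H0 : 0 < H by lra.
have HD a b : H `^ (a + b) = H `^ a * H `^ b.
  by rewrite powRD//; apply/implyP => _; rewrite gt_eqF.
rewrite [leLHS](_ : _ = Y ^+ 2 * H `^ (- (7 * e))); last first.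
  rewrite (_ : - (7 * e) = e + (-1) + (1 - 8 * e)); last by ring.
  by rewrite !HD powR_inv1 ?(ltW H0)//; ring.
rewrite [leRHS](_ : _ = K ^+ 2 * (K / Y) ^+ d * H `^ (- (2 * e))); last first.
  rewrite (_ : - (2 * e) = (- e) + (- e)); last by ring.
  by rewrite HD exprMn -[d.+2]addn2 exprD; ring.
apply: ler_pM; rewrite ?sqr_ge0 ?powR_ge0//.
  rewrite -[leLHS]mulr1; apply: ler_pM; rewrite ?sqr_ge0//.
    by rewrite ler_sqr ?nnegrE ?(ltW Y0) ?(ltW K0).
  by rewrite exprn_ege1// ler_pdivlMr// mul1r.
by apply: ler_powR => //; lra.
Qed.

(** Either [X >= H^(4 e)], and [X^(-1)] pays for the powers of [H]; or [Y >= H^(1 - 4 e)] because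
    [X * Y = H], and [Y^(-d)] becomes a power of [hyp] that is summable under the growth
    condition. *)
Lemma row_far (e s X Y : R) : 0 < e -> e <= 16^-1 -> 1 <= X -> 1 <= Y ->
  s = d%:R * (1 - 12 * e) ->
  (X * Y) `^ e * (X^-1 * Y^-1 ^+ d) <=
  (X * Y) `^ (- e) * (Y^-1 ^+ d * (X * Y) `^ (- e) + (X * Y) `^ (- s)).
Proof.
move=> e0 e16 X1 Y1 sE; have X0 : 0 < X by lra. have Y0 : 0 < Y by lra.
set H := X * Y; have H1 : 1 <= H by rewrite mulr_ege1.
have H0 : 0 < H by lra.
have HD a b : H `^ (a + b) = H `^ a * H `^ b.
  by rewrite powRD//; apply/implyP => _; rewrite gt_eqF.
have d1 : 1 <= d%:R :> R by rewrite ler1n ltnW.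
have Yd0 : 0 <= Y^-1 ^+ d by rewrite exprn_ge0// invr_ge0 ltW.
have Yd1 : Y^-1 ^+ d <= 1.
  by apply: exprn_ile1; rewrite ?invr_ge0 ?(ltW Y0)// invf_le1.
rewrite mulrDr; have [XH|HX] := leP (H `^ (4 * e)) X.
  apply: le_trans (_ : H `^ (- e) * (Y^-1 ^+ d * H `^ (- e)) <= _); last first.
    by rewrite lerDl mulr_ge0 ?powR_ge0.
  rewrite [leRHS](_ : _ = H `^ e * (H `^ (- (3 * e)) * Y^-1 ^+ d)); last first.
    rewrite mulrCA -HD mulrA -HD mulrC; congr (H `^ _ * _); ring.
  rewrite ler_wpM2l ?powR_ge0// ler_wpM2r//.
  apply: le_trans (_ : H `^ (- (4 * e)) <= _); last by apply: ler_powR => //; lra.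
  by rewrite powRN lef_pV2 ?posrE ?powR_gt0.
apply: le_trans (_ : H `^ (- e) * H `^ (- s) <= _); last first.
  by rewrite lerDr mulr_ge0 ?powR_ge0// mulr_ge0 ?powR_ge0.
have YH : H `^ (1 - 4 * e) <= Y.
  have : H `^ (1 - 4 * e) * H `^ (4 * e) <= Y * H `^ (4 * e).
    have HE : H = Y * X by rewrite mulrC.
    by rewrite -HD subrK powRr1 ?(ltW H0)// [leLHS]HE ler_pM2l// ltW.
  by rewrite ler_pM2r ?powR_gt0.
rewrite [leRHS](_ : _ = H `^ e * H `^ (- (2 * e) - s)); last first.
  by rewrite -!HD; congr (H `^ _); ring.
rewrite ler_wpM2l ?powR_ge0//.
apply: le_trans (_ : 1 * Y^-1 ^+ d <= _).
  by rewrite ler_wpM2r// invf_le1.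
rewrite mul1r; apply: le_trans (_ : (H `^ (1 - 4 * e))^-1 ^+ d <= _).
  by rewrite lerXn2r ?nnegrE ?invr_ge0 ?powR_ge0 ?(ltW Y0)// lef_pV2 ?posrE ?powR_gt0.
rewrite -powRN -powR_mulrn ?powR_ge0// -powRrM.
apply: ler_powR => //; rewrite sE.
have : e * 1 <= e * d%:R by rewrite ler_pM2l.
lra.
Qed.

Context (z : nat -> 'rV[R]_d.+1) (delta : R).
Context (hz : forall n, half_space (z n)).
Context (delta0 : 0 < delta).
Context (sep : forall n m, n <> m -> delta <= beta (z n) (z m)).
Context (M alpha : R).
Context (alpha0 : 0 < alpha) (alpha1 : alpha < 1) (M0 : 0 < M).
Context (growth : forall (l n : nat) (s : seq nat), (0 < l)%N -> uniq s ->
  (forall k, k \in s -> beta (z k) (z n) <= l%:R) ->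
  (size s)%:R <= M * 2 `^ (alpha * d%:R * l%:R)).

(** With [e = (1 - alpha) / 16] one has [tau = 8 e] and [alpha = 1 - 16 e], so [s = d (1 - 12 e)]
    still exceeds [alpha * d]. Each term is at most a constant times [hyp^(-e) * (A n + B n)]:
    [packing_sum] sums [A], [growth_sum] sums [B], and [hyp^(-e)] supplies the small [L^(-e)]. The
    factor [hyp^e] inside the sum is the room for the ratio [w n / w m]. *)
Lemma kernel_row_bound : exists k C e L0 : R, [/\ 0 < k, 0 < C, 0 < e, 1 <= L0 &
  forall (F : seq nat) (b : nat -> nat), uniq F -> (forall n, n <> b n) ->
  exists g : nat -> 'rV[R]_d.+1 -> R, [/\ forall n, poisson_sum (g n),
   forall n, g n (z n) = 1, forall n, (1 + k) * g n (z (b n)) <= 1 &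
   forall L m (S : seq nat), L0 <= L -> m \in F -> uniq S ->
     (forall n, n \in S -> L <= hyp (z m) (z n)) ->
     \sum_(n <- S) hyp (z m) (z n) `^ e * g n (z m) <= C * L `^ (- e)]].
Proof.
pose e := (1 - alpha) / 16.
have e0 : 0 < e by rewrite divr_gt0// subr_gt0.
have e16 : e <= 16^-1 by rewrite /e -[leRHS]mul1r ler_pM2r ?invr_gt0// gerDl oppr_le0 ltW.
have [k [C1 [K [L0 [k0 C10 K0 L01 HK]]]]] :=
  interpolation_kernel hz delta0 sep hd alpha0 alpha1 M0 growth.
have [CA CA0 HA] := packing_sum hz delta0 sep e0.
pose s := d%:R * (1 - 12 * e).
have d1 : 1 <= d%:R :> R by rewrite ler1n ltnW.
have as' : alpha * d%:R < s.
  rewrite /s mulrC ltr_pM2l; last by lra.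
  have -> : alpha = 1 - 16 * e by rewrite /e; field.
  lra.
have [CB CB0 HB] := growth_sum hz alpha0 M0 growth as'.
pose C2 := C1 * (K ^+ d.+2 + 1).
have C20 : 0 < C2 by rewrite mulr_gt0// ltr_wpDl// exprn_ge0// ltW.
exists k, (C2 * (CA + CB + 1)), e, L0; split => //.
  by rewrite mulr_gt0// ltr_wpDl// addr_ge0.
move=> F b uF nb; have /choice[g Hg] : forall n, exists g, [/\ poisson_sum g, g (z n) = 1,
   (1 + k) * g (z (b n)) <= 1,
   forall m, m \in F -> L0 <= hyp (z m) (z n) ->
     g (z m) <= C1 * (height (z m) / height (z n) * hyp (z m) (z n) `^ (1 - (1 - alpha) / 2)) &
   forall a, half_space a -> K * height (z n) <= mirror_dist a (z n) ->
     g a <= C1 * (height a / mirror_dist a (z n) * (height (z n) / mirror_dist a (z n)) ^+ d)].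
  by move=> n; exact: HK.
exists g; split; [by move=> n; have [] := Hg n|by move=> n; have [] := Hg n|
  by move=> n; have [] := Hg n|].
move=> L m S L0L mF uS hS.
have L0' : 0 < L by lra.
pose A n := (height (z n) / mirror_dist (z n) (z m)) ^+ d * hyp (z n) (z m) `^ (- e).
pose B n := hyp (z n) (z m) `^ (- s).
have term n : n \in S -> hyp (z m) (z n) `^ e * g n (z m) <= C2 * L `^ (- e) * (A n + B n).
  move=> nS; have Ln := hS n nS; have [_ _ _ gnear gfar] := Hg n.
  have zm0 : 0 < height (z m) := hz m; have zn0 : 0 < height (z n) := hz n.
  have m0 := mirror_dist_gt0 (hz m) (hz n).
  have mle := le_mirror_dist (hz m) (hz n).
  rewrite /A /B hyp_sym (mirror_dist_sym (z n)) [hyp (z n) _]hyp_sym.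
  have H1 : 1 <= hyp (z m) (z n) by lra.
  have HE : hyp (z m) (z n) = (mirror_dist (z m) (z n) / height (z m)) *
     (mirror_dist (z m) (z n) / height (z n)).
    rewrite /hyp; move: (mirror_dist _ _) (height _) (height _) m0 zm0 zn0 {gnear gfar mle} => x y w x0 y0 w0.
    by field; rewrite !gt_eqF.
  have Hle : hyp (z m) (z n) `^ (- e) <= L `^ (- e) by apply: ler_powRN => //; exact: ltW.
  have ratio : height (z m) / height (z n) = (mirror_dist (z m) (z n) / height (z n)) ^+ 2 / hyp (z m) (z n).
    rewrite /hyp; move: (mirror_dist _ _) (height _) (height _) m0 zm0 zn0 {gnear gfar mle HE} => x y w x0 y0 w0.
    by field; rewrite !gt_eqF.
  have X1 : 1 <= mirror_dist (z m) (z n) / height (z m) by rewrite ler_pdivlMr// mul1r; lra.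
  have Y1 : 1 <= mirror_dist (z m) (z n) / height (z n) by rewrite ler_pdivlMr// mul1r; lra.
  have gn := gnear m mF (le_trans L0L Ln).
  have gf := gfar (z m) (hz m).
  rewrite ratio in gn.
  have YI : height (z n) / mirror_dist (z m) (z n) = (mirror_dist (z m) (z n) / height (z n))^-1.
    by rewrite invf_div.
  have XI : height (z m) / mirror_dist (z m) (z n) = (mirror_dist (z m) (z n) / height (z m))^-1.
    by rewrite invf_div.
  rewrite YI in gf *; rewrite XI in gf.
  rewrite -ler_pdivlMr// in gf.
  have kz : (K <= mirror_dist (z m) (z n) / height (z n)) ->
     g n (z m) <= C1 * ((mirror_dist (z m) (z n) / height (z m))^-1 *
       (mirror_dist (z m) (z n) / height (z n))^-1 ^+ d) by exact: gf.
  move: kz gn Hle H1 X1 Y1 HE; clear gf XI YI ratio gfar gnear.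
  move: (mirror_dist (z m) (z n) / height (z n)) (mirror_dist (z m) (z n) / height (z m)).
  move: (g n (z m)) (hyp (z m) (z n)) => G H Y X kz gn Hle H1 X1 Y1 HE.
  have Y0 : 0 < Y by lra.
  have P0 : 0 <= Y^-1 ^+ d * H `^ (- e) by rewrite mulr_ge0 ?powR_ge0// exprn_ge0// invr_ge0 ltW.
  have Q0 : 0 <= H `^ (- s) by exact: powR_ge0.
  apply: le_trans (_ : C2 * (H `^ (- e) * (Y^-1 ^+ d * H `^ (- e) + H `^ (- s))) <= _); last first.
    rewrite -[leRHS]mulrA ler_pM2l//; apply: ler_wpM2r => //; exact: addr_ge0.
  rewrite /C2 -[leRHS]mulrA.
  have [YK|KY] := leP K Y.
    apply: le_trans (_ : H `^ e * (C1 * (X^-1 * Y^-1 ^+ d)) <= _).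
      by rewrite ler_wpM2l ?powR_ge0// kz.
    rewrite mulrCA ler_pM2l// HE.
    apply: le_trans (row_far e0 e16 X1 Y1 erefl) _.
    rewrite -[leLHS]mul1r ler_wpM2r//; last by rewrite lerDr exprn_ge0// ltW.
    by rewrite mulr_ge0 ?powR_ge0// addr_ge0 -?HE.
  apply: le_trans (_ : H `^ e * (C1 * (Y ^+ 2 / H * H `^ (1 - 8 * e))) <= _).
    rewrite ler_wpM2l ?powR_ge0//; apply: le_trans gn _.
    by rewrite (_ : (1 - alpha) / 2 = 8 * e)// /e; field.
  rewrite mulrCA ler_pM2l//; apply: le_trans (row_near e0 K0 Y0 (ltW KY) H1) _.
  apply: ler_pM.
  - by rewrite exprn_ge0// ltW.
  - by rewrite mulr_ge0 ?powR_ge0.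
  - by rewrite lerDl.
  - by rewrite ler_wpM2l ?powR_ge0// lerDl.
apply: le_trans (_ : \sum_(n <- S) C2 * L `^ (- e) * (A n + B n) <= _).
  by rewrite big_seq [leRHS]big_seq; apply: ler_sum => n; exact: term.
rewrite -mulr_sumr big_split /= -mulrA [L `^ _ * _]mulrC mulrA ler_wpM2r ?powR_ge0//.
rewrite ler_pM2l//.
have := HA S (z m) uS (hz m); have := HB S m uS.
rewrite -/(A _) -/(B _) => h1 h2.
have := lerD h2 h1; rewrite /A /B => h3; apply: (le_trans h3); lra.
Qed.

End RowSums.

(** * Positive solutions of a diagonally dominant system *)

Section LinearSystem.
Context {R : realType}.

(* Strict diagonal dominance gives both solvability and positivity. *)
Lemma positive_solution (N : nat) (E : 'I_N -> 'I_N -> R) (w : 'I_N -> R) (q : R) :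
  0 <= q < 1 -> (forall i, 0 < w i) -> (forall i j, 0 <= E i j) ->
  (forall i, \sum_j E i j * w j <= q * w i) ->
  exists2 c : 'I_N -> R, forall i, 0 < c i & forall i, c i + \sum_j E i j * c j = w i.
Proof.
move=> /andP[q0 q1] w0 E0 row.
have rowv (v : 'I_N -> R) i (B : R) : 0 <= B -> (forall j, v j <= B * w j) ->
    \sum_j E i j * v j <= q * B * w i.
  move=> B0 vB; apply: le_trans (_ : \sum_j B * (E i j * w j) <= _).
    by apply: ler_sum => j _; rewrite [leRHS]mulrCA ler_wpM2l.
  by rewrite -mulr_sumr (_ : q * B * w i = B * (q * w i)) ?ler_wpM2l//; ring.
pose A : 'M[R]_N := \matrix_(i, j) ((i == j)%:R + E i j).
have Aapp (v : 'cV[R]_N) i : (A *m v) i ord0 = v i ord0 + \sum_j E i j * v j ord0.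
  rewrite mxE; under eq_bigr do rewrite mxE mulrDl.
  rewrite big_split /=; congr (_ + _); rewrite (bigD1 i)//= eqxx mul1r big1 ?addr0// => j ji.
  by rewrite eq_sym (negbTE ji) mul0r.
(* In the norm [max |v i| / w i] the matrix [E] has norm at most [q < 1], so [v = - E v] forces
   [v = 0]. *)
have Ainj (v : 'cV[R]_N) : A *m v = 0 -> v = 0.
  move=> Av; pose f i := `|v i ord0| / w i.
  apply/colP => i1; rewrite mxE.
  case: (arg_maxP f (erefl : predT i1)) => i _ maxi.
  have fi0 : 0 <= f i by rewrite divr_ge0// ltW.
  have vf j : `|v j ord0| <= f i * w j.
    by rewrite -ler_pdivrMr//; exact: maxi.
  have : `|v i ord0| <= q * f i * w i.
    have -> : v i ord0 = - \sum_j E i j * v j ord0.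
      by apply/eqP; rewrite -addr_eq0; have := Aapp v i; rewrite Av mxE => <-.
    rewrite normrN; apply: le_trans (ler_norm_sum _ _ _) _.
    apply: le_trans (rowv (fun j => `|v j ord0|) i (f i) fi0 vf).
    by apply: ler_sum => j _; rewrite normrM ger0_norm.
  rewrite -ler_pdivrMr// -/(f i) => h.
  have fz : f i = 0.
    have : (1 - q) * f i <= 0 by lra.
    by rewrite pmulr_rle0 ?subr_gt0// => ?; apply/le_anti/andP.
  have := vf i1; rewrite fz mul0r normr_le0 => /eqP //.
have Au : A \in unitmx.
  rewrite -unitmx_tr -row_free_unit -kermx_eq0; apply/eqP/row_matrixP => i.
  rewrite row0; apply: trmx_inj; rewrite trmx0; apply: Ainj.
  by rewrite -{1}[A]trmxK -trmx_mul -row_mul mulmx_ker row0 trmx0.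
pose wv : 'cV[R]_N := \col_i w i.
pose c i := (invmx A *m wv) i ord0.
have cE i : c i + \sum_j E i j * c j = w i.
  by rewrite /c -Aapp mulmxA mulmxV// mul1mx mxE.
exists c => // i1.
pose f i := c i / w i.
case: (arg_minP f (erefl : predT i1)) => im _ minf.
case: (arg_maxP f (erefl : predT i1)) => iM _ maxf.
have lo j : f im * w j <= c j by rewrite -ler_pdivlMr//; exact: minf.
have hi j : c j <= f iM * w j by rewrite -ler_pdivrMr//; exact: maxf.
have cf j : c j = f j * w j by rewrite /f divfK// gt_eqF.
suff fm0 : 0 < f im.
  by apply: lt_le_trans (lo i1); rewrite mulr_gt0.
(* If the least quotient [f im] is nonpositive, the greatest is at most [1 - q * f im]; fed back,
   this gives [f im >= 1 - q + q^2 * f im], impossible for [q < 1]. *)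
rewrite ltNge; apply/negP => fm0.
have hM : f iM <= 1 - q * f im.
  rewrite -(ler_pM2r (w0 iM)) -cf mulrBl mul1r.
  have := rowv (fun j => - c j) iM (- f im); rewrite oppr_ge0 => /(_ fm0).
  have l' j : - c j <= - f im * w j by rewrite mulNr lerN2.
  move=> /(_ l'); under eq_bigr do rewrite mulrN.
  by rewrite sumrN; have := cE iM; lra.
have fM0 : 0 <= Num.max 0 (f iM) by rewrite le_max lexx.
have hm : 1 - q * Num.max 0 (f iM) <= f im.
  rewrite -(ler_pM2r (w0 im)) -cf mulrBl mul1r.
  have := rowv c im (Num.max 0 (f iM)) fM0.
  have l' j : c j <= Num.max 0 (f iM) * w j.
    by apply: le_trans (hi j) _; rewrite ler_wpM2r ?(ltW (w0 j))// le_max lexx orbT.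
  by move=> /(_ l'); have := cE im; lra.
have hmax : Num.max 0 (f iM) <= 1 - q * f im.
  by rewrite ge_max hM andbT; have := mulr_ge0_le0 q0 fm0; lra.
have := ler_wpM2l q0 hmax => h1.
have q2 : q * q <= q * 1 by rewrite ler_wpM2l// ltW.
have : q * q * f im >= q * f im by rewrite ler_wnM2r// -[leRHS]mulr1.
have : q * (- f im) <= 1 * (- f im) by rewrite ler_wpM2r ?oppr_ge0// ltW.
lra.
Qed.

End LinearSystem.

(** * Limits of Poisson sums *)

Section GeneralizedLimit.
Context {R : realType}.
Implicit Types (a b : nat -> R) (c C : R).

(** The limit along an ultrafilter refining the eventual filter: a bounded sequence lives in a
    compact interval, hence converges. One choice serves all test functions at once, without
    extracting subsequences. *)
Lemma generalized_limit : exists Lim : (nat -> R) -> R,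
  [/\ (forall a b c C, (forall K, `|a K| <= C) -> (forall K, `|b K| <= C) ->
        Lim (fun K => a K + c * b K) = Lim a + c * Lim b),
      (forall a c C, (forall K, `|a K| <= C) -> (forall K, a K <= c) -> Lim a <= c) &
      (forall a c K0, (forall K, (K0 <= K)%N -> a K = c) -> Lim a = c)].
Proof.
have [G [UG sG]] := ultraFilterLemma (@eventually_filter).
have PG : ProperFilter G by exact: ultra_proper.
have cv a (C : R) : (forall K, `|a K| <= C) -> cvg (a @ G).
  move=> aC; have := @segment_compact R (- C) C (a @ G) (fmap_proper_filter a PG).
  have GA : (a @ G) `[- C, C]%classic.
    change (G (a @^-1` `[- C, C]%classic)).
    apply: (@filterS nat G _ setT) => [K _|]; last exact: filterT.
    by rewrite /preimage /= in_itv /= -ler_norml.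
  move=> /(_ GA) [p [_ clp]]; apply/cvg_ex; exists p => U Up.
  have [//|] := in_ultra_setVsetC (a @^-1` U) UG.
  move=> GU; have [x [/= nU xU]] := clp (~` U) U GU Up.
  by [].
exists (fun a => lim (a @ G)); split.
- move=> a b c C aC bC; apply/cvg_lim => //; apply: cvgD; first exact: (cv a C aC).
  by apply: cvgM; [exact: cvg_cst|exact: (cv b C bC)].
- move=> a c C aC ac; apply: limr_le; first exact: (cv a C aC).
  exact: nearW.
- move=> a c K0 ac; apply/cvg_lim => //.
  have near_c : \forall K \near G, cst c K = a K.
    by apply: sG; exists K0 => // K /= /ac ->.
  apply: cvg_trans (near_eq_cvg near_c) _.
  exact: cvg_cst.
Qed.

End GeneralizedLimit.

Section PoissonLimit.
Context {R : realType} {d : nat}.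
Implicit Types (z xi : 'rV[R]_d.+1) (h : 'rV[R]_d.+1 -> R) (i j : 'I_d.+1)
  (e : expr R d).

(** Takes the place of a bound by total mass: a nonnegative combination of poles with value [w0] at
    [z0] pairs with [h] to at most [C * w0], whatever the number of poles. *)
Definition dominated z0 C h :=
  forall xi, height xi = 0 -> `|h xi| <= C * poisson xi z0.

Lemma boundary_euclid_le z0 z xi eta m : 0 < eta -> height xi = 0 ->
  eta <= height z -> `|z0 - z| <= m ->
  euclid (z0 - xi) <= (2 + 2 * d.+1%:R * m ^+ 2 / eta ^+ 2) * euclid (z - xi).
Proof.
move=> eta0 xi0 etaz zm.
have Ne : eta <= euclid (z - xi).
  by apply: (le_trans etaz); apply: height_le_euclid => //; exact: lt_le_trans etaz.
set Q := 2 + _; have Q1 : 1 <= Q.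
  rewrite /Q; have : 0 <= 2 * d.+1%:R * m ^+ 2 / eta ^+ 2.
    by rewrite divr_ge0 ?sqr_ge0// mulr_ge0 ?sqr_ge0// mulr_ge0.
  lra.
have Q0 : 0 <= Q by lra.
rewrite -ler_sqr ?nnegrE ?mulr_ge0 ?euclid_ge0//.
rewrite [leRHS]exprMn; apply: le_trans (_ : Q * euclid (z - xi) ^+ 2 <= _); last first.
  by rewrite ler_wpM2r ?sqr_ge0// expr2 ler_peMl.
rewrite !euclid_sqr.
apply: le_trans (_ : \sum_i (2 * (z - xi) ord0 i ^+ 2 + 2 * m ^+ 2) <= _).
  apply: ler_sum => i _.
  have h : (z0 - z) ord0 i ^+ 2 <= m ^+ 2.
    rewrite -[leLHS]real_normK ?num_real// ler_sqr ?nnegrE//; last exact: le_trans zm.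
    exact: le_trans (coord_le_norm _ _) zm.
  have := sqr_ge0 ((z0 - z) ord0 i - (z - xi) ord0 i).
  move: h; rewrite !mxE; move: (z0 ord0 i) (z ord0 i) (xi ord0 i) => a b c.
  by move: (m ^+ 2) => m2; nra.
rewrite big_split /= -mulr_sumr sumr_const card_ord -euclid_sqr /Q [leRHS]mulrDl.
rewrite lerD2l -[leLHS]mulr_natl.
rewrite [leLHS](_ : _ = 2 * d.+1%:R * m ^+ 2 / eta ^+ 2 * eta ^+ 2); last first.
  by move: (m ^+ 2) => m2; field; rewrite gt_eqF.
apply: ler_wpM2l.
  by rewrite divr_ge0 ?sqr_ge0// mulr_ge0 ?sqr_ge0// mulr_ge0.
by rewrite ler_sqr ?nnegrE ?euclid_ge0// (ltW eta0).
Qed.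

Lemma height_near z1 z : `|z - z1| <= height z1 / 2 ->
  height z1 / 2 <= height z <= 2 * height z1.
Proof.
move=> zz; have := le_trans (coord_le_norm (z - z1) ord_max) zz.
rewrite !mxE -!/(height _) ler_norml => /andP[? ?].
have : 0 <= height z1 / 2 by exact: le_trans zz.
by move=> ?; apply/andP; split; lra.
Qed.

(** Derivatives keep the decay of order [d + 1] in the pole, and distances from [z] and from [z0] to
    a boundary pole are comparable; so the kernel at [z0] controls all of them, uniformly for [z]
    near [z1]. *)
Lemma weighted_dominated z0 z1 e : half_space z0 -> half_space z1 ->
  exists2 C : R, 0 <= C & forall z, `|z - z1| <= height z1 / 2 ->
    dominated z0 C (fun xi => weighted d.+1 e xi z).
Proof.
rewrite /half_space /= -!/(height _) => h0 h1.
set eta := height z1 / 2; have eta0 : 0 < eta by rewrite divr_gt0.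
set m := `|z0 - z1| + eta.
set Q := 2 + 2 * d.+1%:R * m ^+ 2 / eta ^+ 2.
have Q0 : 0 < Q.
  rewrite /Q; have : 0 <= 2 * d.+1%:R * m ^+ 2 / eta ^+ 2.
    by rewrite divr_ge0 ?sqr_ge0// mulr_ge0 ?sqr_ge0// mulr_ge0.
  lra.
exists (`|bound eta (2 * height z1) e| * Q ^+ d.+1 / height z0).
  by rewrite divr_ge0 ?(ltW h0)// mulr_ge0// exprn_ge0// ltW.
move=> z zz1 xi xi0.
have /andP[hz hz'] := height_near zz1.
have zp : 0 < height z by exact: lt_le_trans hz.
have Ne : eta <= euclid (z - xi).
  by apply: (le_trans hz); exact: height_le_euclid.
have N0 : 0 < euclid (z - xi) by exact: lt_le_trans Ne.
have N00 : 0 < euclid (z0 - xi) by exact: lt_le_trans (height_le_euclid xi0 h0).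
have zm : `|z0 - z| <= m.
  rewrite (_ : z0 - z = (z0 - z1) - (z - z1)); last first.
    by apply/rowP => i; rewrite !mxE; ring.
  by apply: le_trans (ler_normB _ _) _; rewrite lerD2l.
have NQ := boundary_euclid_le eta0 xi0 hz zm; rewrite -/Q in NQ.
have eb := @eval_bound _ _ eta (2 * height z1) e z xi eta0 _ Ne.
have {}eb : `|eval xi z e| <= bound eta (2 * height z1) e.
  by apply: eb; rewrite -!/(height _) xi0 subr0 ger0_norm// ltW.
rewrite /weighted normrM poisson_boundary//.
rewrite [X in _ * X <= _]ger0_norm; last by rewrite exprn_ge0// invr_ge0 ltW.
rewrite (_ : _ * _ / _ * _ = `|bound eta (2 * height z1) e| *
   (Q ^+ d.+1 / euclid (z0 - xi) ^+ d.+1)); last first.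
  move: (bound _ _ _) (Q ^+ _) (euclid _ ^+ _) (exprn_gt0 d.+1 N00) => b q N Ng.
  by move: (height z0) h0 => y y0; field; rewrite !gt_eqF.
apply: ler_pM => //; first by rewrite exprn_ge0// invr_ge0 ltW.
  exact: le_trans eb (ler_norm _).
rewrite exprVn ler_pdivlMr ?exprn_gt0// mulrC ler_pdivrMr ?exprn_gt0//.
by rewrite -exprMn lerXn2r ?nnegrE ?mulr_ge0 ?(ltW Q0) ?(ltW N0) ?(ltW N00).
Qed.

Lemma move_near z1 j t r : `|t| <= r -> `|move z1 j t - z1| <= r.
Proof.
by move=> tr; apply: le_trans (norm_move_le _ _ _ _) _; rewrite subrr normr0 add0r.
Qed.

Lemma near_euclid_gt0 z1 z xi : half_space z1 -> height xi = 0 ->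
  `|z - z1| <= height z1 / 2 -> 0 < euclid (z - xi).
Proof.
rewrite /half_space /= -!/(height _) => h1 xi0 /height_near /andP[hz _].
have zp : 0 < height z by apply: lt_le_trans hz; rewrite divr_gt0.
exact: lt_le_trans (height_le_euclid xi0 zp).
Qed.

Lemma weighted_lipschitz z0 z1 e j : half_space z0 -> half_space z1 ->
  exists2 C : R, 0 <= C & forall t, `|t| <= height z1 / 2 ->
    dominated z0 (C * `|t|)
     (fun xi => weighted d.+1 e xi (move z1 j t) - weighted d.+1 e xi z1).
Proof.
move=> h0 h1; have [C C0 HC] := weighted_dominated (derivW d.+1 j e) h0 h1.
exists C => // t tr xi xi0.
have := @MVT_bound _ (fun s => weighted d.+1 e xi (move z1 j s))
  (fun s => weighted d.+1 (derivW d.+1 j e) xi (move z1 j s)) t (C * poisson xi z0).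
rewrite /= move0 mulrAC; apply=> s st; have sr := le_trans st tr.
  apply/is_derive_line; apply: is_derive_weighted.
  by apply: (near_euclid_gt0 h1 xi0); exact: move_near.
by apply: HC => //; exact: move_near.
Qed.

(** A remainder quadratic in [t], uniformly over the poles, lets derivatives pass through the
    generalised limit. *)
Lemma weighted_taylor z0 z1 e j : half_space z0 -> half_space z1 ->
  exists2 C : R, 0 <= C & forall t, `|t| <= height z1 / 2 ->
    dominated z0 (C * `|t| ^+ 2)
     (fun xi => weighted d.+1 e xi (move z1 j t) - weighted d.+1 e xi z1
        - t * weighted d.+1 (derivW d.+1 j e) xi z1).
Proof.
move=> h0 h1; have [C C0 HC] := weighted_lipschitz (derivW d.+1 j e) j h0 h1.
exists C => // t tr xi xi0.
have := @taylor2_bound _ (fun s => weighted d.+1 e xi (move z1 j s))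
  (fun s => weighted d.+1 (derivW d.+1 j e) xi (move z1 j s))
  (weighted d.+1 (derivW d.+1 j e) xi z1) t (C * `|t| * poisson xi z0).
rewrite /= move0 (_ : C * `|t| ^+ 2 * _ = C * `|t| * poisson xi z0 * `|t|); last by ring.
apply=> s st; have sr := le_trans st tr.
  apply/is_derive_line; apply: is_derive_weighted.
  by apply: (near_euclid_gt0 h1 xi0); exact: move_near.
apply: le_trans (HC s sr xi xi0) _.
rewrite ler_wpM2r//; last by rewrite ler_wpM2l.
by rewrite ltW// poisson_gt0.
Qed.

Context (s : nat -> seq (R * 'rV[R]_d.+1)) (z0 : 'rV[R]_d.+1) (w0 : R)
  (hs : forall K p, p \in s K -> 0 <= p.1 /\ height p.2 = 0)
  (hz0 : half_space z0) (hw0 : forall K, poisson_comb (s K) z0 = w0)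
  (Lim : (nat -> R) -> R)
  (LimD : forall (a b : nat -> R) (c C : R), (forall K, `|a K| <= C) -> (forall K, `|b K| <= C) ->
        Lim (fun K => a K + c * b K) = Lim a + c * Lim b)
  (Lim_le : forall (a : nat -> R) (c C : R), (forall K, `|a K| <= C) -> (forall K, a K <= c) -> Lim a <= c)
  (Lim_cst : forall (a : nat -> R) (c : R) K0, (forall K, (K0 <= K)%N -> a K = c) -> Lim a = c).

(** [pairing K] integrates over the poles of the [K]-th combination, and [Phi] is its generalised
    limit: a positive functional on dominated functions that stands for a limit measure, any mass
    escaping to infinity included. *)
Let pairing K h := \sum_(p <- s K) p.1 * h p.2.
Let Phi h := Lim (pairing^~ h).

Let pairing_poisson K : pairing K (fun xi => poisson xi z0) = w0.
Proof. exact: hw0. Qed.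

Let pairing_le K h1 h2 : (forall xi, height xi = 0 -> h1 xi <= h2 xi) ->
  pairing K h1 <= pairing K h2.
Proof.
move=> h12; rewrite /pairing !big_seq; apply: ler_sum => p /hs[p0 ph].
exact: ler_wpM2l (h12 _ ph).
Qed.

Let pairingD K h1 h2 c :
  pairing K (fun xi => h1 xi + c * h2 xi) = pairing K h1 + c * pairing K h2.
Proof.
rewrite /pairing mulr_sumr -big_split /=; apply: eq_bigr => p _.
by rewrite mulrDr mulrCA.
Qed.

Let pairingZ K h c : pairing K (fun xi => c * h xi) = c * pairing K h.
Proof. by rewrite /pairing mulr_sumr; apply: eq_bigr => p _; rewrite mulrCA. Qed.

Let pairing_bound K h C : dominated z0 C h -> `|pairing K h| <= C * w0.
Proof.
move=> hC; rewrite -(pairing_poisson K) -pairingZ ler_norml.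
have hC' xi : height xi = 0 -> - (C * poisson xi z0) <= h xi <= C * poisson xi z0.
  by move=> /hC; rewrite ler_norml.
apply/andP; split; last by apply: pairing_le => xi /hC' /andP[].
rewrite -[X in - X]mul1r -mulNr -pairingZ; apply: pairing_le => xi /hC' /andP[].
by rewrite mulN1r.
Qed.

Let w0_ge0 : 0 <= w0.
Proof.
rewrite -(pairing_poisson 0) /pairing big_seq sumr_ge0// => p /hs[p0 ph].
by rewrite mulr_ge0// ltW// poisson_gt0.
Qed.

Let PhiD C1 C2 h1 h2 c : dominated z0 C1 h1 -> dominated z0 C2 h2 ->
  Phi (fun xi => h1 xi + c * h2 xi) = Phi h1 + c * Phi h2.
Proof.
move=> hC1 hC2; rewrite /Phi -(@LimD _ _ _ (Num.max C1 C2 * w0)).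
- by congr Lim; apply/funext => K; rewrite pairingD.
- by move=> K; apply: le_trans (pairing_bound K hC1) _; rewrite ler_wpM2r// le_max lexx.
- by move=> K; apply: le_trans (pairing_bound K hC2) _; rewrite ler_wpM2r// le_max lexx orbT.
Qed.

Let Phi_eq h1 h2 : (forall xi, height xi = 0 -> h1 xi = h2 xi) -> Phi h1 = Phi h2.
Proof.
move=> h12; congr Lim; apply/funext => K; rewrite /pairing !big_seq.
by apply: eq_bigr => p /hs[_ ph]; rewrite h12.
Qed.

Let Phi0 : Phi (fun=> 0) = 0.
Proof.
apply: (@Lim_cst _ _ 0%N) => K _; rewrite /pairing big1// => p _.
by rewrite mulr0.
Qed.

Let Phi_sum (r : seq 'I_d.+1) (h : 'I_d.+1 -> 'rV[R]_d.+1 -> R) (C : 'I_d.+1 -> R) :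
  (forall i, dominated z0 (C i) (h i)) ->
  Phi (fun xi => \sum_(i <- r) h i xi) = \sum_(i <- r) Phi (h i).
Proof.
move=> hC; suff [] : (exists C', dominated z0 C' (fun xi => \sum_(i <- r) h i xi)) /\
  Phi (fun xi => \sum_(i <- r) h i xi) = \sum_(i <- r) Phi (h i) by [].
elim: r => [|i r [[C' hC'] IH]].
  rewrite big_nil; split; last by rewrite -Phi0; apply: Phi_eq => xi _; rewrite big_nil.
  by exists 0 => xi _; rewrite big_nil normr0 mul0r.
split.
  exists (C i + C') => xi xi0; rewrite big_cons mulrDl.
  exact: le_trans (ler_normD _ _) (lerD (hC _ _ xi0) (hC' _ xi0)).
rewrite big_cons -IH -[Phi (fun _ => \sum_(j <- r) _)]mul1r -(PhiD 1 (hC i) hC').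
by apply: Phi_eq => xi _; rewrite big_cons mul1r.
Qed.

Let Phi_le C c h : dominated z0 C h ->
  (forall xi, height xi = 0 -> h xi <= c * poisson xi z0) -> Phi h <= c * w0.
Proof.
move=> hC hc; apply: (@Lim_le _ _ (C * w0)); first by move=> K; exact: pairing_bound.
by move=> K; rewrite -(pairing_poisson K) -pairingZ; exact: pairing_le.
Qed.

Let Phi_norm C h : dominated z0 C h -> `|Phi h| <= C * w0.
Proof.
move=> hC; have hC' xi : height xi = 0 -> - (C * poisson xi z0) <= h xi <= C * poisson xi z0.
  by move=> /hC; rewrite ler_norml.
rewrite ler_norml; apply/andP; split; last first.
  by apply: Phi_le (hC) _ => xi /hC' /andP[].
have hN : dominated z0 0 (fun=> 0) by move=> xi _; rewrite normr0 mul0r.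
rewrite lerNl; have -> : - Phi h = Phi (fun xi => 0 + (-1) * h xi).
  by rewrite (PhiD _ hN hC) Phi0 add0r mulN1r.
apply: (@Phi_le C) => [xi /hC|xi /hC' /andP[? _]].
  by rewrite add0r mulN1r normrN.
by rewrite add0r mulN1r lerNl.
Qed.

(** The limit function is the case [e = Ht]; its partial derivatives have the same form, with
    [derivW] applied to [e]. *)
Let u e z := Phi (fun xi => weighted d.+1 e xi z).

Let weighted_dominated1 e z : half_space z ->
  exists2 C : R, 0 <= C & dominated z0 C (fun xi => weighted d.+1 e xi z).
Proof.
move=> hz; have [C C0 HC] := weighted_dominated e hz0 hz; exists C => //.
by apply: HC; rewrite subrr normr0 divr_ge0// ltW.
Qed.

Let u_derive e z j : half_space z ->
  is_derive z (basis_vec j) (u e) (u (derivW d.+1 j e) z).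
Proof.
move=> hz; have zp : 0 < height z := hz.
have [C C0 HC] := weighted_taylor e j hz0 hz.
have [C1 _ D1] := weighted_dominated1 e hz.
have [C2 _ D2] := weighted_dominated1 (derivW d.+1 j e) hz.
apply: expansion_is_derive => eps eps0.
have w1 : 0 < C * w0 + 1 by have := mulr_ge0 C0 w0_ge0; lra.
exists (Num.min (height z / 2) (eps / (C * w0 + 1))).
  by rewrite lt_min !divr_gt0.
move=> t; rewrite lt_min => /andP[th te].
have hm : half_space (move z j t).
  have := height_near (move_near z j (ltW th)) => /andP[h _].
  by apply: lt_le_trans h; rewrite divr_gt0.
have [C3 _ D3] := weighted_dominated1 e hm.
have D13 : dominated z0 (C3 + C1)
    (fun xi => weighted d.+1 e xi (move z j t) + (-1) * weighted d.+1 e xi z).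
  move=> xi xi0; rewrite mulN1r mulrDl.
  exact: le_trans (ler_normB _ _) (lerD (D3 _ xi0) (D1 _ xi0)).
rewrite (_ : _ - _ = Phi (fun xi => weighted d.+1 e xi (move z j t) +
   (-1) * weighted d.+1 e xi z + (- t) * weighted d.+1 (derivW d.+1 j e) xi z)); last first.
  by rewrite (PhiD _ D13 D2) (PhiD _ D3 D1) mulN1r mulNr.
apply: le_trans (@Phi_norm (C * `|t| ^+ 2) _ _) _.
  by move=> xi xi0; have := HC t (ltW th) xi xi0; rewrite mulN1r mulNr.
rewrite expr2 mulrA mulrAC ler_wpM2r// mulrAC.
apply: le_trans (_ : (C * w0 + 1) * `|t| <= _); first by rewrite ler_wpM2r// lerDl.
by move: te; rewrite ltr_pdivlMr// mulrC => /ltW.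
Qed.

Let u_continuous e z : half_space z -> {for z, continuous (u e)}.
Proof.
move=> hz; have zp : 0 < height z := hz.
have [C C0 HC] : exists2 C : R, 0 <= C & forall j z', `|z' - z| <= height z / 2 ->
    dominated z0 C (fun xi => weighted d.+1 (derivW d.+1 j e) xi z').
  have H j := weighted_dominated (derivW d.+1 j e) hz0 hz.
  exists (\sum_j xget 0 [set C : R | 0 <= C /\ forall z', `|z' - z| <= height z / 2 ->
    dominated z0 C (fun xi => weighted d.+1 (derivW d.+1 j e) xi z')]).
    by apply: sumr_ge0 => j _; case: xgetP => [C _ []|].
  move=> j z' zz' xi xi0; case: (H j) => C C0 HC.
  rewrite (bigD1 j)//=; case: xgetP => [C' _ [C'0 HC']|/(_ C)]; last by case.
  apply: le_trans (HC' _ zz' _ xi0) _; rewrite ler_wpM2r//.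
    by rewrite ltW// poisson_gt0.
  rewrite lerDl sumr_ge0// => i _.
  by case: xgetP => [C'' _ []|].
(* All intermediate points of a coordinate path then stay within [3 * r = height z / 2] of [z],
   where the derivative bounds hold. *)
pose r := height z / 6; have r0 : 0 < r by rewrite divr_gt0.
have lip z' : `|z' - z| <= r -> `|u e z' - u e z| <= d.+1%:R * (C * w0 * `|z' - z|).
  move=> zz'; rewrite -[X in X * `|_|](ger0_norm (mulr_ge0 C0 w0_ge0)).
  apply: (@coordinate_path _ _ (u e) z r (C * w0) (ltW r0)) => // a i t az mz.
  have tr : `|t| <= 2 * r.
    rewrite (_ : t = (move a i t - z) ord0 i - (a - z) ord0 i); last first.
      by rewrite !mxE !eqxx /=; ring.
    apply: le_trans (ler_normB _ _) _.
    have := le_trans (coord_le_norm _ i) az; have := le_trans (coord_le_norm _ i) mz.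
    by move=> ? ?; lra.
  have seg (x : R) : `|x| <= `|t| -> `|move a i x - z| <= height z / 2.
    by move=> xt; have := norm_move_le a z i x; move: tr az xt; rewrite /r; lra.
  have hseg (x : R) : `|x| <= `|t| -> half_space (move a i x).
    by move=> /seg /height_near /andP[h _]; apply: lt_le_trans h; rewrite divr_gt0.
  have := @MVT_bound _ (fun x => u e (move a i x))
    (fun x => u (derivW d.+1 i e) (move a i x)) t (C * w0).
  rewrite /= move0; apply=> x xt; first by apply/is_derive_line; apply: u_derive; exact: hseg.
  by apply: Phi_norm; apply: HC; exact: seg.
apply/(@cvgrPdist_le _ _ _ (nbhs z) (nbhs_filter z)) => eps eps0.
pose Q := d.+1%:R * (C * w0) + 1.
have Q0 : 0 < Q.
  by have := mulr_ge0 (ler0n R d.+1) (mulr_ge0 C0 w0_ge0); rewrite /Q; lra.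
apply/nbhs_ballP; exists (Num.min r (eps / Q)) => /=.
  by rewrite lt_min r0 divr_gt0.
move=> z'; rewrite -ball_normE /= lt_min (distrC z z') (distrC (u e z)) => /andP[h1 h2].
apply: le_trans (lip _ (ltW h1)) _; rewrite mulrA.
apply: le_trans (_ : Q * `|z' - z| <= _); first by rewrite ler_wpM2r// /Q lerDl.
by move: h2; rewrite ltr_pdivlMr// mulrC => /ltW.
Qed.

Let near_half_space z : half_space z -> \forall x \near z, half_space x.
Proof.
move=> hz; have zp : 0 < height z := hz.
apply/nbhs_ballP; exists (height z / 2) => /=; first by rewrite divr_gt0.
move=> z'; rewrite -ball_normE /= (distrC z z') => /ltW /height_near /andP[h _].
by apply: lt_le_trans h; rewrite divr_gt0.
Qed.

(** A derivative of the limit is identified with some [u e] in the half-space only; agreement near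
    each point is enough to differentiate once more. *)
Let u_near (f : 'rV[R]_d.+1 -> R) e z : half_space z ->
  (forall x, half_space x -> f x = u e x) ->
  [/\ {for z, continuous f}, forall j, derivable f z (basis_vec j) &
    forall j, 'D_(basis_vec j) f z = u (derivW d.+1 j e) z].
Proof.
move=> hz fu; have fe : \forall x \near z, u e x = f x.
  by apply: filterS (near_half_space hz) => x /fu ->.
have df j := near_eq_is_derive fe (u_derive e j hz).
split=> [|j|j]; [|by case: (df j)|by case: (df j)].
rewrite /prop_for /continuous_at (fu z hz); apply: cvg_trans (u_continuous (e := e) hz).
exact: (near_eq_cvg fe).
Qed.

Let u_z0 : u (@Ht R d) z0 = w0.
Proof. by apply: (@Lim_cst _ _ 0%N) => K _; exact: hw0. Qed.

(** Domination with exchanged roles: the kernel at [z0] is at most [C] times the kernel at [z],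
    whence [w0] is at most [C] times the limit at [z]. *)
Let u_gt0 z : 0 < w0 -> half_space z -> 0 < u (@Ht R d) z.
Proof.
move=> w00 hz; have [C1 _ D1] := weighted_dominated1 (@Ht R d) hz.
have [C C0 D] := weighted_dominated (@Ht R d) hz hz0.
have {}D : dominated z C (fun xi => poisson xi z0).
  by apply: D; rewrite subrr normr0 divr_ge0// ltW.
have [C2 _ D2] := weighted_dominated1 (@Ht R d) hz0.
have le0 : Phi (fun xi => poisson xi z0 + (- C) * poisson xi z) <= 0 * w0.
  apply: (@Phi_le (C2 + C * C1)) => xi xi0.
    apply: le_trans (ler_normD _ _) _; rewrite mulrDl; apply: lerD (D2 _ xi0) _.
    by rewrite normrM normrN (ger0_norm C0) -mulrA ler_wpM2l// D1.
  rewrite mul0r mulNr subr_le0; exact: le_trans (ler_norm _) (D _ xi0).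
move: le0; rewrite (PhiD _ D2 D1) -!/(u _ _) u_z0 mul0r mulNr subr_le0 => le0.
by rewrite ltNge; apply/negP => /(mulr_ge0_le0 C0); move: le0 w00; lra.
Qed.

Let u_hplus : 0 < w0 -> hplus (u (@Ht R d)).
Proof.
move=> w00; split; last first.
  by move=> z hz; exact: u_gt0.
have d1 f e : (forall x, half_space x -> f x = u e x) -> forall j x, half_space x ->
    'D_(basis_vec j) f x = u (derivW d.+1 j e) x.
  by move=> fu j x hx; have [_ _ ->] := u_near hx fu.
split.
  move=> z hz; have [c dv _] := u_near (f := u (@Ht R d)) hz (fun _ _ => erefl).
  split; first exact: c.
  move=> i; have Di := d1 _ (@Ht R d) (fun _ _ => erefl) i.
  have [ci dvi _] := u_near hz Di.
  split; [exact: dv|exact: ci|move=> j; split; first exact: dvi].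
  by have [] := u_near hz (d1 _ _ Di j).
move=> z hz; rewrite /laplacian.
under eq_bigr => j _ do rewrite (d1 _ _ (d1 _ (@Ht R d) (fun _ _ => erefl) j) j)//.
have H j := weighted_dominated1 (derivW d.+1 j (derivW d.+1 j (@Ht R d))) hz.
have [C HC] : exists C : 'I_d.+1 -> R, forall j, dominated z0 (C j)
  (fun xi => weighted d.+1 (derivW d.+1 j (derivW d.+1 j (@Ht R d))) xi z).
  exists (fun j => xget 0 [set C : R | dominated z0 C
    (fun xi => weighted d.+1 (derivW d.+1 j (derivW d.+1 j (@Ht R d))) xi z)]) => j.
  by case: (H j) => C _ D; case: xgetP => [//|/(_ C)].
rewrite -(Phi_sum _ HC) -[RHS]Phi0; apply: Phi_eq => xi xi0.
by apply: laplacian_poisson; exact: lt_le_trans (height_le_euclid xi0 hz).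
Qed.

Lemma functional_limit : 0 < w0 -> exists2 v : 'rV[R]_d.+1 -> R, hplus v &
  forall z w K0, (forall K, (K0 <= K)%N -> poisson_comb (s K) z = w) -> v z = w.
Proof.
move=> w00; exists (u (@Ht R d)); first exact: u_hplus.
by move=> z w K0; exact: Lim_cst.
Qed.

End PoissonLimit.

Lemma poisson_limit {R : realType} {d : nat} (u : nat -> 'rV[R]_d.+1 -> R) z0 w0 :
  (forall K, poisson_sum (u K)) -> half_space z0 -> 0 < w0 -> (forall K, u K z0 = w0) ->
  exists2 v : 'rV[R]_d.+1 -> R, hplus v &
    forall z w K0, (forall K, (K0 <= K)%N -> u K z = w) -> v z = w.
Proof.
move=> hu hz0 w00 uz0; have [Lim [LimD Lim_le Lim_cst]] := @generalized_limit R.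
pose P K (s : seq (R * 'rV[R]_d.+1)) :=
  (forall p, p \in s -> 0 <= p.1 /\ height p.2 = 0) /\ u K = poisson_comb s.
pose s K := xget [::] [set s | P K s].
have hs K : P K (s K).
  by rewrite /s; case: (hu K) => s' h1 h2; case: xgetP => [//|/(_ s')] [].
have [|v hv ve] := functional_limit (fun K => (hs K).1) hz0 _ LimD Lim_le Lim_cst w00.
  by move=> K; rewrite -(hs K).2.
by exists v => // z w K0 H; apply: (ve _ _ K0) => K /H <-; rewrite -(hs K).2.
Qed.

(** * Interpolation and colouring *)

Section SparseInterpolation.
Context {R : realType} {d : nat} (hd : (1 < d)%N).
Context (z : nat -> 'rV[R]_d.+1) (delta : R).
Context (hz : forall n, half_space (z n)).
Context (delta0 : 0 < delta).
Context (sep : forall n m, n <> m -> delta <= beta (z n) (z m)).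
Context (M alpha : R).
Context (alpha0 : 0 < alpha) (alpha1 : alpha < 1) (M0 : 0 < M).
Context (growth : forall (l n : nat) (s : seq nat), (0 < l)%N -> uniq s ->
  (forall k, k \in s -> beta (z k) (z n) <= l%:R) ->
  (size s)%:R <= M * 2 `^ (alpha * d%:R * l%:R)).

Lemma large_threshold (C e L0 kappa : R) : 0 < C -> 0 < e -> 0 < kappa ->
  exists L : R, [/\ L0 <= L, 2 <= L & C * L `^ (- e) <= kappa].
Proof.
move=> C0 e0 k0; set T := (C / kappa) `^ e^-1.
have T0 : 0 < T by rewrite powR_gt0// divr_gt0.
exists (Num.max L0 2 + T).
have m2 : 2 <= Num.max L0 2 by rewrite le_max lexx orbT.
have mL : L0 <= Num.max L0 2 by rewrite le_max lexx.
split; [lra|lra|].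
have Te : T `^ e = C / kappa.
  by rewrite /T -powRrM mulVf ?gt_eqF// powRr1// divr_ge0 ?(ltW C0) ?(ltW k0).
have : C / kappa <= (Num.max L0 2 + T) `^ e.
  by rewrite -Te; apply: ge0_ler_powR; rewrite ?nnegrE ?(ltW e0)//; lra.
rewrite powRN; have : 0 < (Num.max L0 2 + T) `^ e by rewrite powR_gt0//; lra.
move: (_ `^ e) => X X0.
by rewrite ler_pdivrMr// ler_pdivrMr// mulrC.
Qed.

(** What remains of wide spacing in a union of two colour classes. *)
Definition sparse (A : set nat) (N : R) := forall a b b', A a -> A b -> A b' ->
  b <> a -> b' <> a -> beta (z a) (z b) < N -> beta (z a) (z b') < N -> b = b'.

Lemma sum_le_all_eq (s : seq nat) (f : nat -> R) x B : uniq s -> 0 <= B ->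
  (forall j, j \in s -> j = x /\ f j <= B) -> \sum_(j <- s) f j <= B.
Proof.
move=> us B0 H; case: s us H => [|j [|j' s]] /=.
- by rewrite big_nil.
- by move=> _ /(_ j); rewrite mem_head big_cons big_nil addr0 => /(_ erefl) [].
- move=> /andP[+ _] H; have [-> _] := H j (mem_head _ _).
  by have [-> _] := H j' ltac:(by rewrite !inE eqxx orbT); rewrite inE eqxx.
Qed.

(** Relative to [w i], the near neighbour contributes at most [(1 + k / 4) / (1 + k)] to row [i] and
    the far points at most [kappa = k / (4 * (1 + k))]; together [(1 + k / 2) / (1 + k) < 1]. Hence
    the two conditions on [eps]: [w] changes by a factor at most [1 + k / 4] over distance [N], and
    by at most [hyp^e] in general. *)
Lemma sparse_interpolating : exists2 N : R, 0 < N &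
  forall A, sparse A N -> interpolating A z.
Proof.
have [k [C [e [L0 [k0 C0 e0 L01 HK]]]]] :=
  kernel_row_bound hd hz delta0 sep alpha0 alpha1 M0 growth.
pose kappa := k / (4 * (1 + k)).
have kappa0 : 0 < kappa by rewrite divr_gt0// mulr_gt0//; lra.
have [L [L0L L2 CL]] := large_threshold L0 C0 e0 kappa0.
have Lp : 0 < L by lra.
pose N := log2 L; have LN : 2 `^ N = L by exact: pow2_log2.
have N0 : 0 < N by rewrite /N /log2 divr_gt0 ?ln_gt0//; lra.
exists N => // A sA.
have lk0 : 0 < log2 (1 + k / 4) by rewrite /log2 divr_gt0 ?ln_gt0//; lra.
pose eps := Num.min e (log2 (1 + k / 4) / N).
have eps0 : 0 < eps by rewrite lt_min e0 divr_gt0.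
have epsN : 2 `^ (eps * N) <= 1 + k / 4.
  rewrite -[leRHS]pow2_log2; last lra.
  rewrite ler_powR ?ler1n// -ler_pdivlMr//.
  by rewrite /eps ge_min lexx orbT.
exists eps => // w w0 hw.
have [[n0 An0]|nA] := pselect (exists n0, A n0); last first.
  have [g [gP g1 _ _]] := HK [::] S isT n_Sn.
  have [v hv _] := poisson_limit (fun _ : nat => gP 0%N) (hz 0%N) ltr01 (fun _ => g1 0%N).
  by exists v => // n An; case: nA; exists n.
have w_ratio i j : A i -> A j -> w j <= 2 `^ (eps * beta (z i) (z j)) * w i.
  move=> Ai Aj; have := hw i j Ai Aj; rewrite ler_norml => /andP[h _].
  rewrite -[leLHS](pow2_log2 (w0 _ Aj)) -[X in _ * X](pow2_log2 (w0 _ Ai)).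
  rewrite -powRD; last by apply/implyP => _; rewrite gt_eqF.
  by rewrite ler_powR ?ler1n//; lra.
have w_hyp i j : A i -> A j -> w j <= hyp (z i) (z j) `^ e * w i.
  move=> Ai Aj; apply: le_trans (w_ratio _ _ Ai Aj) _.
  rewrite ler_wpM2r//; first by rewrite ltW// w0.
  have h4 := hyp_ge4 (hz i) (hz j); have b0 := beta_ge0 (hz i) (hz j).
  rewrite mulrC powRrM; apply: le_trans (_ : hyp (z i) (z j) `^ eps <= _).
    apply: ge0_ler_powR; rewrite ?nnegrE ?(ltW eps0) ?powR_ge0//; first lra.
    exact: pow2_beta_le.
  rewrite ler_powR//; first lra.
  by rewrite ge_min lexx.
(* The default [n.+1] merely supplies an index different from [n] when there is no near
   neighbour. *)
pose b n := xget n.+1 [set m | [/\ A m, m <> n & beta (z n) (z m) < N]].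
have nb n : n <> b n by rewrite /b; case: xgetP => [m _ [_ mn _]|_]; [exact/nesym|exact: n_Sn].
have bE i j : A i -> A j -> j <> i -> beta (z i) (z j) < N -> b j = i.
  move=> Ai Aj ji; rewrite beta_sym; [move=> ij|exact: hz|exact: hz].
  rewrite /b; case: xgetP => [m _ [Am mj jm]|/(_ i) []].
    exact: (sA j m i Aj Am Ai mj (nesym ji) jm ij).
  by split; [exact: Ai|exact/nesym|exact: ij].
pose q := (1 + k / 4) / (1 + k) + kappa.
have q01 : 0 <= q < 1.
  rewrite addr_ge0 ?(ltW kappa0) ?divr_ge0//=; try lra.
  rewrite (_ : q = (1 + k / 2) / (1 + k)); last by rewrite /q /kappa; field; lra.
  by rewrite ltr_pdivrMr; lra.
pose F K := [seq n <- iota 0 K | `[< A n >]].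
have uF K : uniq (F K) by rewrite filter_uniq// iota_uniq.
have FA K n : n \in F K -> A n by rewrite mem_filter => /andP[/asboolP].
have sol K : exists2 u, poisson_sum u & forall n, A n -> (n < K)%N -> u (z n) = w n.
  have [g [gP g1 gb gS]] := HK (F K) b (uF K) nb.
  have g0 j a : half_space a -> 0 <= g j a.
    move=> ha; have [s hs ->] := gP j.
    rewrite /poisson_comb big_seq sumr_ge0// => p /hs[p0 ph].
    by rewrite mulr_ge0// ltW// poisson_gt0.
  (* Indices outside [A] get zero entries here and the value [1] in [w'], so the system is indexed
     by all of ['I_K]. *)
  pose E (i j : 'I_K) := if (i != j) && `[< A i >] && `[< A j >] then g j (z i) else 0.
  pose w' (i : nat) := if `[< A i >] then w i else 1.
  have w'0 (i : 'I_K) : 0 < w' i by rewrite /w'; case: asboolP => // /w0.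
  have E0 i j : 0 <= E i j by rewrite /E; case: ifP => // _; exact: g0.
  have row (i : 'I_K) : \sum_j E i j * w' j <= q * w' i.
    have [Ai|nAi] := pselect (A i); last first.
      rewrite big1 => [|j _]; first by rewrite mulr_ge0 ?(ltW (w'0 i))//; case/andP: q01.
      by rewrite /E (asboolF nAi) andbF mul0r.
    have w'i : w' i = w i by rewrite /w' asboolT.
    have wi0 := w0 _ Ai.
    pose near j := beta (z i) (z j) < N.
    have -> : \sum_j E i j * w' j = \sum_(j <- F K | j != i) g j (z i) * w j.
      rewrite /F big_filter_cond (_ : iota 0 K = index_iota 0 K) ?big_mkord; last by rewrite /index_iota subn0.
      rewrite [RHS]big_mkcond.
      apply: eq_bigr => j _; rewrite /E /w' (asboolT Ai) andbT eq_sym andbC.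
      by case: ifP => [/andP[-> _]//|]; rewrite mul0r.
    rewrite w'i mulrDl (bigID near) /=; apply: lerD.
    - rewrite -big_filter; apply: (@sum_le_all_eq _ _ (b i)).
      + by rewrite filter_uniq.
      + by rewrite mulr_ge0 ?(ltW wi0)// divr_ge0//; lra.
      move=> j; rewrite mem_filter => /andP[/andP[/eqP ji ij] /FA Aj].
      have ji' : beta (z j) (z i) < N by rewrite beta_sym; [exact: ij|exact: hz|exact: hz].
      split; first exact: esym (bE j i Aj Ai (nesym ji) ji').
      (* Nearness is symmetric: [i] is the very neighbour against which the kernel of [z j] was
         built. *)
      have gj : g j (z i) <= (1 + k)^-1.
        by have := gb j; rewrite (bE i j Ai Aj ji ij) -ler_pdivlMl ?mulr1//; lra.
      have wj : w j <= (1 + k / 4) * w i.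
        apply: le_trans (w_ratio _ _ Ai Aj) _; rewrite ler_wpM2r ?(ltW wi0)//.
        apply: le_trans epsN; rewrite ler_powR ?ler1n// ler_wpM2l ?(ltW eps0)//.
        exact: ltW.
      apply: le_trans (ler_pM _ _ gj wj) _; [exact: g0|exact/ltW/w0|].
      by rewrite mulrA [_^-1 * _]mulrC.
    - rewrite -big_filter.
      have iF : (i : nat) \in F K by rewrite mem_filter mem_iota asboolT//= ltn_ord.
      pose S := [seq j : nat <- F K | (j != i) && ~~ near j].
      have := gS L i S L0L iF (filter_uniq _ (uF K)).
      have H n : n \in S -> L <= hyp (z i) (z n).
        rewrite mem_filter => /andP[/andP[_]]; rewrite /near -leNgt => Nb _.
        apply: le_trans (pow2_beta_le (hz i) (hz n)).
        by rewrite -LN ler_powR// ler1n.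
      move=> /(_ H) le1; apply: le_trans (_ : kappa * w i <= _) => //.
      apply: le_trans (ler_wpM2r (ltW wi0) (le_trans le1 CL)).
      rewrite mulr_suml !big_seq; apply: ler_sum => j.
      rewrite mem_filter => /andP[_ /FA Aj].
      rewrite mulrAC mulrC ler_wpM2r ?g0//.
      exact: w_hyp.
  have [c c0 cE] := positive_solution q01 w'0 E0 row.
  exists (fun a => \sum_(i < K) (if `[< A i >] then c i else 0) * g i a).
    by apply: poisson_sum_sum => i; apply: poisson_sumZ => //; case: ifP => // _; exact/ltW.
  move=> n An nK; pose m := Ordinal nK.
  have -> : w n = w' m by rewrite /w' asboolT.
  rewrite -(cE m) (bigD1 m)//= [in RHS](bigD1 m)//=.
  have Emm : E m m = 0 by rewrite /E eqxx.
  rewrite Emm mul0r add0r (asboolT An) g1 mulr1; congr (_ + _).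
  apply: eq_bigr => j jm; rewrite /E eq_sym jm /= (asboolT An) /=.
  by case: ifP => _; rewrite ?mul0r ?mul1r// mulrC.
have [u [uP uE]] : exists u : nat -> 'rV[R]_d.+1 -> R,
    (forall K, poisson_sum (u K)) /\ forall K n, A n -> (n < K)%N -> u K (z n) = w n.
  pose P K u := poisson_sum u /\ forall n, A n -> (n < K)%N -> u (z n) = w n.
  exists (fun K => xget (fun=> 0) [set u | P K u]).
  have H K : P K (xget (fun=> 0) [set u | P K u]).
    by have [v v1 v2] := sol K; case: xgetP => [//|/(_ v)] [].
  by split=> K; case: (H K).
(* The shift by [n0.+1] gives every term the value [w n0] at [z n0], the normalisation that controls
   the masses. *)
have [v hv vE] := poisson_limit (u := fun K => u (K + n0.+1)%N) (fun K => uP _) (hz n0) (w0 _ An0)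
  (fun K => uE _ _ An0 (leq_addl _ _)).
exists v => // n An; apply: (vE _ _ n) => K nK; apply: uE => //.
by rewrite (leq_ltn_trans nK)// addnS ltnS leq_addr.
Qed.

End SparseInterpolation.

(** * Greedy colouring of a graph with few earlier neighbours *)

Section GreedyColoring.
Context (e : rel nat) (D : nat).
Context (deg : forall n (s : seq nat), uniq s ->
  (forall k, k \in s -> (k < n)%N && e k n) -> (size s <= D)%N).

(** [f n] settles the colours of the indices below [n]. At most [D] earlier neighbours leave one of
    the [D + 1] colours free, and later stages never revise a colour ([stable]). *)
Lemma greedy_coloring : exists c : nat -> 'I_D.+1,
  forall m n, (m < n)%N -> e m n -> c m <> c n.
Proof.
pose nbrs n := [seq k <- iota 0 n | e k n].
pose next n (f : nat -> 'I_D.+1) := odflt ord0 [pick c | c \notin map f (nbrs n)].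
pose fix f n : nat -> 'I_D.+1 :=
  if n is n'.+1 then fun k => if (k < n')%N then f n' k else next n' (f n')
  else fun=> ord0.
have nextP n : next n (f n) \notin map (f n) (nbrs n).
  rewrite /next; case: pickP => [//|all_used] /=.
  have : (#|'I_D.+1| <= size (map (f n) (nbrs n)))%N.
    rewrite cardE; apply: uniq_leq_size; first exact: enum_uniq.
    by move=> x _; have := all_used x => /negbFE.
  rewrite card_ord size_map leqNgt ltnS => /negP[]; apply: (@deg n).
    by rewrite filter_uniq// iota_uniq.
  by move=> k; rewrite mem_filter mem_iota => /andP[-> /andP[_ ->]].
have stable n k : (k < n)%N -> f n k = f k.+1 k.
  elim: n => // n IH; rewrite ltnS leq_eqVlt => /orP[/eqP->//|kn].
  by rewrite -IH//= kn.
exists (fun n => f n.+1 n) => m n mn emn; rewrite -(stable n)//= ltnn => H.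
have /negP := nextP n; apply; rewrite -H; apply/mapP; exists m => //.
by rewrite mem_filter emn mem_iota.
Qed.

End GreedyColoring.

Unset Implicit Arguments.

Theorem theorem11 (R : realType) (d : nat) (hd : (1 < d)%N)
    (z : nat -> 'rV[R]_d.+1) (hz : forall n, half_space (z n))
    (hsep : separated_seq z) :
  (interpolating setT z ->
     exists M alpha : R, [/\ 0 < M, 0 < alpha, alpha < 1 &
       growth_bound z M alpha])
  /\
  ((exists M alpha : R, [/\ 0 < M, 0 < alpha, alpha < 1 &
      growth_bound z M alpha]) ->
   exists (N : nat) (Lambda : 'I_N -> set nat),
     [/\ trivIset setT Lambda,
         \bigcup_i Lambda i = setT &
         forall i j, interpolating (Lambda i `|` Lambda j) z]).
Proof.
have [delta delta0 sep] : exists2 delta : R, 0 < delta &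
    forall n m, n <> m -> delta <= beta (z n) (z m).
  exists (inf [set b : R | exists n m, n <> m /\ b = beta (z n) (z m)]) => // n m nm.
  apply: ge_inf; last by exists n, m.
  by exists 0 => _ [k [l [_ ->]]]; exact: beta_ge0.
have zinj : injective z.
  move=> n m znm; apply: contrapT => /sep.
  by rewrite znm beta_refl leNgt delta0.
split.
  move=> /(interpolating_growth hz delta0 sep hd)[M [alpha [M0 a0 a1 G]]].
  by exists M, alpha; split=> //; apply/growth_boundP => //; exact: ltW.
move=> [M [alpha [M0 a0 a1 /(growth_boundP _ zinj (ltW M0)) G]]].
have [N N0 sparseP] := sparse_interpolating hd hz delta0 sep a0 a1 M0 G.
(* Two points within [N] of a third are less than [2 * N + 6] apart, so points of one colour are
   kept farther apart than [l > 2 * N + 6]. *)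
pose l := Num.bound (2 * N + 7).
have lN : 2 * N + 6 < l%:R :> R.
  by have := @archi_boundP R (2 * N + 7) ltac:(lra); rewrite -/l; lra.
have l0 : (0 < l)%N by rewrite -(ltr0n R); lra.
pose B := M * 2 `^ (alpha * d%:R * l%:R).
have B0 : 0 <= B by rewrite mulr_ge0 ?powR_ge0// ltW.
(* By the growth condition [B] bounds the number of points in a ball of radius [l], so [D] bounds
   the degrees of the proximity graph. *)
pose D := Num.bound B.
have [|c cP] := @greedy_coloring (fun k n => beta (z k) (z n) <= l%:R) D.
  move=> n s us hs; rewrite -(ler_nat R).
  apply: le_trans (ltW (archi_boundP B0)); apply: G l0 us _ => k /hs /andP[_ h].
  exact: h.
have cE m n : m <> n -> beta (z m) (z n) <= l%:R -> c m <> c n.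
  have [mn _|nm _|//] := ltngtP m n; first exact: cP.
  by rewrite beta_sym// => /(cP _ _ nm) /nesym.
exists D.+1, (fun i => [set n | c n = i]); split.
- by move=> i j _ _ [n [/= -> ->]].
- by apply/seteqP; split => // n _; exists (c n).
move=> i j; apply: sparseP => a b b' Aa Ab Ab' ba b'a ab ab'.
have Nl : N <= l%:R by move: (l%:R : R) lN => x; lra.
have cb := cE _ _ (nesym ba) (ltW (lt_le_trans ab Nl)).
have cb' := cE _ _ (nesym b'a) (ltW (lt_le_trans ab' Nl)).
(* Neither [b] nor [b'] has the colour of [a] and only two colours occur, so they share the other
   one; being less than [2 * N + 6] apart, they coincide. *)
have bb' : c b = c b'.
  by move: Aa Ab Ab' cb cb' => /= [<-|<-] [->|->] [->|->].
apply: contrapT => /cE; apply => //.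
have := beta_quasi_triangle (hz b) (hz a) (hz b'); rewrite (beta_sym (hz b) (hz a)).
move: (beta _ _) (beta _ _) (beta _ _) ab ab' (l%:R : R) lN => x y t ? ? r ? ?; lra.
Qed.
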